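(* Let $1<s<3/2$ and $z\in\mathbb{D}$. For $N\ge1$ and $X\in\mathrm{Conf}(\mathbb{D})$ define the $A^2(\mathbb{D})$-valued linear statistic \[ \Theta_N^{(s,z)}(X)=\sum_{x\in X\cap\mathcal{U}_N(z)}e^{-sd_{\mathrm{h}}(z,x)}K(\cdot,x),\qquad \mathcal{U}_N(z)=\{x\in\mathbb{D}:d_{\mathrm{h}}(z,x)<N\}. \] Then, $\mathbb{P}_K$-almost surely, \[ \lim_{N\to\infty}\frac{\|\Theta_N^{(s,z)}\|_{A^2(\mathbb{D})}^2}{\mathbb{E}\big[\|\Theta_N^{(s,z)}\|_{A^2(\mathbb{D})}^2\big]}=1, \] where $\mathbb{E}$ denotes expectation with respect to $\mathbb{P}_K$.
   Context: $\mathbb{D}$ is the open unit disk, $\mathrm{d}\mu=\frac{1}{\pi}\mathrm{d}x\,\mathrm{d}y$, $A^2(\mathbb{D})$ is the Hilbert space of holomorphic functions on $\mathbb{D}$ square integrable w.r.t. $\mu$, with reproducing kernel $K(z,w)=(1-z\overline{w})^{-2}$. $\mathrm{Conf}(\mathbb{D})$ is the space of locally finite subsets of $\mathbb{D}$; $\mathbb{P}_K$ is the determinantal point process on $\mathbb{D}$ whose $k$-point correlation functions w.r.t. $\mu^{\otimes k}$ are $\det[K(x_i,x_j)]_{1\le i,j\le k}$. The hyperbolic distance is $d_{\mathrm{h}}(z,x)=\log\frac{1+|\varphi_z(x)|}{1-|\varphi_z(x)|}$, $\varphi_z(x)=\frac{z-x}{1-\overline{z}x}$. *)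

(* Defs.v *)
From HB Require Import structures.
From mathcomp Require Import all_boot all_order all_algebra.
From mathcomp Require Import all_classical all_reals all_analysis.
From mathcomp Require Import measurable_realfun complex.
Set Implicit Arguments. Unset Strict Implicit. Unset Printing Implicit Defensive.
Import Order.TTheory GRing.Theory Num.Theory.
Import numFieldNormedType.Exports.
Local Open Scope classical_set_scope.
Local Open Scope ring_scope.

Section Defs.
Variable R : realType.

Definition pt := (R * R)%type.
Definition toC (p : pt) : R[i] := Complex p.1 p.2.
Definition sqmod (w : R[i]) : R := (complex.Re w) ^+ 2 + (complex.Im w) ^+ 2.
Definition cmod (w : R[i]) : R := Num.sqrt (sqmod w).

Definition disk : set pt := [set p | p.1 ^+ 2 + p.2 ^+ 2 < 1].

Definition Kc (z w : R[i]) : R[i] := ((1 - z * conjc w) ^+ 2)^-1.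
Definition Kp (x y : pt) : R[i] := Kc (toC x) (toC y).

Definition phi (z x : R[i]) : R[i] := (z - x) / (1 - conjc z * x).
Definition dh (z x : R[i]) : R :=
  ln ((1 + cmod (phi z x)) / (1 - cmod (phi z x))).

Definition U (N : R) (z : R[i]) : set pt := [set x | disk x /\ dh z (toC x) < N].

Definition leb2 := ((@lebesgue_measure R) \x (@lebesgue_measure R))%E.

Definition muint (A : set pt) (f : pt -> \bar R) : \bar R :=
  ((pi^-1)%:E * \int[leb2]_(w in A) f w)%E.

(* k-fold integral w.r.t. mu^{(x) k} over disk^k, written as an iterated integral *)
Fixpoint iter_muint (k : nat) (g : seq pt -> \bar R) : \bar R :=
  match k with
  | 0 => g [::]
  | k'.+1 => muint disk (fun x => iter_muint k' (fun s => g (x :: s)))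
  end.

(* k-point correlation function det[K(x_i,x_j)] (a real number) *)
Definition rho (s : seq pt) : R :=
  complex.Re (\det (\matrix_(i < size s, j < size s) Kp (nth (0,0) s i) (nth (0,0) s j))).

Definition npts (X B : set pt) : \bar R := (\esum_(x in X `&` B) 1)%E.

Definition relcompact (B : set pt) : Prop :=
  exists r : R, r < 1 /\ B `<=` [set p | p.1 ^+ 2 + p.2 ^+ 2 <= r].

Definition conf (X : set pt) : Prop :=
  X `<=` disk /\ forall B, relcompact B -> finite_set (X `&` B).

Definition eprod (l : seq (\bar R)) : \bar R := foldr (fun a b => a * b)%E 1%E l.

(* X : Omega -> Conf(D) is a point process whose k-point correlation functions
   w.r.t. mu^{(x) k} are det[K(x_i,x_j)] (Hough-Krishnapur-Peres-Virag, Def. 1.2.2) *)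
Definition is_DPP_K d (Omega : measurableType d) (P : probability Omega R)
    (X : Omega -> set pt) : Prop :=
  (forall w, conf (X w)) /\
  (forall B, measurable B -> relcompact B ->
     measurable_fun setT (fun w => npts (X w) B)) /\
  (forall Bs : seq (set pt),
     (forall B, B \in Bs -> measurable B /\ relcompact B) ->
     (forall i j, (i < j < size Bs)%N -> nth set0 Bs i `&` nth set0 Bs j = set0) ->
     (\int[P]_w eprod [seq npts (X w) B | B <- Bs])%E =
     iter_muint (size Bs) (fun s =>
       ((\prod_(i < size Bs) (\1_(nth set0 Bs i) (nth (0,0) s i) : R)) * rho s)%:E)).

Definition Theta (s : R) (z : R[i]) (N : R) (X : set pt) (w : pt) : R[i] :=
  (\sum_(x \in X `&` U N z) Complex (expR (- s * dh z (toC x))) 0 * Kp w x)%R.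

Definition A2normsq (f : pt -> R[i]) : \bar R := muint disk (fun w => (sqmod (f w))%:E).

End Defs.

(* Main.v *)
(** Expanding the square with the reproducing formula, the squared norm of Theta_N
    is the pair statistic T_N = sum_{x,y} q(x,y) over the points of the process in
    U_N(z), where q(x,y) = g(x) g(y) Re K(x,y) and g = exp(- s d_h(z,.)).

    The first two moments of T_N involve the correlation functions of order at
    most four.  They are obtained as limits of finite sums over the cells of finer
    and finer grids of U_N(z), which is legitimate because K is Lipschitz there and
    all moments of the number of points are finite.  For Hermitian determinants,
    rho(A u B) - rho(A) rho(B) is bounded by prod K(x,x) times the sum of
    |K(a,b)|^2 / (K(a,a) K(b,b)) over a in A, b in B, and since
    int |K(a,b)|^2 dmu(b) = K(a,a), this gives
      Var T_N <= C int Q(x)^2 K(x,x) dmu(x),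
      Q(x) = q(x,x) + int |q(x,y)| K(y,y) dmu(y).

    Put t = 1 - |x|^2, tau = exp(-N) and a = 3 - 2s, which lies in (0,1).  On U_N,
    g is comparable to t^s, and t >= c tau.  In polar coordinates
    Q(x) <= C t^(2s-2-eps), so that Var T_N <= C tau^(-a-2eps).  On the other hand
    the points with t of order tau already give E T_N >= c tau^(-a): the mass
    int_{U_N} |K(x,y)|^2 dmu(y) misses a fixed proportion of K(x,x) there.  Hence
    Var T_N / (E T_N)^2 <= C exp(- (a - 2eps) N) is summable, and T_N / E T_N tends
    to 1 almost surely. *)

(* Correlation functions only give expectations of products of counts over disjoint sets, whereas
   T_N^2 is a sum over quadruples with arbitrary coincidences. On a grid that separates the points
   of a configuration every count is 0 or 1, hence idempotent, and a product with repeated cells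
   equals the product over the distinct ones. This absorbs all coincidences. The price is that the
   estimates are proved for finite sums, with explicit distortion constants, and cross to the limit
   afterwards. Measurability of the inner integrands of the iterated integrals is never established:
   they are only squeezed between constants, which monotonicity allows. The loss eps comes from a
   pointwise interpolation that replaces the exact asymptotics of int g(y) |K(x,y)| K(y,y) dmu(y)
   and costs a factor 1/eps; it is affordable because only a > 2 eps is needed. The two conditions
   on s have separate uses: s < 3/2 makes the mean grow like a power of exp(N), and s > 1 makes
   t^(-a) integrable. *)
Require Import Defs.
From HB Require Import structures.
From mathcomp Require Import all_boot all_order all_algebra perm.
From mathcomp Require Import all_classical all_reals all_analysis.
From mathcomp Require Import measurable_realfun complex.
From mathcomp Require Import ring lra.
Set Implicit Arguments. Unset Strict Implicit. Unset Printing Implicit Defensive.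
Import Order.TTheory GRing.Theory Num.Theory.
Import numFieldNormedType.Exports.
Local Open Scope classical_set_scope.
Local Open Scope ring_scope.

(** * Rotation invariance of planar Lebesgue measure *)

Section PlanarLebesgue.
Variable R : realType.
Local Notation leb := (@lebesgue_measure R).
Local Notation lam := (leb \x leb)%E.
Implicit Types (f : pt R -> \bar R).
Local Open Scope ereal_scope.

(** By uniqueness: the translated measure also gives every interval its length. *)
Lemma lebesgue_measure_shift (a : R) (A : set R) : measurable A ->
  leb A = leb ((fun x : R => x + a)%R @^-1` A).
Proof.
have mf : measurable_fun setT (fun x : measurableTypeR R => (x + a)%R : measurableTypeR R).
  by apply: measurable_funD.
move=> mA; rewrite -[RHS]/(pushforward leb (fun x : measurableTypeR R => (x + a)%R : measurableTypeR R) A).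
apply: lebesgue_measure_unique => //= _ [[u v]] _ <-; rewrite /pushforward /=.
rewrite (_ : _ @^-1` _ = `](u - a)%R, (v - a)%R]%classic); last first.
  by apply/seteqP; split => x /=; rewrite !in_itv /= ltrBlDr lerBrDr.
rewrite !lebesgue_measure_itv /= !lte_fin ltrD2r.
by case: ifP => // _; congr EFin; ring.
Qed.

Lemma ge0_integral_shift (a : R) (f : R -> \bar R) : measurable_fun setT f ->
  (forall x, 0 <= f x) -> \int[leb]_x f (x + a)%R = \int[leb]_x f x.
Proof.
move=> mf f0.
have mg : measurable_fun setT (fun x : measurableTypeR R => (x + a)%R : measurableTypeR R).
  by apply: measurable_funD.
rewrite -[LHS](_ : \int[leb]_(x in (fun x : measurableTypeR R => (x + a)%R : measurableTypeR R) @^-1` setT) (f \o (fun x => x + a)%R) x = _); last by rewrite preimage_setT.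
rewrite -(ge0_integral_pushforward mg) //.
apply: eq_measure_integral => A mA _; exact/esym/lebesgue_measure_shift.
Qed.

Lemma measurable_fst_pt : measurable_fun setT (fun p : pt R => p.1 : R).
Proof. exact: measurable_fst. Qed.
Lemma measurable_snd_pt : measurable_fun setT (fun p : pt R => p.2 : R).
Proof. exact: measurable_snd. Qed.

(** With the second coordinate integrated last, the shear is a translation on each horizontal
    line. *)
Lemma integral_shear1 (a : R) f : measurable_fun setT f -> (forall p, 0 <= f p) ->
  \int[lam]_p f (p.1 + a * p.2, p.2)%R = \int[lam]_p f p.
Proof.
move=> mf f0.
have mg : measurable_fun setT (fun p : pt R => (p.1 + a * p.2, p.2)%R : pt R).
  apply/measurable_fun_pairP; split => /=; last exact: measurable_snd_pt.
  by apply: measurable_funD; [exact: measurable_fst_pt|apply: measurable_funM => //; exact: measurable_snd_pt].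
rewrite (@fubini_tonelli2 _ _ _ _ _ leb leb (fun p : pt R => f (p.1 + a * p.2, p.2)%R)) //; last first.
  exact: (measurableT_comp mf mg).
rewrite (@fubini_tonelli2 _ _ _ _ _ leb leb f) //.
apply: eq_integral => y _; rewrite /fubini_G /=.
apply: (ge0_integral_shift (a * y) (f := fun x => f (x, y))) => //.
exact: measurableT_comp.
Qed.

Lemma integral_shear2 (a : R) f : measurable_fun setT f -> (forall p, 0 <= f p) ->
  \int[lam]_p f (p.1, p.2 + a * p.1)%R = \int[lam]_p f p.
Proof.
move=> mf f0.
have mg : measurable_fun setT (fun p : pt R => (p.1, p.2 + a * p.1)%R : pt R).
  apply/measurable_fun_pairP; split => /=; first exact: measurable_fst_pt.
  by apply: measurable_funD; [exact: measurable_snd_pt|apply: measurable_funM => //; exact: measurable_fst_pt].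
rewrite (@fubini_tonelli1 _ _ _ _ _ leb leb (fun p : pt R => f (p.1, p.2 + a * p.1)%R)) //; last first.
  exact: (measurableT_comp mf mg).
rewrite (@fubini_tonelli1 _ _ _ _ _ leb leb f) //.
apply: eq_integral => x _; rewrite /fubini_F /=.
apply: (ge0_integral_shift (a * x) (f := fun y => f (x, y))) => //.
exact: measurableT_comp.
Qed.

Definition rot (c s : R) (p : pt R) : pt R := (c * p.1 - s * p.2, s * p.1 + c * p.2)%R.

Lemma measurable_rot c s : measurable_fun setT (rot c s).
Proof.
have m1 (a : R) : measurable_fun setT (fun p : pt R => a * p.1)%R.
  by apply: measurable_funM => //; exact: measurable_fst_pt.
have m2 (a : R) : measurable_fun setT (fun p : pt R => a * p.2)%R.
  by apply: measurable_funM => //; exact: measurable_snd_pt.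
apply/measurable_fun_pairP; split => /=.
  exact: measurable_funB.
exact: measurable_funD.
Qed.

Lemma ge0_integral_rot (c s : R) f : (c ^+ 2 + s ^+ 2 = 1)%R ->
  measurable_fun setT f -> (forall p, 0 <= f p) ->
  \int[lam]_p f (rot c s p) = \int[lam]_p f p.
Proof.
(* A rotation of angle not in pi Z is a product of three shears. *)
have gen (u v : R) g : (v != 0)%R -> (u ^+ 2 + v ^+ 2 = 1)%R ->
    measurable_fun setT g -> (forall p, 0 <= g p) ->
    \int[lam]_p g (rot u v p) = \int[lam]_p g p.
  (* If u and v are the cosine and sine of theta, then a = -tan(theta/2), the slope of the two outer
     shears. *)
  move=> v0 uv mg g0; pose a := ((u - 1) / v)%R.
  have m1 b : measurable_fun setT (fun p : pt R => (p.1 + b * p.2, p.2)%R : pt R).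
    apply/measurable_fun_pairP; split => /=; last exact: measurable_snd_pt.
    by apply: measurable_funD; [exact: measurable_fst_pt|apply: measurable_funM => //; exact: measurable_snd_pt].
  have m2 b : measurable_fun setT (fun p : pt R => (p.1, p.2 + b * p.1)%R : pt R).
    apply/measurable_fun_pairP; split => /=; first exact: measurable_fst_pt.
    by apply: measurable_funD; [exact: measurable_snd_pt|apply: measurable_funM => //; exact: measurable_fst_pt].
  rewrite -(integral_shear1 a mg g0).
  rewrite -(integral_shear2 v (f := fun p => g (p.1 + a * p.2, p.2)%R)) //; last exact: (measurableT_comp mg (m1 a)).
  rewrite -(integral_shear1 a (f := fun p => g (p.1 + a * (p.2 + v * p.1), p.2 + v * p.1)%R)) //; last first.
    exact: (measurableT_comp (measurableT_comp mg (m1 a)) (m2 v)).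
  apply: eq_integral => p _; congr g; rewrite /rot /a /=.
  have vu : (v ^+ 2 = 1 - u ^+ 2)%R by rewrite -uv; ring.
  congr (_, _); last by field.
  have -> : (p.1 + (u - 1) / v * p.2 + (u - 1) / v * (p.2 + v * (p.1 + (u - 1) / v * p.2)) = u * p.1 + (u - 1) / v * (u + 1) * p.2)%R by field.
  rewrite (_ : (u - 1) / v * (u + 1) = - v)%R; first by rewrite mulNr.
  apply: (mulIf v0); transitivity (- v ^+ 2)%R; last by rewrite expr2 mulNr.
  by rewrite vu; field.
move=> cs mf f0; have [s0|s0] := eqVneq s 0%R; last exact: gen.
have : (c == 1)%R || (c == -1)%R by rewrite -sqrf_eq1 -cs s0 expr0n addr0.
case/orP => /eqP c1.
  by apply: eq_integral => -[x y] _; rewrite /rot c1 s0 /= !mul1r !mul0r subr0 add0r.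
(* The half turn is treated as the square of the quarter turn. *)
have i1 : (0 ^+ 2 + 1 ^+ 2 = 1 :> R)%R by rewrite expr0n expr1n add0r.
rewrite -(gen 0%R 1%R f) ?oner_neq0 //.
rewrite -(gen 0%R 1%R (fun p => f (rot 0 1 p))) ?oner_neq0 //; last first.
  exact: measurableT_comp mf (measurable_rot _ _).
apply: eq_integral => -[x y] _; rewrite /rot c1 s0 /=; congr (f (_, _)); ring.
Qed.

End PlanarLebesgue.

(** * Area of discs and polar integration *)

Section DiskArea.
Variable R : realType.
Local Notation leb := (@lebesgue_measure R).
Local Notation lam := (leb \x leb)%E.

Definition nrm2 (p : pt R) : R := p.1 ^+ 2 + p.2 ^+ 2.

Lemma nrm2_ge0 p : 0 <= nrm2 p.
Proof. by rewrite addr_ge0 ?sqr_ge0. Qed.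

Lemma measurable_nrm2 : measurable_fun setT nrm2.
Proof.
by apply: measurable_funD; apply: measurable_funX; [exact: measurable_fst_pt|exact: measurable_snd_pt].
Qed.

(** Substitution of x = r sin theta: the integrand becomes 2 r^2 cos^2 theta, with primitive r^2
    (theta + sin theta cos theta). *)
Lemma integral_half_circle (r : R) : 0 < r ->
  (\int[leb]_(x in `[(- r)%R, r]) (2 * Num.sqrt (r ^+ 2 - x ^+ 2))%:E = (pi * r ^+ 2)%:E)%E.
Proof.
move=> r0; pose F x : R := r * sin x.
have pi2 : 0 < pi / 2 :> R by rewrite divr_gt0 ?pi_gt0.
have Fa : F (- (pi / 2)) = - r by rewrite /F sinN sin_pihalf mulrN1.
have Fb : F (pi / 2) = r by rewrite /F sin_pihalf mulr1.
have dF (x : R) : is_derive x 1 F (r * cos x).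
  by apply: is_derive_eq.
have F'E : (derive1 F) = (fun x => r * cos x).
  by apply/funext => x; rewrite derive1E (@derive_val _ _ _ _ _ _ _ (dF x)).
have cF : continuous F.
  by move=> x; apply/differentiable_continuous/derivable1_diffP; case: (dF x).
have cF' : continuous (derive1 F).
  rewrite F'E => x; apply: (@continuousM _ _ (fun=> r) cos); first exact: cvg_cst.
  exact: continuous_cos.
rewrite -{1}Fa -{1}Fb.
rewrite (integration_by_substitution_increasing (G := fun x => 2 * Num.sqrt (r ^+ 2 - x ^+ 2))).
- pose H x : R := r ^+ 2 * (x + sin x * cos x).
  have dH (x : R) : is_derive x 1 H (2 * (r * cos x) * (r * cos x)).
    have -> : 2 * (r * cos x) * (r * cos x) = r ^+ 2 * (1 + (sin x * - sin x + cos x * cos x)).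
      have -> : sin x * - sin x = cos x ^+ 2 - 1 by rewrite mulrN -expr2 sin2cos2; ring.
      ring.
    by apply: is_derive_eq.
  have cH : continuous H.
    by move=> x; apply/differentiable_continuous/derivable1_diffP; case: (dH x).
  pose H' (x : R) : R := 2 * (r * cos x) * (r * cos x).
  transitivity (\int[leb]_(x in `[(- (pi / 2))%R, (pi / 2)%R]) (H' x)%:E)%E.
    apply: eq_integral => x; rewrite inE /= in_itv /= => xI.
    rewrite F'E /F /H'; congr EFin => /=; congr (_ * _ * _).
    have -> : r ^+ 2 - (r * sin x) ^+ 2 = (r * cos x) ^+ 2.
      by rewrite [in RHS]exprMn cos2sin2; ring.
    rewrite sqrtr_sqr ger0_norm //; apply: mulr_ge0; first exact: ltW.
    exact: cos_ge0_pihalf.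
  rewrite (@continuous_FTC2 R H' H).
  - rewrite -EFinB /H cosN cos_pihalf !mulr0 !addr0; congr EFin; by field.
  - by rewrite gtrN.
  - apply: continuous_subspaceT => x.
    have cF'x : {for x, continuous (fun y => r * cos y)} by have := cF' x; rewrite F'E.
    apply: (@continuousM _ _ (fun y : R => 2 * (r * cos y)) (fun y : R => r * cos y)) => //.
    apply: (@continuousM _ _ (fun=> 2) (fun y : R => r * cos y)) => //; exact: cvg_cst.
  - split => [x _| |]; first by case: (dH x).
    + by apply: cvg_at_right_filter; exact: cH.
    + by apply: cvg_at_left_filter; exact: cH.
  - by move=> x _; rewrite derive1E (@derive_val _ _ _ _ _ _ _ (dH x)).
- by rewrite ltW // gtrN.
- move=> x y xI yI xy; rewrite /F ltr_pM2l //.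
  by rewrite ltr_sin.
- by move=> x _; exact: cF'.
- by apply: (cvgP (derive1 F (- (pi / 2)))); apply: cvg_at_right_filter; exact: cF'.
- by apply: (cvgP (derive1 F (pi / 2))); apply: cvg_at_left_filter; exact: cF'.
- split => [x _| |]; first by case: (dF x).
  + by apply: cvg_at_right_filter; exact: cF.
  + by apply: cvg_at_left_filter; exact: cF.
- apply: continuous_subspaceT => x.
  apply: (@continuousM R R (fun=> 2) (fun y : R => Num.sqrt (r ^+ 2 - y ^+ 2))); first exact: cvg_cst.
  apply: continuous_comp; last exact: sqrt_continuous.
  by apply: continuousB; [exact: cvg_cst|exact: exprn_continuous].
Qed.

Lemma ler_sqr_itv (v y : R) : 0 <= v -> (y ^+ 2 <= v ^+ 2) = (- v <= y <= v).
Proof.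
by move=> v0; rewrite -ler_norml -[y ^+ 2]real_normK ?num_real // ler_sqr ?nnegrE.
Qed.

(** Integration of the lengths of vertical chords. For u <= 0 the sections lie in {0}; [Num.max]
    keeps one formula for all u, as wanted when discs are subtracted to give annuli. *)
Lemma disk_area (u : R) : (lam [set p | nrm2 p <= u]%R = (pi * Num.max u 0)%:E)%E.
Proof.
rewrite /product_measure1 /=.
have [u0|u0] := leP u 0.
  rewrite mulr0.
  transitivity (\int[leb]_(x in setT) (cst 0 x : \bar R))%E; last by rewrite integral0.
  apply: eq_integral => x _.
  apply/eqP; rewrite eq_le measure_ge0 andbT.
  rewrite [X in (_ <= X)%E](_ : _ = leb [set (0:R)]); last by rewrite lebesgue_measure_set1.
  apply: le_measure; rewrite ?inE //.
    apply: measurable_xsection; rewrite -[X in measurable X]setTI.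
    by apply: (measurable_fun_le (f := nrm2) (g := fun=> u)) => //; exact: measurable_nrm2.
  move=> y; rewrite /xsection /= inE /nrm2 /= => h.
  have : x ^+ 2 + y ^+ 2 == 0 by rewrite eq_le (le_trans h u0) addr_ge0 ?sqr_ge0.
  by rewrite paddr_eq0 ?sqr_ge0 // !sqrf_eq0 => /andP[_ /eqP].
rewrite -[u]sqr_sqrtr ?ltW //; set r := Num.sqrt u.
have r0 : 0 < r by rewrite sqrtr_gt0.
rewrite -integral_half_circle //.
rewrite [RHS]integral_mkcond /=; apply: eq_integral => x _.
rewrite patchE mem_setE in_itv /=.
have E : xsection [set p | nrm2 p <= r ^+ 2] x = [set y | y ^+ 2 <= r ^+ 2 - x ^+ 2].
  by apply/seteqP; split => y; rewrite /xsection /= inE /nrm2 /= lerBrDl.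
rewrite E; case: ifPn => [xr|xr].
  have d0 : 0 <= r ^+ 2 - x ^+ 2 by rewrite subr_ge0 ler_sqr_itv // ltW.
  set v := Num.sqrt _.
  have v0 : 0 <= v by rewrite sqrtr_ge0.
  have -> : [set y | y ^+ 2 <= r ^+ 2 - x ^+ 2] = `[- v, v]%classic.
    by apply/seteqP; split => y /=; rewrite in_itv /= -ler_sqr_itv // /v (sqr_sqrtr d0).
  rewrite lebesgue_measure_itv /= lte_fin.
  case: ltP => [_|vv]; first by rewrite -EFinD opprK mulr_natl mulr2n.
  have -> : v = 0 by apply/eqP; rewrite eq_le v0 andbT; lra.
  by rewrite mulr0.
rewrite [X in leb X](_ : _ = set0) ?measure0 //.
rewrite -subset0 => y /= h; move/negP: xr; apply.
rewrite -ler_sqr_itv; last exact: ltW.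
by rewrite -subr_ge0; apply: le_trans h; exact: sqr_ge0.
Qed.

End DiskArea.

Section NormalizedArea.
Variable R : realType.
Local Notation leb := (@lebesgue_measure R).
Local Notation lam := (leb \x leb)%E.
Local Notation mR := (measurableTypeR R).

Lemma piV_ge0 : 0 <= pi^-1 :> R.
Proof. by rewrite invr_ge0 pi_ge0. Qed.

Definition mu := mscale (NngNum piV_ge0) lam.
HB.instance Definition _ := Measure.on mu.

Lemma muE (A : set (pt R)) : mu A = ((pi^-1)%:E * lam A)%E.
Proof. by []. Qed.

Lemma measurable_set_ltr d (T : measurableType d) (f g : T -> R) :
  measurable_fun setT f -> measurable_fun setT g -> measurable [set p | f p < g p].
Proof.
move=> mf mg; rewrite -[X in measurable X]setTI.
have := measurable_fun_ltr mf mg measurableT (I : measurable [set true]).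
by congr measurable; apply/seteqP; split => p /=.
Qed.

Lemma measurable_disk : measurable (@disk R).
Proof.
by apply: (@measurable_set_ltr _ _ (@nrm2 R) (fun=> 1)) => //; exact: measurable_nrm2.
Qed.

Lemma measurable_nrm2_le (u : R) : measurable [set p : pt R | nrm2 p <= u].
Proof.
rewrite -[X in measurable X]setTI.
by apply: (measurable_fun_le (f := @nrm2 R) (g := fun=> u)) => //; exact: measurable_nrm2.
Qed.

Lemma ge0_muintE (A : set (pt R)) (f : pt R -> \bar R) :
  measurable A -> measurable_fun A f -> (forall x, A x -> (0 <= f x)%E) ->
  muint A f = (\int[mu]_(x in A) f x)%E.
Proof. by move=> mA mf f0; rewrite ge0_integral_mscale. Qed.

Lemma mu_nrm2_le (u : R) : mu [set p : pt R | nrm2 p <= u] = (Num.max u 0)%:E.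
Proof.
by rewrite muE disk_area -EFinM mulrA mulVf ?mul1r // gt_eqF // pi_gt0.
Qed.

Lemma mu_annulus (a b : R) : a <= b ->
  mu [set p : pt R | a < nrm2 p <= b] = (Num.max b 0 - Num.max a 0)%:E.
Proof.
move=> ab.
have -> : [set p : pt R | a < nrm2 p <= b] =
    [set p | nrm2 p <= b] `\` [set p | nrm2 p <= a].
  apply/seteqP; split => p /=; first by move=> /andP[h1 h2]; split => //; apply/negP; rewrite -ltNge.
  by move=> [h1 /negP h2]; rewrite h1 andbT ltNge.
rewrite measureD; [|exact: measurable_nrm2_le|exact: measurable_nrm2_le|]; last first.
  by rewrite [X in (X < _)%E](_ : _ = (Num.max b 0)%:E) ?ltry // -mu_nrm2_le.
rewrite setIidr; last by move=> p /= /le_trans; apply.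
by rewrite EFinB; congr (_ - _)%E; exact: mu_nrm2_le.
Qed.

(** A disc of squared radius u has mass u, so [nrm2] carries mu to Lebesgue measure on the
    half-line. This stands in for polar coordinates. *)
Lemma ge0_integral_radial (h : R -> \bar R) : measurable_fun setT h ->
  (forall x, (0 <= h x)%E) ->
  (\int[mu]_(p in @disk R) h (nrm2 p) = \int[leb]_(u in `[0%R, 1%R[) h u)%E.
Proof.
move=> mh h0.
have E1 : @disk R = @nrm2 R @^-1` `[0%R, 1%R[%classic.
  apply/seteqP; split => p /=; rewrite in_itv /= /disk /=; first by move=> ?; rewrite nrm2_ge0.
  by move=> /andP[].
rewrite E1 -(@ge0_integral_pushforward _ _ (mR * mR)%type mR R (@nrm2 R) (@measurable_nrm2 R) mu _ h) //; last first.
  exact: measurable_funTS.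
(* Lebesgue measure on the negative half-line completes the image measure to one on the whole line,
   where the values on intervals determine it. *)
have lebE A : measurable A -> leb A = measure_add (pushforward mu (@nrm2 R : (mR * mR)%type -> mR)) (mrestr leb (measurable_itv `]-oo, 0%R])) A.
  apply: lebesgue_measure_unique => _ [[a b]] _ <-.
  rewrite [RHS]/= /msum 2!big_ord_recl big_ord0 adde0.
  change (leb `]a, b] = mu (@nrm2 R @^-1` `]a, b]%classic) + leb (`]a, b]%classic `&` `]-oo, 0%R]%classic))%E.
  rewrite [X in mu X](_ : _ = [set p | a < nrm2 p <= b]); last by apply/seteqP; split => p /=; rewrite in_itv.
  rewrite [X in (_ + leb X)%E](_ : _ = `]a, Num.min b 0]%classic); last first.
    apply/seteqP; split => x /=; rewrite !in_itv /= le_min; first by move=> [/andP[-> ->] ->].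
    by move=> /andP[-> /andP[-> ->]].
  rewrite !lebesgue_measure_itv /= !lte_fin; have [ab|ba] := ltP a b; last first.
    rewrite [X in mu X](_ : _ = set0); last by rewrite -subset0 => p /= /andP[] /lt_le_trans /[apply]; rewrite ltNge ba.
    by rewrite measure0 add0e lt_min ltNge ba.
  rewrite mu_annulus ?ltW // lt_min ab /=.
  have [a0|a0] := ltP a 0; have [b0|b0] := leP b 0; rewrite -?EFinB -?EFinD; congr EFin; lra.
apply: eq_measure_integral => [|m A mA AS]; first exact: measurable_nrm2.
change (mu (@nrm2 R @^-1` A) = leb A).
rewrite (lebE m) // measure_addE.
change (mu (@nrm2 R @^-1` A) = mu (@nrm2 R @^-1` A) + leb (A `&` `]-oo, 0%R]%classic))%E.
rewrite -[LHS]adde0; congr (_ + _)%E.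
apply/esym/eqP; rewrite eq_le measure_ge0 andbT.
rewrite -(lebesgue_measure_set1 0); apply: le_measure; rewrite ?inE //.
  by apply: measurableI.
move=> x [/AS /=]; rewrite !in_itv /= => /andP[x0 _] x0'.
by apply/eqP; rewrite eq_le x0 x0'.
Qed.

End NormalizedArea.

(** * Complex arithmetic on pairs of reals *)

Section ComplexFacts.
Variable R : realType.
Implicit Types (z w : R[i]) (p x y : pt R).
Local Notation Re := (@complex.Re R).
Local Notation Im := (@complex.Im R).

Lemma sqmodE z : (sqmod z)%:C%C = z * conjc z.
Proof. by case: z => a b; rewrite /sqmod /=; simpc; congr Complex; ring. Qed.

Lemma sqmodM z w : sqmod (z * w) = sqmod z * sqmod w.
Proof. by case: z => a b; case: w => c d; rewrite /sqmod /=; ring. Qed.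

Lemma sqmod1 : sqmod (1 : R[i]) = 1.
Proof. by rewrite /sqmod /= expr1n expr0n addr0. Qed.

Lemma sqmodX z n : sqmod (z ^+ n) = sqmod z ^+ n.
Proof. by elim: n => [|n IH]; rewrite ?expr0 ?sqmod1 // !exprS sqmodM IH. Qed.

Lemma sqmod_conj z : sqmod (conjc z) = sqmod z.
Proof. by case: z => a b; rewrite /sqmod /= sqrrN. Qed.

Lemma sqmodN z : sqmod (- z) = sqmod z.
Proof. by case: z => a b; rewrite /sqmod /= !sqrrN. Qed.

Lemma sqmod_ge0 z : 0 <= sqmod z.
Proof. by rewrite addr_ge0 ?sqr_ge0. Qed.

Lemma sqmod_eq0 z : (sqmod z == 0) = (z == 0).
Proof. by case: z => a b; rewrite /sqmod /= paddr_eq0 ?sqr_ge0 // !sqrf_eq0 eq_complex. Qed.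

Lemma sqmod0 : sqmod (0 : R[i]) = 0.
Proof. by apply/eqP; rewrite sqmod_eq0. Qed.

Lemma sqmodV z : sqmod z^-1 = (sqmod z)^-1.
Proof.
have [->|z0] := eqVneq z 0; first by rewrite invr0 sqmod0 invr0.
have s0 : sqmod z != 0 by rewrite sqmod_eq0.
by apply: (mulIf s0); rewrite -sqmodM !mulVf // sqmod1.
Qed.

Lemma sqmodR (a : R) : sqmod (Complex a 0) = a ^+ 2.
Proof. by rewrite /sqmod /= expr0n addr0. Qed.

Lemma cmod_ge0 z : 0 <= cmod z. Proof. exact: sqrtr_ge0. Qed.

Lemma cmod_sqr z : cmod z ^+ 2 = sqmod z.
Proof. by rewrite sqr_sqrtr // sqmod_ge0. Qed.

Lemma cmodM z w : cmod (z * w) = cmod z * cmod w.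
Proof. by rewrite /cmod sqmodM sqrtrM // sqmod_ge0. Qed.

Lemma cmod1 : cmod (1 : R[i]) = 1. Proof. by rewrite /cmod sqmod1 sqrtr1. Qed.

Lemma cmodX z n : cmod (z ^+ n) = cmod z ^+ n.
Proof. by elim: n => [|n IH]; rewrite ?expr0 ?cmod1 // !exprS cmodM IH. Qed.

Lemma cmodV z : cmod z^-1 = (cmod z)^-1.
Proof. by rewrite /cmod sqmodV sqrtrV // sqmod_ge0. Qed.

Lemma cmod_conj z : cmod (conjc z) = cmod z.
Proof. by rewrite /cmod sqmod_conj. Qed.

Lemma cmodN z : cmod (- z) = cmod z.
Proof. by rewrite /cmod sqmodN. Qed.

Lemma cmodR (a : R) : cmod (Complex a 0) = `|a|.
Proof. by rewrite /cmod sqmodR sqrtr_sqr. Qed.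

Lemma cmodD z w : cmod (z + w) <= cmod z + cmod w.
Proof. by have := le_normcD z w; case: z => a b; case: w => c d. Qed.

Lemma cmodB z w : cmod (z - w) <= cmod z + cmod w.
Proof. by rewrite -(cmodN w) cmodD. Qed.

Lemma cmod_distB z w : cmod z - cmod w <= cmod (z - w).
Proof. by rewrite lerBlDr -{1}(subrK w z) cmodD. Qed.

Lemma cmod_sum (I : Type) (s : seq I) (P : pred I) (F : I -> R[i]) :
  cmod (\sum_(i <- s | P i) F i) <= \sum_(i <- s | P i) cmod (F i).
Proof.
elim/big_ind2: _ => //; first by rewrite /cmod sqmod0 sqrtr0.
by move=> a b c d ab cd; apply: le_trans (cmodD _ _) _; exact: lerD.
Qed.

Lemma Re_le_cmod z : `|Re z| <= cmod z.
Proof.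
by rewrite -ler_sqr ?nnegrE ?cmod_ge0 // cmod_sqr real_normK ?num_real // lerDl sqr_ge0.
Qed.

Lemma Im_le_cmod z : `|Im z| <= cmod z.
Proof.
by rewrite -ler_sqr ?nnegrE ?cmod_ge0 // cmod_sqr real_normK ?num_real // lerDr sqr_ge0.
Qed.

Lemma ReD z w : Re (z + w) = Re z + Re w. Proof. by case: z; case: w. Qed.
Lemma ImD z w : Im (z + w) = Im z + Im w. Proof. by case: z; case: w. Qed.
Lemma ReN z : Re (- z) = - Re z. Proof. by case: z. Qed.
Lemma ImN z : Im (- z) = - Im z. Proof. by case: z. Qed.
Lemma ReM z w : Re (z * w) = Re z * Re w - Im z * Im w. Proof. by case: z; case: w. Qed.
Lemma ImM z w : Im (z * w) = Re z * Im w + Im z * Re w.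
Proof. by case: z => a b; case: w. Qed.
Lemma ReJ z : Re (conjc z) = Re z. Proof. by case: z. Qed.
Lemma ImJ z : Im (conjc z) = - Im z. Proof. by case: z. Qed.
Lemma ReZ (a : R) z : Re (Complex a 0 * z) = a * Re z.
Proof. by rewrite ReM /= mul0r subr0. Qed.
Lemma Re_sum (I : Type) (s : seq I) (P : pred I) (F : I -> R[i]) :
  Re (\sum_(i <- s | P i) F i) = \sum_(i <- s | P i) Re (F i).
Proof. by elim/big_rec2: _ => // i a b _ <-; rewrite ReD. Qed.

Lemma ReV z : Re z^-1 = Re z / sqmod z.
Proof. by case: z. Qed.
Lemma ImV z : Im z^-1 = - Im z / sqmod z.
Proof. by case: z => a b; rewrite /sqmod /= mulNr. Qed.

Lemma conjcM z w : conjc (z * w) = conjc z * conjc w.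
Proof. by case: z => a b; case: w => c d; simpc; congr Complex; ring. Qed.

Lemma conjcD z w : conjc (z + w) = conjc z + conjc w.
Proof. by case: z => a b; case: w => c d; simpc; congr Complex; ring. Qed.

Lemma conjcX z n : conjc (z ^+ n) = conjc z ^+ n.
Proof. by elim: n => [|n IH]; rewrite ?expr0 ?conjc1 // !exprS conjcM IH. Qed.

Lemma sqmod_toC p : sqmod (toC p) = nrm2 p.
Proof. by []. Qed.

Lemma cmod_toC_lt1 p : disk p -> cmod (toC p) < 1.
Proof. by move=> dp; rewrite -sqrtr1 ltr_sqrt. Qed.

Lemma toC_rot c s p : toC (rot c s p) = Complex c s * toC p.
Proof. by case: p => a b; rewrite /toC /rot /=; simpc; congr Complex; ring. Qed.

Lemma nrm2_rot c s p : c ^+ 2 + s ^+ 2 = 1 -> nrm2 (rot c s p) = nrm2 p.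
Proof.
by move=> cs; rewrite -!sqmod_toC toC_rot sqmodM [sqmod (Complex c s)]cs mul1r.
Qed.

(** Rotation by zeta reverses the sign of a monomial whose two exponents differ by k. *)
Lemma exists_unimodular_root (k : nat) : (0 < k)%N ->
  exists2 zeta : R[i], sqmod zeta = 1 & zeta ^+ k = -1.
Proof.
move=> k0; exists (k.-root (-1 : R[i])); last by rewrite rootCK.
have : sqmod (k.-root (-1 : R[i])) ^+ k = 1 by rewrite -sqmodX rootCK // sqmodN sqmod1.
by move/eqP; rewrite pexpr_eq1 ?sqmod_ge0 // => /eqP.
Qed.

Definition cmeas (f : pt R -> R[i]) :=
  measurable_fun setT (fun p => Re (f p)) /\ measurable_fun setT (fun p => Im (f p)).

Lemma cmeas_cst z : cmeas (fun=> z).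
Proof. by split. Qed.

Lemma cmeas_toC : cmeas (@toC R).
Proof. by split; [exact: measurable_fst_pt|exact: measurable_snd_pt]. Qed.

Lemma cmeasD f g : cmeas f -> cmeas g -> cmeas (fun p => f p + g p).
Proof.
move=> [f1 f2] [g1 g2]; split.
  by under eq_fun do rewrite ReD; exact: measurable_funD.
by under eq_fun do rewrite ImD; exact: measurable_funD.
Qed.

Lemma cmeasN f : cmeas f -> cmeas (fun p => - f p).
Proof.
move=> [f1 f2]; split.
  by under eq_fun do rewrite ReN; exact: measurableT_comp.
by under eq_fun do rewrite ImN; exact: measurableT_comp.
Qed.

Lemma cmeasJ f : cmeas f -> cmeas (fun p => conjc (f p)).
Proof.
move=> [f1 f2]; split.
  by under eq_fun do rewrite ReJ.
by under eq_fun do rewrite ImJ; exact: measurableT_comp.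
Qed.

Lemma cmeasM f g : cmeas f -> cmeas g -> cmeas (fun p => f p * g p).
Proof.
move=> [f1 f2] [g1 g2]; split.
  by under eq_fun do rewrite ReM; apply: measurable_funB; exact: measurable_funM.
by under eq_fun do rewrite ImM; apply: measurable_funD; exact: measurable_funM.
Qed.

Lemma cmeasX f n : cmeas f -> cmeas (fun p => f p ^+ n).
Proof.
move=> mf; elim: n => [|n IH].
  by under [X in cmeas X]eq_fun do rewrite expr0; exact: cmeas_cst.
by under [X in cmeas X]eq_fun do rewrite exprS; exact: cmeasM.
Qed.

Lemma cmeas_sum (I : Type) (s : seq I) (F : I -> pt R -> R[i]) :
  (forall i, cmeas (F i)) -> cmeas (fun p => \sum_(i <- s) F i p).
Proof.
move=> mF; elim: s => [|i s IH].
  by under [X in cmeas X]eq_fun do rewrite big_nil; exact: cmeas_cst.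
by under [X in cmeas X]eq_fun do rewrite big_cons; exact: cmeasD.
Qed.

Lemma measurable_sqmod f : cmeas f -> measurable_fun setT (fun p => sqmod (f p)).
Proof. by move=> [f1 f2]; apply: measurable_funD; apply: measurable_funX. Qed.

Lemma cmeasV f : cmeas f -> cmeas (fun p => (f p)^-1).
Proof.
move=> mf; have [f1 f2] := mf; have ms := measurable_sqmod mf.
have msV : measurable_fun setT (fun p => (sqmod (f p))^-1).
  have -> : (fun p => (sqmod (f p))^-1) = (@powR R ^~ (-1)) \o (fun p => sqmod (f p)).
    by apply/funext => p /=; rewrite powR_inv1 ?sqmod_ge0.
  by apply: measurableT_comp => //; exact: measurable_powR.
split.
  by under eq_fun do rewrite ReV; exact: measurable_funM.
by under eq_fun do rewrite ImV; apply: measurable_funM => //; exact: measurableT_comp.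
Qed.

End ComplexFacts.

(** * Integrals of monomials and of the Bergman kernel *)

Section Orthogonality.
Variable R : realType.
Local Notation leb := (@lebesgue_measure R).
Local Notation lam := (leb \x leb)%E.
Local Notation mR := (measurableTypeR R).
Local Notation mu := (@mu R).
Local Notation D := (@disk R).
Local Notation Re := (@complex.Re R).
Local Notation Im := (@complex.Im R).
Implicit Types (p : pt R).

Lemma mu_disk : mu D = 1%E.
Proof.
have H : (\int[mu]_(p in D) 1 = \int[leb]_(u in `[0%R, 1%R[) 1)%E.
  by apply: (@ge0_integral_radial R (fun=> 1%E)) => //; exact: measurable_cst.
move: H; rewrite !integral_cst //=; last exact: measurable_disk.
by rewrite !mul1e => ->; rewrite lebesgue_measure_itv /= lte_fin ltr01 oppr0 adde0.
Qed.

Lemma mu_disk_lty : (mu D < +oo)%E.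
Proof. by rewrite mu_disk ltry. Qed.

Lemma integrable_disk (f : pt R -> R) (M : R) : measurable_fun setT f ->
  (forall p, D p -> `|f p| <= M) -> mu.-integrable D (EFin \o f).
Proof.
move=> mf fM; apply: measurable_bounded_integrable => //.
- exact: measurable_disk.
- exact: mu_disk_lty.
- exact: measurable_funTS.
- by exists M; split; rewrite ?num_real // => x Mx p Dp; apply: le_trans (fM p Dp) (ltW Mx).
Qed.

Lemma ge0_integral_disk_rot (c s : R) (f : pt R -> \bar R) : c ^+ 2 + s ^+ 2 = 1 ->
  measurable_fun setT f -> (forall p, (0 <= f p)%E) ->
  (\int[mu]_(p in D) f (rot c s p) = \int[mu]_(p in D) f p)%E.
Proof.
move=> cs mf f0.
have mfr := measurableT_comp mf (@measurable_rot R c s).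
have mD := @measurable_disk R.
have mf1 : measurable_fun D (fun p => f (rot c s p)) by exact: (measurable_funTS mfr).
have mf2 : measurable_fun D f by exact: measurable_funTS.
rewrite !ge0_integral_mscale //.
congr (_ * _)%E.
rewrite [LHS]integral_mkcond [RHS]integral_mkcond.
rewrite -(@ge0_integral_rot R c s (f \_ D)) //; first last.
- by move=> p; rewrite patchE; case: ifP.
- by apply/(measurable_restrictT _ mD).
apply: eq_integral => p _; rewrite /patch /=.
suff -> : (rot c s p \in D) = (p \in D) by [].
have Dn q : D q = (nrm2 q < 1) by [].
by apply/idP/idP => /set_mem H; apply/mem_set; move: H; rewrite !Dn nrm2_rot.
Qed.

Lemma Rintegral_disk_rot (c s : R) (f : pt R -> R) : c ^+ 2 + s ^+ 2 = 1 ->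
  measurable_fun setT f ->
  \int[mu]_(p in D) f (rot c s p) = \int[mu]_(p in D) f p.
Proof.
move=> cs mf; rewrite /Rintegral; congr fine.
have mf' : measurable_fun setT (EFin \o f) by exact/measurable_EFinP.
rewrite [LHS]integralE [RHS]integralE; congr (_ - _)%E.
  rewrite -(@ge0_integral_disk_rot c s (EFin \o f)^\+%E cs) //; last exact: measurable_funepos.
  by apply: eq_integral => p _; rewrite !funeposE.
rewrite -(@ge0_integral_disk_rot c s (EFin \o f)^\-%E cs) //; last exact: measurable_funeneg.
by apply: eq_integral => p _; rewrite !funenegE.
Qed.

Definition radial_moment (h : R -> R) (n : nat) : R :=
  \int[leb]_(u in `[0, 1[) (h u * u ^+ n).

Section Weight.
Variables (h : R -> R) (M : R).
Hypotheses (mh : measurable_fun setT h) (h0 : forall u, 0 <= h u) (hM : forall u, h u <= M).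

Lemma measurable_wt (f : pt R -> R[i]) : cmeas f ->
  measurable_fun setT (fun p => h (nrm2 p) * Re (f p)).
Proof.
move=> [mf _]; apply: measurable_funM => //.
exact: (measurableT_comp mh (@measurable_nrm2 R)).
Qed.

Lemma toC_conjM p n : toC p ^+ n * conjc (toC p) ^+ n = Complex (nrm2 p ^+ n) 0.
Proof.
rewrite -exprMn -sqmodE sqmod_toC; elim: n => [|n IH]; first by rewrite !expr0.
by rewrite !exprS IH; simpc; congr Complex; ring.
Qed.

Lemma cmeas_monomial (a : R[i]) n m :
  cmeas (fun p => a * (toC p ^+ n * conjc (toC p) ^+ m)).
Proof.
apply: cmeasM; first exact: cmeas_cst.
by apply: cmeasM; apply: cmeasX; [|apply: cmeasJ]; exact: cmeas_toC.
Qed.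

(** Monomials are orthogonal for every radial weight: if n and m differ, some rotation changes the
    sign of the integrand and preserves the integral; if they agree, the integrand is radial. *)
Lemma integral_monomial (a : R[i]) n m :
  \int[mu]_(p in D) (h (nrm2 p) * Re (a * (toC p ^+ n * conjc (toC p) ^+ m))) =
  if n == m then Re a * radial_moment h n else 0.
Proof.
set f := fun p => h (nrm2 p) * Re (a * (toC p ^+ n * conjc (toC p) ^+ m)).
have mf : measurable_fun setT f by apply: measurable_wt; exact: cmeas_monomial.
case: eqVneq => [nm|nm].
  subst m.
  have mhn : measurable_fun setT (fun u : R => (h u * u ^+ n)%:E).
    by apply/measurable_EFinP; apply: measurable_funM => //; exact: measurable_funX.
  have E : \int[mu]_(p in D) (h (nrm2 p) * nrm2 p ^+ n) = radial_moment h n.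
    rewrite /radial_moment /Rintegral; congr fine.
    (* The radial formula asks for nonnegativity on the whole line, and [u ^+ n] may be negative for
       u < 0; hence the maximum with 0. *)
    have := @ge0_integral_radial R (fun u => (h u * (Num.max u 0) ^+ n)%:E).
    move=> H; transitivity (\int[mu]_(p in D) (h (nrm2 p) * (Num.max (nrm2 p) 0) ^+ n)%:E)%E.
      by apply: eq_integral => p _; rewrite (max_idPl _) // nrm2_ge0.
    rewrite H.
    - by apply: eq_integral => u; rewrite inE /= in_itv /= => /andP[u0 _]; rewrite (max_idPl _).
    - apply/measurable_EFinP; apply: measurable_funM => //; apply: measurable_funX.
      by apply: measurable_maxr.
    - by move=> u; rewrite lee_fin mulr_ge0 // exprn_ge0 // le_max lexx orbT.
  rewrite -E -RintegralZl; last first.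
  - apply: (@integrable_disk _ M).
      apply: measurable_funM; first exact: (measurableT_comp mh (@measurable_nrm2 R)).
      by apply: measurable_funX; exact: measurable_nrm2.
    move=> p Dp; rewrite normrM !ger0_norm ?exprn_ge0 ?nrm2_ge0 //.
    rewrite -[leRHS]mulr1 ler_pM ?exprn_ge0 ?nrm2_ge0 //.
    by rewrite exprn_ile1 ?nrm2_ge0 // ltW.
  - exact: measurable_disk.
  by apply: eq_Rintegral => p _; rewrite /f toC_conjM ReM /= mulr0 subr0; ring.
have [zeta z1 zk] : exists2 zeta : R[i], sqmod zeta = 1 & zeta ^+ n * conjc zeta ^+ m = -1.
  have zz (zeta : R[i]) k : sqmod zeta = 1 -> zeta ^+ k * conjc zeta ^+ k = 1.
    by move=> z1; rewrite -exprMn -sqmodE z1 expr1n.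
  have [lt|lt|eq] := ltngtP n m; last by rewrite eq eqxx in nm.
    have [|zeta z1 zk] := exists_unimodular_root R (k := m - n); first by rewrite subn_gt0.
    exists zeta => //; rewrite -(subnKC (ltnW lt)) exprD mulrA zz // mul1r.
    by rewrite -conjcX zk; apply/eqP; rewrite eq_complex /= !oppr0 !eqxx.
  have [|zeta z1 zk] := exists_unimodular_root R (k := n - m); first by rewrite subn_gt0.
  by exists zeta => //; rewrite -(subnK (ltnW lt)) exprD -mulrA zz // mulr1.
have fr p : f (rot (Re zeta) (Im zeta) p) = - f p.
  rewrite /f nrm2_rot // -mulrN -ReN; congr (_ * Re _).
  rewrite toC_rot (_ : Complex _ _ = zeta); last by case: (zeta).
  rewrite conjcM !exprMn -mulrN; congr (_ * _).
  by rewrite mulrACA zk mulN1r.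
have : \int[mu]_(p in D) (-1 * f p) = \int[mu]_(p in D) f p.
  rewrite -(@Rintegral_disk_rot (Re zeta) (Im zeta) f z1 mf).
  by apply: eq_Rintegral => p _; rewrite fr mulN1r.
rewrite RintegralZl; last first.
- apply: (@integrable_disk _ (M * cmod a)) => // p Dp.
  rewrite /f normrM ger0_norm // ler_pM //.
  apply: le_trans (Re_le_cmod _) _; rewrite !cmodM !cmodX cmod_conj -[leRHS]mulr1.
  rewrite ler_wpM2l ?cmod_ge0 // mulr_ile1 ?exprn_ge0 ?cmod_ge0 // exprn_ile1 ?cmod_ge0 //; exact/ltW/cmod_toC_lt1.
- exact: measurable_disk.
by rewrite mulN1r; set I := Rintegral _ _ _; lra.
Qed.

End Weight.
End Orthogonality.

(** * Limits and finite sums under the integral *)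

Section IntegralLimits.
Context d (T : measurableType d) (R : realType) (nu : {measure set T -> \bar R}).

Lemma fatou_bound (D : set T) (f : (T -> \bar R)^nat) (g : T -> \bar R) (B : \bar R) :
  measurable D -> (forall n, measurable_fun D (f n)) ->
  (forall n x, D x -> (0 <= f n x)%E) ->
  (forall x, D x -> f ^~ x @ \oo --> g x) ->
  (forall n, (\int[nu]_(x in D) f n x <= B)%E) -> (\int[nu]_(x in D) g x <= B)%E.
Proof.
move=> mD mf f0 fg fB.
have -> : (\int[nu]_(x in D) g x = \int[nu]_(x in D) limn_einf (f^~ x))%E.
  apply: eq_integral => x; rewrite inE => Dx.
  rewrite is_cvg_limn_einfE; last by apply: cvgP (fg _ Dx).
  by apply/esym/cvg_lim => //; exact: fg.
apply: le_trans (fatou _ _ _ _) _ => //.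
rewrite limn_einf_lim; apply: lime_le.
  exact: is_cvg_einfs.
apply: nearW => n; rewrite /einfs; apply: le_trans (fB n).
by apply: ereal_inf_lbound; exists n => //=.
Qed.

Lemma Rintegral_sum (I : Type) (D : set T) (f : I -> T -> R) (r : seq I) :
  measurable D -> (forall i, nu.-integrable D (EFin \o f i)) ->
  \int[nu]_(x in D) (\sum_(i <- r) f i x) = \sum_(i <- r) \int[nu]_(x in D) f i x.
Proof.
move=> mD fi; rewrite /Rintegral.
rewrite (eq_integral (fun x => (\sum_(i <- r) (f i x)%:E)%E)); last by move=> x _; rewrite sumEFin.
rewrite integral_sum // -sum_fine // => i _.
exact: (integrable_fin_num mD (fi i)).
Qed.

Lemma integrable_sumr (I : Type) (D : set T) (f : I -> T -> R) (r : seq I) :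
  measurable D -> (forall i, nu.-integrable D (EFin \o f i)) ->
  nu.-integrable D (fun x => (\sum_(i <- r) f i x)%:E).
Proof.
move=> mD fi.
rewrite (_ : (fun x => _) = (fun x => (\sum_(i <- r) (f i x)%:E)%E)); last by apply/funext => x; rewrite sumEFin.
by apply: integrable_sum => // i _; exact: fi.
Qed.

Lemma dominated_cvg_Rintegral (D : set T) (f : nat -> T -> R) (g G : T -> R) :
  measurable D -> (forall n, measurable_fun D (f n)) -> measurable_fun D g ->
  (forall x, D x -> f ^~ x @ \oo --> g x) ->
  nu.-integrable D (EFin \o G) -> (forall n x, D x -> `|f n x| <= G x) ->
  nu.-integrable D (EFin \o g) /\
  (fun n => \int[nu]_(x in D) f n x) @ \oo --> \int[nu]_(x in D) g x.
Proof.
move=> mD mf mg fg iG fG.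
have [||||| ig _ cv] := @dominated_convergence _ _ _ nu D mD (fun n => EFin \o f n) (EFin \o g) (EFin \o G).
- by move=> n; exact/measurable_EFinP.
- exact/measurable_EFinP.
- apply: aeW => x Dx; apply: cvg_EFin; first exact: nearW.
  exact: fg.
- exact: iG.
- by apply: aeW => x n Dx; rewrite lee_fin; exact: fG.
split => //; rewrite /Rintegral.
apply: (@fine_cvg _ _ _ _ (fun n => \int[nu]_(x in D) (f n x)%:E)%E).
by rewrite fineK //; exact: (integrable_fin_num mD ig).
Qed.

End IntegralLimits.

(** * The power series of (1 - z)^(-1) and (1 - z)^(-2) *)

Section GeometricSeries.
Variable R : realType.
Local Notation Re := (@complex.Re R).
Local Notation Im := (@complex.Im R).

Lemma sum_geom (A : comNzRingType) (z : A) n :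
  (\sum_(k < n) z ^+ k) * (1 - z) = 1 - z ^+ n.
Proof.
elim: n => [|n IH]; first by rewrite big_ord0 expr0 mul0r subrr.
by rewrite big_ord_recr /= mulrDl IH (exprS z n); ring.
Qed.

Lemma sum_dgeom (A : comNzRingType) (z : A) n :
  (\sum_(k < n) k.+1%:R * z ^+ k) * (1 - z) ^+ 2 = 1 - (n.+1%:R - n%:R * z) * z ^+ n.
Proof.
elim: n => [|n IH]; first by rewrite big_ord0 expr0; ring.
by rewrite big_ord_recr /= mulrDl IH (exprS z n) -[n.+2%:R]natr1 -[n.+1%:R]natr1; ring.
Qed.

Lemma sum_geom_le (r : R) n : 0 <= r < 1 -> \sum_(k < n) r ^+ k <= (1 - r)^-1.
Proof.
move=> /andP[r0 r1]; have h : 0 < 1 - r by rewrite subr_gt0.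
rewrite -[leRHS]mul1r ler_pdivlMr // sum_geom.
by rewrite gerBl exprn_ge0.
Qed.

Lemma sum_dgeom_le (r : R) n : 0 <= r < 1 ->
  \sum_(k < n) k.+1%:R * r ^+ k <= ((1 - r) ^+ 2)^-1.
Proof.
move=> /andP[r0 r1]; have h : 0 < 1 - r by rewrite subr_gt0.
rewrite -[leRHS]mul1r ler_pdivlMr ?exprn_gt0 // sum_dgeom.
rewrite gerBl mulr_ge0 ?exprn_ge0 // subr_ge0.
apply: le_trans (_ : n%:R <= _); last by rewrite ler_nat.
by rewrite -[leRHS]mulr1 ler_wpM2l // ltW.
Qed.

(** These are the terms of a series with bounded partial sums. *)
Lemma cvg_dgeom (r : R) : 0 <= r < 1 -> (fun n => n.+1%:R * r ^+ n) @ \oo --> 0.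
Proof.
move=> r01; apply: (@cvg_series_cvg_0 R R).
apply: nondecreasing_is_cvgn.
  apply/nondecreasing_seqP => n; rewrite /series /= big_nat_recr //= lerDl mulr_ge0 // exprn_ge0 //.
  by case/andP: r01.
exists ((1 - r) ^+ 2)^-1 => _ [n _ <-].
by rewrite /series /= big_mkord; exact: sum_dgeom_le.
Qed.

Definition ccvg (u : nat -> R[i]) (l : R[i]) := (fun n => cmod (u n - l)) @ \oo --> (0 : R).

Lemma ccvg_eq u v l : u =1 v -> ccvg v l -> ccvg u l.
Proof. by move=> /funext ->. Qed.

Lemma ccvg_Re u l : ccvg u l -> (fun n => Re (u n)) @ \oo --> Re l.
Proof.
move=> ul; apply/subr_cvg0; apply: norm_cvg0.
apply: (squeeze_cvgr (f := fun=> 0) (h := fun n => cmod (u n - l))) => //; last exact: cvg_cst.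
apply: nearW => n; rewrite normr_ge0 /= -ReN -ReD; exact: Re_le_cmod.
Qed.

Lemma ccvg_Im u l : ccvg u l -> (fun n => Im (u n)) @ \oo --> Im l.
Proof.
move=> ul; apply/subr_cvg0; apply: norm_cvg0.
apply: (squeeze_cvgr (f := fun=> 0) (h := fun n => cmod (u n - l))) => //; last exact: cvg_cst.
apply: nearW => n; rewrite normr_ge0 /= -ImN -ImD; exact: Im_le_cmod.
Qed.

Lemma ccvg_sqmod u l : ccvg u l -> (fun n => sqmod (u n)) @ \oo --> sqmod l.
Proof.
move=> ul; rewrite /sqmod; under eq_fun do rewrite !expr2.
by apply: cvgD; apply: cvgM; first [exact: ccvg_Re|exact: ccvg_Im].
Qed.

Lemma ccvg_ReMJ u v l m : ccvg u l -> ccvg v m ->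
  (fun n => Re (u n * conjc (v n))) @ \oo --> Re (l * conjc m).
Proof.
move=> ul vm; under eq_fun do rewrite ReM ReJ ImJ mulrN opprK.
rewrite ReM ReJ ImJ mulrN opprK.
by apply: cvgD; apply: cvgM; first [exact: ccvg_Re|exact: ccvg_Im].
Qed.

Lemma cmod_1B_neq0 (z : R[i]) : cmod z < 1 -> 1 - z != 0.
Proof.
by move=> z1; rewrite subr_eq0; apply: contraTneq z1 => <-; rewrite cmod1 ltxx.
Qed.

Lemma ccvg_geom (z : R[i]) : cmod z < 1 ->
  ccvg (fun n => \sum_(k < n) z ^+ k) (1 - z)^-1.
Proof.
move=> z1; have zn := cmod_1B_neq0 z1.
rewrite /ccvg (_ : (fun n => _) = fun n => (cmod (1 - z))^-1 * cmod z ^+ n).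
  rewrite -[X in _ --> X](mulr0 (cmod (1 - z))^-1); apply: cvgM; first exact: cvg_cst.
  by apply: cvg_expr; rewrite ger0_norm // cmod_ge0.
apply/funext => n; have -> : \sum_(k < n) z ^+ k - (1 - z)^-1 = - z ^+ n / (1 - z).
  apply: (mulIf zn); rewrite mulrBl sum_geom mulVf // mulfVK //; ring.
by rewrite cmodM cmodN cmodV cmodX mulrC.
Qed.

Lemma ccvg_dgeom (z : R[i]) : cmod z < 1 ->
  ccvg (fun n => \sum_(k < n) k.+1%:R * z ^+ k) ((1 - z) ^+ 2)^-1.
Proof.
move=> z1; have zn := cmod_1B_neq0 z1.
pose c := (cmod (1 - z) ^+ 2)^-1.
apply: (squeeze_cvgr (f := fun=> 0) (h := fun n => c * (2 * (n.+1%:R * cmod z ^+ n)))); last 2 first.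
- exact: cvg_cst.
- rewrite -[X in _ --> X](mulr0 c); apply: cvgM; first exact: cvg_cst.
  rewrite -[X in _ --> X](mulr0 2); apply: cvgM; first exact: cvg_cst.
  by apply: cvg_dgeom; rewrite cmod_ge0.
apply: nearW => n; rewrite cmod_ge0 /=.
have -> : \sum_(k < n) k.+1%:R * z ^+ k - ((1 - z) ^+ 2)^-1 =
    - ((n.+1%:R - n%:R * z) * z ^+ n) / (1 - z) ^+ 2.
  have zn2 : (1 - z) ^+ 2 != 0 by rewrite expf_neq0.
  apply: (mulIf zn2); rewrite mulrBl sum_dgeom mulVf // mulfVK //; ring.
rewrite cmodM cmodN cmodV cmodX mulrC cmodM cmodX -/c.
rewrite ler_wpM2l ?invr_ge0 ?exprn_ge0 ?cmod_ge0 // mulrA ler_wpM2r ?exprn_ge0 ?cmod_ge0 //.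
have cn (m : nat) : cmod (m%:R : R[i]) = m%:R.
  have -> : (m%:R : R[i]) = Complex m%:R 0 by rewrite -[RHS]/(m%:R%:C%C) rmorph_nat.
  by rewrite cmodR ger0_norm.
apply: le_trans (cmodB _ _) _; rewrite cmodM !cn [leRHS](_ : _ = n.+1%:R + n.+1%:R); last by ring.
rewrite lerD2l.
apply: le_trans (_ : n%:R <= _); last by rewrite ler_nat.
by rewrite -[leRHS]mulr1 ler_wpM2l // ltW.
Qed.

End GeometricSeries.

(** * Parseval with radial weights and integrals of the kernel *)

Section KernelIntegrals.
Variable R : realType.
Local Notation leb := (@lebesgue_measure R).
Local Notation mR := (measurableTypeR R).
Local Notation mu := (@mu R).
Local Notation D := (@disk R).
Local Notation Re := (@complex.Re R).
Local Notation Im := (@complex.Im R).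
Implicit Types (p x y : pt R).

Definition psum (c : nat -> R[i]) (n : nat) (z : R[i]) : R[i] := \sum_(k < n) c k * z ^+ k.

Lemma cmeas_psum c n : cmeas (fun p => psum c n (toC p)).
Proof.
apply: cmeas_sum => k; apply: cmeasM; first exact: cmeas_cst.
by apply: cmeasX; exact: cmeas_toC.
Qed.

Section Weight.
Variables (h : R -> R) (M : R).
Hypotheses (mh : measurable_fun setT h) (h0 : forall u, 0 <= h u) (hM : forall u, h u <= M).

Lemma integrable_monomial (a : R[i]) n m :
  mu.-integrable D (EFin \o (fun p => h (nrm2 p) * Re (a * (toC p ^+ n * conjc (toC p) ^+ m)))).
Proof.
apply: (@integrable_disk _ _ (M * cmod a)) => [|p Dp].
  by apply: measurable_wt => //; exact: cmeas_monomial.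
rewrite normrM ger0_norm // ler_pM //.
apply: le_trans (Re_le_cmod _) _; rewrite !cmodM !cmodX cmod_conj -[leRHS]mulr1.
have c1 := ltW (cmod_toC_lt1 Dp).
by rewrite ler_wpM2l ?cmod_ge0 // mulr_ile1 ?exprn_ge0 ?cmod_ge0 // exprn_ile1 ?cmod_ge0.
Qed.

Lemma psum_mulJ c e n p : Re (psum c n (toC p) * conjc (psum e n (toC p))) =
  \sum_(k < n) \sum_(l < n) Re (c k * conjc (e l) * (toC p ^+ k * conjc (toC p) ^+ l)).
Proof.
have -> : conjc (psum e n (toC p)) = \sum_(l < n) conjc (e l) * conjc (toC p) ^+ l.
  rewrite /psum; elim/big_rec2: _ => [|i a b _ <-]; first by rewrite conjc0.
  by rewrite conjcD conjcM conjcX.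
rewrite /psum mulr_suml Re_sum; apply: eq_bigr => k _.
rewrite mulr_sumr Re_sum; apply: eq_bigr => l _; congr Re; ring.
Qed.

Lemma integral_psum c e n :
  \int[mu]_(p in D) (h (nrm2 p) * Re (psum c n (toC p) * conjc (psum e n (toC p)))) =
  \sum_(k < n) Re (c k * conjc (e k)) * radial_moment h k.
Proof.
pose F (k l : 'I_n) p := h (nrm2 p) * Re (c k * conjc (e l) * (toC p ^+ k * conjc (toC p) ^+ l)).
have mD := @measurable_disk R.
have iF k l : mu.-integrable D (EFin \o F k l) by exact: integrable_monomial.
transitivity (\int[mu]_(p in D) (\sum_(k < n) \sum_(l < n) F k l p)).
  apply: eq_Rintegral => p _; rewrite psum_mulJ mulr_sumr; apply: eq_bigr => k _.
  by rewrite mulr_sumr.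
rewrite Rintegral_sum //; last by move=> k; exact: integrable_sumr.
apply: eq_bigr => k _; rewrite Rintegral_sum //.
rewrite (bigD1 k) //= big1 ?addr0.
  by rewrite /F (@integral_monomial R h M) // eqxx.
by move=> l lk; rewrite /F (@integral_monomial R h M) // eq_sym; move: lk; rewrite -val_eqE /= => /negbTE ->.
Qed.

Lemma integral_psum_sqmod c n :
  (\int[mu]_(p in D) (h (nrm2 p) * sqmod (psum c n (toC p)))%:E =
  (\sum_(k < n) sqmod (c k) * radial_moment h k)%:E)%E.
Proof.
have sqE z : sqmod z = Re (z * conjc z) by rewrite -sqmodE.
have mD := @measurable_disk R.
have I : mu.-integrable D (fun p => (h (nrm2 p) * Re (psum c n (toC p) * conjc (psum c n (toC p))))%:E).
  under eq_fun do rewrite psum_mulJ mulr_sumr.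
  apply: integrable_sumr => // k.
  rewrite (_ : EFin \o _ = (fun p => (\sum_(l < n) h (nrm2 p) * Re (c k * conjc (c l) * (toC p ^+ k * conjc (toC p) ^+ l)))%:E)).
    by apply: integrable_sumr => // l; exact: integrable_monomial.
  by apply/funext => p /=; rewrite mulr_sumr.
have := integral_psum c c n.
rewrite /Rintegral => E.
under [X in _ = X%:E]eq_bigr do rewrite sqE; rewrite -E fineK.
  by apply: eq_integral => p _; rewrite sqE.
exact: (@integrable_fin_num _ _ _ mu D mD _ I).
Qed.

(** One half of Parseval: Fatou turns a bound on the weighted coefficient sums into a bound on the
    integral, which is the direction the kernel estimates require. *)
Lemma fatou_psum c (F : pt R -> R[i]) (B : R) :
  (forall p, D p -> ccvg (fun n => psum c n (toC p)) (F p)) ->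
  (forall n, \sum_(k < n) sqmod (c k) * radial_moment h k <= B) ->
  (\int[mu]_(p in D) (h (nrm2 p) * sqmod (F p))%:E <= B%:E)%E.
Proof.
move=> cF cB; have mD := @measurable_disk R.
apply: (@fatou_bound _ (mR * mR)%type R mu D (fun n p => (h (nrm2 p) * sqmod (psum c n (toC p)))%:E)) => //.
- move=> n; apply: measurable_funTS; apply/measurable_EFinP; apply: measurable_funM.
    exact: (measurableT_comp mh (@measurable_nrm2 R)).
  by apply: measurable_sqmod; exact: cmeas_psum.
- by move=> n p _; rewrite lee_fin mulr_ge0 // sqmod_ge0.
- move=> p Dp; apply: cvg_EFin; first exact: nearW.
  by apply: cvgM; [exact: cvg_cst|apply: ccvg_sqmod; exact: cF].
- by move=> n; rewrite integral_psum_sqmod lee_fin.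
Qed.

End Weight.

Definition oneBJ x y : R[i] := 1 - toC x * conjc (toC y).

Lemma KpE x y : Kp x y = (oneBJ x y ^+ 2)^-1. Proof. by []. Qed.

Lemma oneBJ_conj x y : oneBJ y x = conjc (oneBJ x y).
Proof. by case: x => a b; case: y => c e; rewrite /oneBJ /toC; simpc; congr Complex; ring. Qed.

Lemma Kp_conj x y : Kp y x = conjc (Kp x y).
Proof. by rewrite !KpE oneBJ_conj conjc_inv conjcX. Qed.

Lemma cmod_mul_lt1 x y : D x -> D y -> cmod (toC x * conjc (toC y)) < 1.
Proof.
move=> Dx Dy; rewrite cmodM cmod_conj.
by apply: mulr_ilt1; rewrite ?cmod_ge0 //; exact: cmod_toC_lt1.
Qed.

Lemma oneBJ_neq0 x y : D x -> D y -> oneBJ x y != 0.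
Proof. by move=> Dx Dy; apply: cmod_1B_neq0; exact: cmod_mul_lt1. Qed.

Lemma ccvg_Kp x p : D x -> D p ->
  ccvg (fun n => psum (fun k => k.+1%:R * conjc (toC x) ^+ k) n (toC p)) (Kp p x).
Proof.
move=> Dx Dp; apply: ccvg_eq (ccvg_dgeom (cmod_mul_lt1 Dp Dx)) => n.
by apply: eq_bigr => k _; rewrite exprMn; ring.
Qed.

Lemma ccvg_oneBJV x p : D x -> D p ->
  ccvg (fun n => psum (fun k => conjc (toC x) ^+ k) n (toC p)) (oneBJ p x)^-1.
Proof.
move=> Dx Dp; apply: ccvg_eq (ccvg_geom (cmod_mul_lt1 Dp Dx)) => n.
by apply: eq_bigr => k _; rewrite exprMn; ring.
Qed.

Lemma integral_pow (r : R) k : 0 < r ->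
  (\int[leb]_(u in `[0%R, r]) (u ^+ k)%:E = (r ^+ k.+1 / k.+1%:R)%:E)%E.
Proof.
move=> r0; pose F (u : R) : R := k.+1%:R^-1 * u ^+ k.+1.
have dF (u : R) : is_derive u 1 F (u ^+ k).
  have dX : is_derive u 1 (fun x : R => x ^+ k.+1) (k.+1%:R * u ^+ k).
    apply: DeriveDef; first exact: exprn_derivable.
    by rewrite exp_derive [LHS]mulr1.
  apply: (is_derive_eq (@is_deriveZ _ _ _ _ k.+1%:R^-1 u 1 _ dX)).
  by rewrite -[LHS]/(k.+1%:R^-1 * (k.+1%:R * u ^+ k)) mulrA mulVf ?mul1r // pnatr_eq0.
have cF : continuous F.
  by move=> u; apply/differentiable_continuous/derivable1_diffP; case: (dF u).
rewrite (@continuous_FTC2 R (fun u => u ^+ k) F) //.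
- by rewrite /F expr0n /= mulr0 -EFinB subr0 mulrC.
- by apply: continuous_subspaceT => u; exact: exprn_continuous.
- split => [u _| |]; first by case: (dF u).
  + by apply: cvg_at_right_filter; exact: cF.
  + by apply: cvg_at_left_filter; exact: cF.
- by move=> u _; rewrite derive1E (@derive_val _ _ _ _ _ _ _ (dF u)).
Qed.

Lemma radial_moment1 k : radial_moment (fun=> 1 : R) k = k.+1%:R^-1.
Proof.
rewrite /radial_moment /Rintegral integral_itv_bndo_bndc; last first.
  apply/measurable_EFinP; apply: measurable_funM => //; exact: measurable_funX.
under eq_integral do rewrite mul1r.
by rewrite integral_pow // expr1n mul1r.
Qed.

Lemma radial_moment_indic (r : R) k : 0 < r < 1 ->
  radial_moment (fun u : R => (u <= r)%R%:R : R) k = r ^+ k.+1 / k.+1%:R.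
Proof.
move=> /andP[r0 r1]; rewrite /radial_moment /Rintegral.
rewrite -[RHS]/(fine (r ^+ k.+1 / k.+1%:R)%:E) -integral_pow //; congr fine.
rewrite [LHS]integral_mkcond [RHS]integral_mkcond; apply: eq_integral => u _.
rewrite !patchE !mem_setE !in_itv /=.
have [u0|u0] //= := leP 0 u.
have [ur|ur] := leP u r; first by rewrite (le_lt_trans ur r1) mul1r.
by case: ifP => // _; rewrite mul0r.
Qed.

Lemma sqmod_oneBJ_coef x k : sqmod ((k.+1%:R : R[i]) * conjc (toC x) ^+ k) = k.+1%:R ^+ 2 * nrm2 x ^+ k.
Proof.
rewrite sqmodM sqmodX sqmod_conj sqmod_toC; congr (_ * _).
have -> : (k.+1%:R : R[i]) = Complex k.+1%:R 0 by rewrite -[RHS]/(k.+1%:R%:C%C) rmorph_nat.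
by rewrite sqmodR.
Qed.

(** The k-th coefficient has squared modulus (k+1)^2 |x|^(2k) and the moment is r^(k+1)/(k+1), which
    leaves r times the series of (1 - r|x|^2)^(-2). For r < 1 the value falls below K(x,x): this
    deficit drives the lower bound for the mean. *)
Lemma integral_Kp_sqmod_le (r : R) x : 0 < r < 1 -> D x ->
  (\int[mu]_(p in D) ((nrm2 p <= r)%R%:R * sqmod (Kp p x))%:E <= (r / (1 - r * nrm2 x) ^+ 2)%:E)%E.
Proof.
move=> r01 Dx; have /andP[r0 r1] := r01.
apply: (@fatou_psum (fun u : R => (u <= r)%R%:R : R) 1 _ _ _ (fun k => k.+1%:R * conjc (toC x) ^+ k)).
- rewrite (_ : (fun u : R => (u <= r)%R%:R) = fun u => if u <= r then 1 else 0); last first.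
    by apply/funext => u; case: (u <= r).
  by apply: measurable_fun_ifT => //; apply: measurable_fun_ler.
- by move=> u; exact: ler0n.
- by move=> u; case: (u <= r).
- by move=> p Dp; exact: ccvg_Kp.
- move=> n; under eq_bigr do rewrite sqmod_oneBJ_coef radial_moment_indic //.
  have := @sum_dgeom_le R (r * nrm2 x) n.
  have rx : 0 <= r * nrm2 x < 1.
    by rewrite mulr_ge0 ?nrm2_ge0 ?(ltW r0) //= mulr_ilt1 ?nrm2_ge0 // ltW.
  move=> /(_ rx) H; apply: le_trans (_ : r * ((1 - r * nrm2 x) ^+ 2)^-1 <= _) => //.
  rewrite -(ler_pM2l r0) mulr_sumr in H; apply: le_trans H.
  apply: ler_sum => k _; rewrite exprMn (exprS r k) le_eqVlt; apply/orP; left; apply/eqP.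
  have : k.+1%:R != 0 :> R by rewrite pnatr_eq0.
  by move: (k.+1%:R : R) => a a0; field.
Qed.

(** The coefficients of [(oneBJ p x)^-1] in p are the powers of conj x, so averaging over circles
    replaces |1 - p conj x|^(-2) by 1/(1 - |x|^2 |p|^2), and a planar integral becomes
    one-dimensional. *)
Lemma integral_oneBJV_le (h : R -> R) (M B : R) x :
  measurable_fun setT h -> (forall u, 0 <= h u) -> (forall u, h u <= M) -> D x ->
  (\int[leb]_(u in `[0%R, 1%R[) (h u / (1 - nrm2 x * u))%:E <= B%:E)%E ->
  (\int[mu]_(p in D) (h (nrm2 p) / sqmod (oneBJ p x))%:E <= B%:E)%E.
Proof.
move=> mh h0 hM Dx hB.
under eq_integral do rewrite -sqmodV.
apply: (@fatou_psum h M _ _ _ (fun k => conjc (toC x) ^+ k)) => //.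
  by move=> p Dp; exact: ccvg_oneBJV.
have ih k : leb.-integrable `[0%R, 1%R[ (EFin \o (fun u => h u * u ^+ k)).
  apply: measurable_bounded_integrable => //.
  - by rewrite /= lebesgue_measure_itv /= lte_fin ltr01 -EFinB ltry.
  - by apply: measurable_funTS; apply: measurable_funM => //; exact: measurable_funX.
  - exists M; split; rewrite ?num_real // => v Mv u; rewrite /= in_itv /= => /andP[u0 u1].
    rewrite normrM !ger0_norm ?exprn_ge0 //; apply: le_trans (ltW Mv).
    by rewrite -[leRHS]mulr1 ler_pM ?exprn_ge0 // exprn_ile1 // ltW.
have x1 : nrm2 x < 1 by [].
have mix k : leb.-integrable `[0%R, 1%R[ (EFin \o (fun u => nrm2 x ^+ k * (h u * u ^+ k))).
  have := @integrableZl _ _ _ leb _ (measurable_itv `[0%R, 1%R[) (nrm2 x ^+ k) _ (ih k).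
  by apply: eq_integrable.
move=> n; have -> : \sum_(k < n) sqmod (conjc (toC x) ^+ k) * radial_moment h k =
    \int[leb]_(u in `[0, 1[) (\sum_(k < n) nrm2 x ^+ k * (h u * u ^+ k)).
  rewrite Rintegral_sum //; apply: eq_bigr => k _.
  by rewrite sqmodX sqmod_conj sqmod_toC RintegralZl.
have S : leb.-integrable `[0%R, 1%R[ (fun u => (\sum_(k < n) nrm2 x ^+ k * (h u * u ^+ k))%:E).
  by apply: integrable_sumr => // k; exact: mix.
rewrite -lee_fin /Rintegral fineK; last exact: (@integrable_fin_num _ _ _ leb _ (measurable_itv `[0%R, 1%R[) _ S).
apply: le_trans hB; apply: ge0_le_integral => //.
- move=> u; rewrite /= in_itv /= => /andP[u0 u1].
  by rewrite lee_fin sumr_ge0 // => k _; rewrite !mulr_ge0 ?exprn_ge0 ?nrm2_ge0.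
- by have /integrableP[] := S.
- apply/measurable_EFinP; apply: measurable_funM; first exact: measurable_funTS.
  apply: (eq_measurable_fun ((@powR R ^~ (-1)) \o (fun u => 1 - nrm2 x * u))).
    move=> u; rewrite inE /= in_itv /= => /andP[u0 u1].
    by rewrite powR_inv1 // subr_ge0 mulr_ile1 ?nrm2_ge0 // ltW.
  apply: measurable_funTS; apply: measurableT_comp; first exact: measurable_powR.
  by apply: measurable_funB => //; apply: measurable_funM.
- move=> u; rewrite /= in_itv /= => /andP[u0 u1].
  rewrite lee_fin; have -> : \sum_(k < n) nrm2 x ^+ k * (h u * u ^+ k) = \sum_(k < n) h u * (nrm2 x * u) ^+ k.
    by apply: eq_bigr => k _; rewrite exprMn; ring.
  rewrite -mulr_sumr ler_wpM2l // sum_geom_le // mulr_ge0 ?nrm2_ge0 //=.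
  by rewrite mulr_ilt1 ?nrm2_ge0.
Qed.

End KernelIntegrals.

(** * The reproducing formula *)

Section Reproducing.
Variable R : realType.
Local Notation mR := (measurableTypeR R).
Local Notation mu := (@mu R).
Local Notation D := (@disk R).
Local Notation Re := (@complex.Re R).
Implicit Types (p x y : pt R).

Lemma cmod_nat n : cmod (n%:R : R[i]) = n%:R.
Proof.
have -> : (n%:R : R[i]) = Complex n%:R 0 by rewrite -[RHS]/(n%:R%:C%C) rmorph_nat.
by rewrite cmodR ger0_norm.
Qed.

(** The majorant for [reproducing]: since |p| < 1, the series is bounded by one in |x| alone. *)
Lemma cmod_psum_Kp_le x p n : D x -> D p ->
  cmod (psum (fun k => k.+1%:R * conjc (toC x) ^+ k) n (toC p)) <= ((1 - cmod (toC x)) ^+ 2)^-1.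
Proof.
move=> Dx Dp; apply: le_trans (cmod_sum _ _ _) _.
apply: le_trans (sum_dgeom_le n (_ : 0 <= cmod (toC x) < 1)); last first.
  by rewrite cmod_ge0 cmod_toC_lt1.
apply: ler_sum => k _; rewrite !cmodM !cmodX cmod_conj cmod_nat -mulrA ler_wpM2l //.
rewrite -[leRHS]mulr1 ler_wpM2l ?exprn_ge0 ?cmod_ge0 //.
by rewrite exprn_ile1 ?cmod_ge0 // ltW // cmod_toC_lt1.
Qed.

Lemma cmeas_Kp x : cmeas (fun p => Kp p x).
Proof.
apply: cmeasV; apply: cmeasX; apply: cmeasD; first exact: cmeas_cst.
by apply: cmeasN; apply: cmeasM; [exact: cmeas_toC|exact: cmeas_cst].
Qed.

(** In the integral of two truncated series the moment 1/(k+1) cancels one of two factors k+1, and a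
    partial sum of the series of K(y,x) remains. On the disk the truncations are bounded by
    constants depending on x and y, so dominated convergence applies. *)
Lemma reproducing x y : D x -> D y ->
  mu.-integrable D (EFin \o (fun p => Re (Kp p x * conjc (Kp p y)))) /\
  \int[mu]_(p in D) Re (Kp p x * conjc (Kp p y)) = Re (Kp x y).
Proof.
move=> Dx Dy; have mD := @measurable_disk R.
pose c a k : R[i] := k.+1%:R * conjc (toC a) ^+ k.
pose f n p := Re (psum (c x) n (toC p) * conjc (psum (c y) n (toC p))).
pose M := ((1 - cmod (toC x)) ^+ 2)^-1 * ((1 - cmod (toC y)) ^+ 2)^-1.
have mc (g : pt R -> R[i]) : cmeas g -> measurable_fun D (EFin \o (fun p => Re (g p))).
  by move=> [mg _]; apply: measurable_funTS; apply/measurable_EFinP.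
have mf n : measurable_fun D (EFin \o f n).
  by apply: mc; apply: cmeasM; [|apply: cmeasJ]; exact: cmeas_psum.
have mg : measurable_fun D (EFin \o (fun p => Re (Kp p x * conjc (Kp p y)))).
  by apply: mc; apply: cmeasM; [|apply: cmeasJ]; exact: cmeas_Kp.
have fM n p : D p -> `|f n p| <= M.
  move=> Dp; apply: le_trans (Re_le_cmod _) _; rewrite cmodM cmod_conj.
  by apply: ler_pM; rewrite ?cmod_ge0 //; exact: cmod_psum_Kp_le.
have fg p : D p -> f ^~ p @ \oo --> Re (Kp p x * conjc (Kp p y)).
  by move=> Dp; apply: ccvg_ReMJ; exact: ccvg_Kp.
have iM : mu.-integrable D (EFin \o cst M).
  by apply: (@integrable_disk _ _ `|M|).
have mf' n : measurable_fun D (f n) by exact/measurable_EFinP.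
have mg' : measurable_fun D (fun p => Re (Kp p x * conjc (Kp p y))) by exact/measurable_EFinP.
have [ig cvf] := @dominated_cvg_Rintegral _ (mR * mR)%type R mu D f _ _ mD mf' mg' fg iM fM.
split=> //.
have If n : \int[mu]_(p in D) f n p = Re (\sum_(k < n) k.+1%:R * (toC y * conjc (toC x)) ^+ k).
  have := @integral_psum R (fun=> 1) 1 (measurable_cst _) (fun=> ler01) (fun=> lexx _) (c x) (c y) n.
  under eq_Rintegral do rewrite mul1r.
  move=> ->; rewrite Re_sum; apply: eq_bigr => k _.
  rewrite radial_moment1 /c conjcM conjcX conjcK.
  have nC : (k.+1%:R : R[i]) = Complex k.+1%:R 0 by rewrite -[RHS]/(k.+1%:R%:C%C) rmorph_nat.
  have -> : conjc (k.+1%:R : R[i]) = k.+1%:R by rewrite nC /= oppr0.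
  set q := conjc (toC x) ^+ k; set q' := (toC y * _) ^+ k.
  have -> : k.+1%:R * q * (k.+1%:R * toC y ^+ k) = Complex k.+1%:R 0 * (k.+1%:R * q').
    by rewrite -nC /q /q' exprMn; ring.
  rewrite ReZ; set r := Re _.
  by rewrite mulrAC mulfV ?mul1r // pnatr_eq0.
have cv2 : (fun n => Re (\sum_(k < n) k.+1%:R * (toC y * conjc (toC x)) ^+ k)) @ \oo --> Re (Kp x y).
  rewrite Kp_conj ReJ; apply: ccvg_Re; apply: ccvg_dgeom.
  exact: cmod_mul_lt1.
move: cvf; under eq_fun do rewrite If; move=> cvf.
exact: (cvg_unique _ cvf cv2).
Qed.

End Reproducing.

(** * Norms of finite combinations of kernels *)

Section FiniteSums.
Variable R : realType.
Local Notation mR := (measurableTypeR R).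
Local Notation mu := (@mu R).
Local Notation D := (@disk R).
Local Notation Re := (@complex.Re R).

(** The index set is kept apart from the points, so that the formula serves both for the points of a
    configuration and for cell centres, which may coincide. *)
Lemma A2normsq_sum (I : eqType) (g : I -> R) (c : I -> pt R) (xs : seq I) : (forall x, x \in xs -> D (c x)) ->
  A2normsq (fun w => \sum_(x <- xs) Complex (g x) 0 * Kp w (c x)) =
  (\sum_(x <- xs) \sum_(y <- xs) g x * g y * Re (Kp (c x) (c y)))%:E.
Proof.
move=> xD; have mD := @measurable_disk R.
rewrite /A2normsq ge0_muintE //; first last.
- by move=> p _; rewrite lee_fin sqmod_ge0.
- apply: measurable_funTS; apply/measurable_EFinP; apply: measurable_sqmod; apply: cmeas_sum => x.
  by apply: cmeasM; [exact: cmeas_cst|exact: cmeas_Kp].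
have sqE p : sqmod (\sum_(x <- xs) Complex (g x) 0 * Kp p (c x)) =
    \sum_(x <- xs) \sum_(y <- xs) g x * g y * Re (Kp p (c x) * conjc (Kp p (c y))).
  rewrite -[LHS]/(Re (sqmod _)%:C%C) sqmodE.
  have -> : conjc (\sum_(x <- xs) Complex (g x) 0 * Kp p (c x)) = \sum_(x <- xs) Complex (g x) 0 * conjc (Kp p (c x)).
    elim/big_rec2: _ => [|i a b _ <-]; first by rewrite conjc0.
    by rewrite conjcD conjcM /= oppr0.
  rewrite mulr_suml Re_sum; apply: eq_bigr => x _.
  rewrite mulr_sumr Re_sum; apply: eq_bigr => y _.
  by rewrite -[RHS]mulrA -!ReZ; congr Re; ring.
(* Positions in [xs] replace its members: every position gives a point of the disk, as
   [integrable_sumr] requires of every index. *)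
pose t i := tnth (in_tuple xs) i.
have tD i : D (c (t i)) by apply: xD; exact: mem_tnth.
have iq i j : mu.-integrable D (EFin \o (fun p => g (t i) * g (t j) * Re (Kp p (c (t i)) * conjc (Kp p (c (t j)))))).
  have [ig _] := reproducing (tD i) (tD j).
  apply: eq_integrable (@integrableZl _ _ _ mu _ mD (g (t i) * g (t j)) _ ig) => //.
pose S p := \sum_(i < size xs) \sum_(j < size xs) g (t i) * g (t j) * Re (Kp p (c (t i)) * conjc (Kp p (c (t j)))).
have iS : mu.-integrable D (EFin \o S).
  by apply: integrable_sumr => // i; exact: integrable_sumr.
have SE p : sqmod (\sum_(x <- xs) Complex (g x) 0 * Kp p (c x)) = S p.
  by rewrite sqE big_tnth; apply: eq_bigr => i _; rewrite big_tnth.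
transitivity (\int[mu]_(p in D) (S p)%:E)%E.
  by apply: eq_integral => p _; rewrite SE.
rewrite -[LHS]fineK; last exact: (@integrable_fin_num _ _ _ mu D mD _ iS).
congr EFin; rewrite -[LHS]/(\int[mu]_(p in D) S p) Rintegral_sum //; last first.
  by move=> i; exact: integrable_sumr.
rewrite [RHS]big_tnth; apply: eq_bigr => i _; rewrite Rintegral_sum //.
rewrite [RHS]big_tnth; apply: eq_bigr => j _.
have [ig E] := reproducing (tD i) (tD j).
by rewrite (@RintegralZl _ _ _ mu _ _ _ mD ig) E.
Qed.

End FiniteSums.

(** * Decorrelation of Hermitian determinants *)

Section Determinants.
Variable R : realType.
Implicit Types (A B : nat -> nat -> R[i]) (k : nat -> R).

Definition detf n A : R[i] := \det (\matrix_(i < n, j < n) A i j).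

Lemma detfE n A : detf n A = \sum_(s : 'S_n) (-1) ^+ s * \prod_(i < n) A i (s i).
Proof.
by rewrite /detf /determinant; apply: eq_bigr => s _; congr (_ * _); apply: eq_bigr => i _; rewrite mxE.
Qed.

Lemma cmod_prod (I : Type) (r : seq I) (F : I -> R[i]) :
  cmod (\prod_(i <- r) F i) = \prod_(i <- r) cmod (F i).
Proof. by elim/big_rec2: _ => [|i a b _ <-]; rewrite ?cmod1 // cmodM. Qed.

Lemma cmod_sign (b : bool) (z : R[i]) : cmod ((-1) ^+ b * z) = cmod z.
Proof. by case: b; rewrite ?mulN1r ?cmodN ?mul1r. Qed.

Lemma cmod_sum_perm n (F : 'S_n -> R[i]) (b : R) :
  (forall s, cmod (F s) <= b) -> cmod (\sum_(s : 'S_n) (-1) ^+ s * F s) <= n`!%:R * b.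
Proof.
move=> Fb; apply: le_trans (cmod_sum _ _ _) _.
apply: le_trans (ler_sum _ (_ : forall s : 'S_n, true -> _ <= b)) _.
  by move=> s _; rewrite cmod_sign.
by rewrite sumr_const card_Sn mulr_natl.
Qed.

Section Normalized.
Variables (n : nat) (A : nat -> nat -> R[i]) (k : nat -> R).
Hypotheses (k0 : forall i, (i < n)%N -> 0 < k i)
  (Ak : forall i j, (i < n)%N -> (j < n)%N -> sqmod (A i j) <= k i * k j).

Let kap (i j : nat) : R := cmod (A i j) / (Num.sqrt (k i) * Num.sqrt (k j)).

Let kap_ge0 i j : 0 <= kap i j.
Proof. by rewrite divr_ge0 ?cmod_ge0 // mulr_ge0 // sqrtr_ge0. Qed.

Let kap_le1 (i j : 'I_n) : kap i j <= 1.
Proof.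
have sk (l : 'I_n) : 0 < Num.sqrt (k l) by rewrite sqrtr_gt0 k0.
rewrite ler_pdivrMr ?mulr_gt0 // mul1r -sqrtrM; last by apply/ltW/k0.
by rewrite /cmod ler_wsqrtr // Ak.
Qed.

Let kap_sqr (i j : 'I_n) : kap i j ^+ 2 = sqmod (A i j) / (k i * k j).
Proof. by rewrite exprMn cmod_sqr exprVn exprMn !sqr_sqrtr // ltW // k0. Qed.

(** Each k i occurs once through its row and once through its column, so the normalising square
    roots multiply to the product of the k i. *)
Lemma prod_perm_normalized (s : 'S_n) :
  \prod_(i < n) cmod (A i (s i)) = (\prod_(i < n) k i) * \prod_(i < n) kap i (s i).
Proof.
have sk (l : 'I_n) : Num.sqrt (k l) != 0 by rewrite gt_eqF // sqrtr_gt0 k0.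
have -> : \prod_(i < n) k i = \prod_(i < n) (Num.sqrt (k i) * Num.sqrt (k (s i))).
  have E : \prod_(i < n) Num.sqrt (k i) = \prod_(i < n) Num.sqrt (k (s i)).
    by rewrite (reindex_inj (@perm_inj _ s)).
  rewrite big_split /= -E -big_split /=.
  by apply: eq_bigr => i _; rewrite -expr2 sqr_sqrtr // ltW // k0.
rewrite -big_split /=; apply: eq_bigr => i _.
by rewrite mulrC divfK // mulf_neq0.
Qed.

Lemma cmod_detf_le : cmod (detf n A) <= n`!%:R * \prod_(i < n) k i.
Proof.
rewrite detfE; apply: cmod_sum_perm => s; rewrite cmod_prod prod_perm_normalized.
have kp : 0 <= \prod_(i < n) k i by apply: prodr_ge0 => i _; rewrite ltW // k0.
rewrite -[leRHS]mulr1 ler_wpM2l //; apply: prodr_ile1 => i _.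
by rewrite kap_ge0 kap_le1.
Qed.

(** The normalised entries are at most 1, so all but two may be dropped; then uv <= u^2 + v^2. Two
    entries are kept to reach squares, which the reproducing formula can integrate. *)
Lemma cmod_prod_perm_le2 (s : 'S_n) (a b : 'I_n) : a != b ->
  cmod (\prod_(i < n) A i (s i)) <=
  (\prod_(i < n) k i) * (sqmod (A a (s a)) / (k a * k (s a)) + sqmod (A b (s b)) / (k b * k (s b))).
Proof.
move=> ab; rewrite cmod_prod prod_perm_normalized.
have kp : 0 <= \prod_(i < n) k i by apply: prodr_ge0 => i _; rewrite ltW // k0.
rewrite ler_wpM2l // -!kap_sqr (bigD1 a) //= (bigD1 b) /=; last by rewrite eq_sym.
set P := \prod_(_ < n | _) _.
have P1 : P <= 1 by apply: prodr_ile1 => i _; rewrite kap_ge0 kap_le1.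
have P0 : 0 <= P by apply: prodr_ge0.
have a0 := kap_ge0 a (s a); have b0 := kap_ge0 b (s b).
set u := kap a _; set v := kap b _.
apply: le_trans (_ : u * v <= _).
  by rewrite mulrA -[leRHS]mulr1 ler_wpM2l // mulr_ge0.
have := sqr_ge0 (u - v); have := sqr_ge0 (u + v); rewrite /u /v; nra.
Qed.

End Normalized.

(** A permutation that leaves a block somewhere must return to it elsewhere, which supplies the
    second entry for [cmod_prod_perm_le2]. *)
Lemma perm_crossing n n1 (s : 'S_n) (a : 'I_n) : (a < n1)%N != (s a < n1)%N ->
  exists2 b : 'I_n, (b < n1)%N = (s a < n1)%N & (s b < n1)%N = (a < n1)%N.
Proof.
move=> cross; pose L := [set i : 'I_n | (i < n1)%N == (s a < n1)%N]%SET.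
have [[b bL sbL]|H] := pselect (exists2 b, b \in L & s b \notin L).
  move: bL sbL; rewrite !inE => /eqP bL sbL; exists b => //.
  by move: cross sbL; case: (a < n1)%N; case: (s a < n1)%N; case: (s b < n1)%N.
(* otherwise [s] permutes [L], which contains [s a] but not [a] *)
exfalso; have sL : [set s i | i in L]%SET = L.
  apply/eqP; rewrite eqEcard card_imset ?leqnn ?andbT; last exact: perm_inj.
  apply/fintype.subsetP => _ /imsetP[i iL ->]; apply/negPn/negP => siL; apply: H; by exists i.
have : s a \in [set s i | i in L]%SET by rewrite sL inE.
by move=> /imsetP[i iL /perm_inj ai]; move: iL; rewrite -ai inE (negbTE cross).
Qed.

Lemma detf_block n1 n2 A : detf (n1 + n2) (fun i j => if (i < n1)%N == (j < n1)%N then A i j else 0) =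
  detf n1 A * detf n2 (fun i j => A (n1 + i)%N (n1 + j)%N).
Proof.
rewrite /detf -[RHS](det_ublock _ 0); congr determinant.
apply/matrixP => i j; rewrite !mxE.
case: splitP => i' Hi; rewrite !mxE; case: splitP => j' Hj; rewrite !mxE Hi Hj ?ltn_ord ?ltnNge ?leq_addr //.
Qed.

(** Permutations preserving the two blocks cancel against the product of the block determinants.
    Every other one crosses between the blocks at two places, and each crossing entry contributes a
    summand of the double sum, whence the factor 2. *)
Lemma detf_decorrelation n1 n2 A k :
  (forall i, (i < n1 + n2)%N -> 0 < k i) ->
  (forall i j, (i < n1 + n2)%N -> (j < n1 + n2)%N -> sqmod (A i j) <= k i * k j) ->
  (forall i j, sqmod (A i j) = sqmod (A j i)) ->
  cmod (detf (n1 + n2) A - detf n1 A * detf n2 (fun i j => A (n1 + i)%N (n1 + j)%N)) <=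
  (n1 + n2)`!%:R * ((\prod_(i < n1 + n2) k i) *
    (2 * \sum_(i < n1) \sum_(j < n2) sqmod (A i (n1 + j)%N) / (k i * k (n1 + j)%N))).
Proof.
move=> k0 Ak Asym; rewrite -detf_block !detfE -sumrB.
under eq_bigr do rewrite -mulrBr.
set S := \sum_(i < n1) _.
have kp : 0 <= \prod_(i < n1 + n2) k i by apply: prodr_ge0 => i _; rewrite ltW // k0.
have t0 (i : 'I_n1) (j : 'I_n2) : 0 <= sqmod (A i (n1 + j)%N) / (k i * k (n1 + j)%N).
  by rewrite divr_ge0 ?sqmod_ge0 // mulr_ge0 // ltW // k0 ?ltn_add2l // ltn_addr.
have S0 : 0 <= S by apply: sumr_ge0 => i _; apply: sumr_ge0.
apply: cmod_sum_perm => s.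
have [H|H] := boolP [forall i : 'I_(n1 + n2), (i < n1)%N == (s i < n1)%N].
  rewrite [X in _ - X](_ : _ = \prod_(i < n1 + n2) A i (s i)); last first.
    by apply: eq_bigr => i _; rewrite (forallP H i).
  by rewrite subrr /cmod sqmod0 sqrtr0 mulr_ge0 // mulr_ge0.
have [a Ha] : exists a : 'I_(n1 + n2), (a < n1)%N != (s a < n1)%N.
  by move: H; rewrite negb_forall => /existsP.
have [b b1 b2] := perm_crossing Ha.
have ab : a != b by apply/eqP => E; move: b1; rewrite -E => b1; move: Ha; rewrite b1 eqxx.
rewrite [X in _ - X](_ : _ = 0) ?subr0; last first.
  by rewrite (bigD1 a) //= (negbTE Ha) mul0r.
apply: le_trans (cmod_prod_perm_le2 (n := n1 + n2) (A := A) (k := k) k0 Ak s ab) _.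
rewrite ler_wpM2l //.
have cr (c : 'I_(n1 + n2)) : (c < n1)%N != (s c < n1)%N -> sqmod (A c (s c)) / (k c * k (s c)) <= S.
  have main (u v : 'I_(n1 + n2)) : (u < n1)%N -> (n1 <= v)%N -> sqmod (A u v) / (k u * k v) <= S.
    move=> u1 v1; have v2 : (v - n1 < n2)%N by rewrite ltn_subLR.
    rewrite /S (bigD1 (Ordinal u1)) //= (bigD1 (Ordinal v2)) //= subnKC // -addrA lerDl.
    by apply: addr_ge0; [apply: sumr_ge0 => j _; exact: (t0 (Ordinal u1))|apply: sumr_ge0 => i _; exact: sumr_ge0].
  case: (ltnP c n1) => c1; case: (ltnP (s c) n1) => // s1 _; first exact: main.
  by rewrite Asym [k c * _]mulrC; exact: main.
rewrite mulr_natl mulr2n; apply: lerD; apply: cr => //.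
by rewrite b1 b2 eq_sym.
Qed.

(** Telescoping: the factors are exchanged one at a time. *)
Lemma prod_diff_le (I : Type) (r : seq I) (F G : I -> R[i]) (M e : R) : 1 <= M ->
  (forall i, cmod (F i) <= M) -> (forall i, cmod (G i) <= M) ->
  (forall i, cmod (F i - G i) <= e) ->
  cmod (\prod_(i <- r) F i - \prod_(i <- r) G i) <= (size r)%:R * M ^+ size r * e.
Proof.
move=> M1 FM GM FG; have M0 := le_trans ler01 M1.
elim: r => [|i r IH]; first by rewrite !big_nil subrr /cmod sqmod0 sqrtr0 !mul0r.
rewrite !big_cons /=; set a := \prod_(_ <- _) _; set b := \prod_(_ <- _) _.
have -> : F i * a - G i * b = F i * (a - b) + (F i - G i) * b by ring.
have e0 : 0 <= e by apply: le_trans (FG i); exact: cmod_ge0.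
have bM : cmod b <= M ^+ size r.
  rewrite /b cmod_prod; elim: (r) => [|j r' IH']; first by rewrite big_nil.
  by rewrite big_cons exprS; apply: ler_pM => //; rewrite ?cmod_ge0 // prodr_ge0 // => ? _; exact: cmod_ge0.
apply: le_trans (cmodD _ _) _; rewrite !cmodM.
apply: le_trans (_ : M * ((size r)%:R * M ^+ size r * e) + e * M ^+ size r <= _).
  by apply: lerD; apply: ler_pM => //; rewrite ?cmod_ge0.
rewrite -natr1 mulrDl mul1r exprS mulrDl; apply: lerD; last first.
  rewrite mulrC ler_wpM2r // -[leLHS]mul1r ler_wpM2r // exprn_ge0 //.
by rewrite le_eqVlt; apply/orP; left; apply/eqP; ring.
Qed.

Lemma detf_diff_le n A B (M e : R) : 1 <= M ->
  (forall i j, (i < n)%N -> (j < n)%N -> cmod (A i j) <= M) ->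
  (forall i j, (i < n)%N -> (j < n)%N -> cmod (B i j) <= M) ->
  (forall i j, (i < n)%N -> (j < n)%N -> cmod (A i j - B i j) <= e) ->
  cmod (detf n A - detf n B) <= n`!%:R * (n%:R * M ^+ n * e).
Proof.
move=> M1 AM BM AB; rewrite !detfE -sumrB; under eq_bigr do rewrite -mulrBr.
apply: cmod_sum_perm => s.
have := @prod_diff_le _ (index_enum 'I_n) (fun i => A i (s i)) (fun i => B i (s i)) M e M1.
rewrite /index_enum -enumT size_enum_ord; apply => i.
- exact: AM.
- exact: BM.
- exact: AB.
Qed.

End Determinants.

(** * Correlation functions of the Bergman kernel *)

Section Correlations.
Variable R : realType.
Local Notation D := (@disk R).
Local Notation Re := (@complex.Re R).
Local Notation Im := (@complex.Im R).
Implicit Types (p x y : pt R) (s : seq (pt R)).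

(* In this notation [K(x,y) = oneBJ(x,y)^-2], [K(x,x) = bgap(x)^-2] and
   [sqmod (oneBJ x y) = bgap x * bgap y + sqmod (x - y)]. *)
Definition bgap x : R := 1 - nrm2 x.
Definition Kdiag x : R := (bgap x ^+ 2)^-1.

Lemma bgap_gt0 x : D x -> 0 < bgap x.
Proof. by move=> Dx; rewrite subr_gt0. Qed.

Lemma bgap_le1 x : bgap x <= 1.
Proof. by rewrite gerBl nrm2_ge0. Qed.

Lemma Kdiag_gt0 x : D x -> 0 < Kdiag x.
Proof. by move=> Dx; rewrite invr_gt0 exprn_gt0 // bgap_gt0. Qed.

Lemma oneBJ_diag x : oneBJ x x = Complex (bgap x) 0.
Proof. by rewrite /oneBJ -sqmodE sqmod_toC /bgap; apply/eqP; rewrite eq_complex /= subr0 !eqxx. Qed.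

Lemma Kp_diag x : Kp x x = Complex (Kdiag x) 0.
Proof.
by rewrite KpE oneBJ_diag /Kdiag -!/(real_complex _ _) -rmorphXn -fmorphV.
Qed.

Lemma sqmod_oneBJ x y : sqmod (oneBJ x y) = bgap x * bgap y + sqmod (toC x - toC y).
Proof. by case: x => a b; case: y => c e; rewrite /oneBJ /bgap /nrm2 /toC /sqmod /=; ring. Qed.

Lemma sqmod_oneBJ_ge x y : bgap x * bgap y <= sqmod (oneBJ x y).
Proof. by rewrite sqmod_oneBJ lerDl sqmod_ge0. Qed.

Lemma sqmod_Kp x y : sqmod (Kp x y) = (sqmod (oneBJ x y) ^+ 2)^-1.
Proof. by rewrite KpE sqmodV sqmodX. Qed.

Lemma cmod_Kp x y : cmod (Kp x y) = (sqmod (oneBJ x y))^-1.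
Proof. by rewrite KpE cmodV cmodX cmod_sqr. Qed.

Lemma sqmod_Kp_sym x y : sqmod (Kp x y) = sqmod (Kp y x).
Proof. by rewrite (Kp_conj x y) sqmod_conj. Qed.

Lemma sqmod_oneBJ_gt0 x y : D x -> D y -> 0 < sqmod (oneBJ x y).
Proof. by move=> Dx Dy; rewrite lt_def sqmod_ge0 sqmod_eq0 oneBJ_neq0. Qed.

Lemma sqmod_Kp_le x y : D x -> D y -> sqmod (Kp x y) <= Kdiag x * Kdiag y.
Proof.
move=> Dx Dy; rewrite sqmod_Kp /Kdiag -invfM -exprMn.
have t0 : 0 < bgap x * bgap y by rewrite mulr_gt0 ?bgap_gt0.
have d0 := sqmod_oneBJ_gt0 Dx Dy.
rewrite lef_pV2 ?posrE ?exprn_gt0 //.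
by rewrite lerXn2r ?nnegrE ?sqmod_oneBJ_ge // ltW.
Qed.

Lemma rhoE s : rho s = Re (detf (size s) (fun i j => Kp (nth (0,0) s i) (nth (0,0) s j))).
Proof. by []. Qed.

(** The matrix is Hermitian, so its determinant is its own conjugate; the real part in [rho] loses
    nothing and the complex estimates apply to it. *)
Lemma rho_complex s : detf (size s) (fun i j => Kp (nth (0,0) s i) (nth (0,0) s j)) = Complex (rho s) 0.
Proof.
set M := detf _ _.
suff : Im M = 0 by rewrite rhoE -/M; case: M => a b /= ->.
have H : conjc M = M.
  rewrite /M /detf -[in RHS]det_tr !/determinant.
  have conj_sum (I : finType) (F : I -> R[i]) : conjc (\sum_i F i) = \sum_i conjc (F i).
    by elim/big_rec2: _ => [|i a b _ <-]; rewrite ?conjc0 // conjcD.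
  have conj_prod (I : finType) (F : I -> R[i]) : conjc (\prod_i F i) = \prod_i conjc (F i).
    by elim/big_rec2: _ => [|i a b _ <-]; rewrite ?conjc1 // conjcM.
  rewrite conj_sum; apply: eq_bigr => t _; rewrite conjcM conj_prod; congr (_ * _).
    case: (odd_perm t); rewrite ?expr1 ?expr0; last by rewrite conjc1.
    by apply/eqP; rewrite eq_complex /= !oppr0 !eqxx.
  by apply: eq_bigr => i _; rewrite !mxE -Kp_conj.
by move: H; case: M => a b /= [] /eqP; rewrite eqNr => /eqP.
Qed.

Lemma big_nth_seq s (F : pt R -> R) : \prod_(i < size s) F (nth (0,0) s i) = \prod_(x <- s) F x.
Proof. by rewrite (big_nth (0,0)) big_mkord. Qed.

Lemma big_nth_sum s (F : pt R -> R) : \sum_(i < size s) F (nth (0,0) s i) = \sum_(x <- s) F x.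
Proof. by rewrite (big_nth (0,0)) big_mkord. Qed.

Lemma rho_le s : (forall x, x \in s -> D x) ->
  `|rho s| <= (size s)`!%:R * \prod_(x <- s) Kdiag x.
Proof.
move=> sD; have nD i : (i < size s)%N -> D (nth (0,0) s i) by move=> h; apply: sD; exact: mem_nth.
rewrite -big_nth_seq rhoE; apply: le_trans (Re_le_cmod _) _.
apply: (@cmod_detf_le _ _ _ (fun i => Kdiag (nth (0, 0) s i))) => [i /nD|i j /nD Di /nD Dj]; first exact: Kdiag_gt0.
exact: sqmod_Kp_le.
Qed.

Lemma rho_cat s1 s2 : (forall x, x \in s1 ++ s2 -> D x) ->
  `|rho (s1 ++ s2) - rho s1 * rho s2| <= (size s1 + size s2)`!%:R *
   ((\prod_(x <- s1 ++ s2) Kdiag x) * (2 * \sum_(x <- s1) \sum_(y <- s2) sqmod (Kp x y) / (Kdiag x * Kdiag y))).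
Proof.
move=> sD; set s := s1 ++ s2.
have nD i : (i < size s1 + size s2)%N -> D (nth (0,0) s i).
  by rewrite -size_cat => h; apply: sD; exact: mem_nth.
have := @detf_decorrelation R (size s1) (size s2) (fun i j => Kp (nth (0,0) s i) (nth (0,0) s j))
  (fun i => Kdiag (nth (0,0) s i)) (fun i h => Kdiag_gt0 (nD i h))
  (fun i j h h' => sqmod_Kp_le (nD i h) (nD j h')) (fun i j => sqmod_Kp_sym _ _).
have n1 i : (i < size s1)%N -> nth (0,0) s i = nth (0,0) s1 i by move=> h; rewrite nth_cat h.
have n2 i : nth (0,0) s (size s1 + i) = nth (0,0) s2 i by rewrite nth_cat ltnNge leq_addr /= addKn.
have -> : detf (size s1 + size s2) (fun i j => Kp (nth (0,0) s i) (nth (0,0) s j)) = Complex (rho s) 0.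
  by rewrite -size_cat rho_complex.
have -> : detf (size s1) (fun i j => Kp (nth (0,0) s i) (nth (0,0) s j)) = Complex (rho s1) 0.
  rewrite -rho_complex /detf; congr determinant; apply/matrixP => i j; rewrite !mxE !n1 //.
have -> : detf (size s2) (fun i j => Kp (nth (0,0) s (size s1 + i)) (nth (0,0) s (size s1 + j))) = Complex (rho s2) 0.
  by rewrite -rho_complex /detf; congr determinant; apply/matrixP => i j; rewrite !mxE !n2.
have -> : Complex (rho s) 0 - Complex (rho s1) 0 * Complex (rho s2) 0 = Complex (rho s - rho s1 * rho s2) 0.
  by simpc; congr Complex; ring.
rewrite cmodR -[in X in _ <= X -> _]size_cat big_nth_seq size_cat.
move=> H; apply: le_trans H _; rewrite le_eqVlt; apply/orP; left; apply/eqP.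
congr (_ * (_ * (2 * _))).
rewrite -(big_nth_sum s1); apply: eq_bigr => i _; rewrite -(big_nth_sum s2); apply: eq_bigr => j _.
by rewrite n1 // n2.
Qed.

Lemma rho_diff_le s s' (M e : R) : size s = size s' -> 1 <= M ->
  (forall i j, (i < size s)%N -> (j < size s)%N -> cmod (Kp (nth (0,0) s i) (nth (0,0) s j)) <= M) ->
  (forall i j, (i < size s)%N -> (j < size s)%N -> cmod (Kp (nth (0,0) s' i) (nth (0,0) s' j)) <= M) ->
  (forall i j, (i < size s)%N -> (j < size s)%N ->
     cmod (Kp (nth (0,0) s i) (nth (0,0) s j) - Kp (nth (0,0) s' i) (nth (0,0) s' j)) <= e) ->
  `|rho s - rho s'| <= (size s)`!%:R * ((size s)%:R * M ^+ size s * e).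
Proof.
move=> ss M1 AM BM AB; rewrite !rhoE -ReN -ReD; apply: le_trans (Re_le_cmod _) _.
by rewrite -ss; exact: detf_diff_le.
Qed.

(** The difference is (b - a)(b + a) / (a^2 b^2), where a and b are the two values of [oneBJ]; here
    |b - a| <= 2e, |b + a| <= 4, and |a| and |b| are at least 1 - r. *)
Lemma Kp_diff_le (r e : R) x y x' y' : r < 1 -> 
  cmod (toC x) <= r -> cmod (toC y) <= r -> cmod (toC x') <= r -> cmod (toC y') <= r ->
  cmod (toC x - toC x') <= e -> cmod (toC y - toC y') <= e ->
  cmod (Kp x y - Kp x' y') <= 8 * e / (1 - r) ^+ 4.
Proof.
move=> r1 xr yr xr' yr' ex ey.
have r0 : 0 <= r by apply: le_trans xr; exact: cmod_ge0.
have e0 : 0 <= e by apply: le_trans ex; exact: cmod_ge0.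
have dr (a b : pt R) : cmod (toC a) <= r -> cmod (toC b) <= r -> 1 - r <= cmod (oneBJ a b) <= 2.
  move=> ar br.
  have ab : cmod (toC a * conjc (toC b)) <= r.
    rewrite cmodM cmod_conj -[leRHS]mulr1; apply: ler_pM; rewrite ?cmod_ge0 //.
    exact: le_trans br (ltW r1).
  rewrite /oneBJ; apply/andP; split.
    by apply: le_trans (cmod_distB _ _); rewrite cmod1 lerD2l lerN2.
  by apply: le_trans (cmodB _ _) _; rewrite cmod1 -[2]/(1 + 1) lerD2l (le_trans ab) // ltW.
have /andP[d1 d2] := dr _ _ xr yr; have /andP[d1' d2'] := dr _ _ xr' yr'.
have s0 : 0 < 1 - r by rewrite subr_gt0.
have c0 : 0 < cmod (oneBJ x y) by apply: lt_le_trans d1.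
have c0' : 0 < cmod (oneBJ x' y') by apply: lt_le_trans d1'.
have n0 (a b : pt R) : 0 < cmod (oneBJ a b) -> oneBJ a b != 0.
  by apply: contraTneq => ->; rewrite /cmod sqmod0 sqrtr0 ltxx.
have z0 := n0 _ _ c0; have z0' := n0 _ _ c0'.
have -> : Kp x y - Kp x' y' = (oneBJ x' y' - oneBJ x y) * (oneBJ x' y' + oneBJ x y) / (oneBJ x y ^+ 2 * oneBJ x' y' ^+ 2).
  by rewrite !KpE; field; rewrite z0 z0'.
rewrite !cmodM cmodV cmodM !cmodX.
have de : cmod (oneBJ x' y' - oneBJ x y) <= 2 * e.
  have -> : oneBJ x' y' - oneBJ x y = (toC x - toC x') * conjc (toC y) + toC x' * (conjc (toC y - toC y')).
    rewrite /oneBJ conjcD.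
    have -> : conjc (- toC y') = - conjc (toC y') by case: (toC y') => a b; apply/eqP; rewrite eq_complex /= !eqxx.
    by ring.
  apply: le_trans (cmodD _ _) _; rewrite !cmodM !cmod_conj mulr_natl mulr2n.
  apply: lerD; first by rewrite -[leRHS]mulr1; apply: ler_pM; rewrite ?cmod_ge0 // (le_trans yr) // ltW.
  by rewrite -[leRHS]mul1r; apply: ler_pM; rewrite ?cmod_ge0 // (le_trans xr') // ltW.
have ds : cmod (oneBJ x' y' + oneBJ x y) <= 4.
  by apply: le_trans (cmodD _ _) _; lra.
apply: ler_pM; rewrite ?mulr_ge0 ?invr_ge0 ?exprn_ge0 ?cmod_ge0 //.
  by rewrite mulr_ge0 ?exprn_ge0 ?cmod_ge0.
  by rewrite (_ : 8 * e = 2 * e * 4); [apply: ler_pM; rewrite ?cmod_ge0|ring].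
rewrite lef_pV2 ?posrE ?mulr_gt0 ?exprn_gt0 // (_ : (1 - r) ^+ 4 = (1 - r) ^+ 2 * (1 - r) ^+ 2); last by ring.
by apply: ler_pM; rewrite ?exprn_ge0 ?lerXn2r ?nnegrE ?cmod_ge0 // ltW.
Qed.

End Correlations.

(** * Variance bound for pair sums over a finite index set *)

Section VarianceBound.
Variables (R : realType) (I : finType).
(** In the application p i is K(x,x) times the mass of cell i, [kap] is |K(x,y)|^2 / (K(x,x) K(y,y))
    at the centres, and c s is the product of the masses times [rho] at the centres. The 2 in
    [kap_sum] is the reproducing identity with room for discretisation; 24 is 4! and 48 is twice
    4!. *)
Variables (p : I -> R) (kap q : I -> I -> R) (c : seq I -> R).
Hypotheses (p0 : forall i, 0 <= p i) (p1 : forall i, p i <= 1).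
Hypotheses (kap0 : forall i j, 0 <= kap i j) (kapC : forall i j, kap i j = kap j i).
Hypothesis (kap_sum : forall i, \sum_j kap i j * p j <= 2).
Hypotheses (qC : forall i j, q i j = q j i) (qd0 : forall i, 0 <= q i i)
  (q2 : forall i j, q i j ^+ 2 <= q i i * q j j * kap i j).
Let ps (s : seq I) : R := \prod_(a <- s) p a.
Hypothesis c_le : forall s, uniq s -> (size s <= 4)%N -> `|c s| <= 24 * ps s.
Hypothesis c_cat : forall s t, uniq (s ++ t) -> (size s <= 2)%N -> (size t <= 2)%N ->
  `|c (s ++ t) - c s * c t| <= 48 * (ps (s ++ t) * \sum_(a <- s) \sum_(b <- t) kap a b).

Let Q (i : I) : R := q i i + \sum_j `|q i j| * p j.
Let U (s : seq I) : R := ps (undup s).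

Let ps0 s : 0 <= ps s. Proof. exact: prodr_ge0. Qed.

Let UE s : U s = \prod_(a | a \in s) p a.
Proof.
rewrite /U /ps big_uniq ?undup_uniq //; apply: eq_bigl => a; exact: mem_undup.
Qed.

Let U_mem s t : s =i t -> U s = U t.
Proof. by move=> st; rewrite !UE; apply: eq_bigl. Qed.

(** An index common to s and t loses one of its two factors on the right, and p <= 1. *)
Let U_cat_ge s t : U s * U t <= U (s ++ t).
Proof.
rewrite /U undup_cat {3}/ps big_cat /= -!/(ps _) ler_wpM2r // /ps big_filter.
rewrite [leLHS](bigID (fun x => x \notin t)) /= -[leRHS]mulr1 ler_wpM2l ?prodr_ge0 //.
by apply: prodr_ile1 => a _; rewrite p0 p1.
Qed.

Let U2 i j : U [:: i; j] <= (i == j)%:R * p i + p i * p j.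
Proof.
rewrite /U /ps /= inE; case: eqVneq => [->|ij] /=.
  by rewrite big_seq1 mul1r lerDl mulr_ge0.
by rewrite mul0r add0r !big_cons big_nil mulr1.
Qed.

(** The five terms list the ways in which three indices can coincide; each coincidence removes a
    factor p. *)
Let U3 i j l : U [:: i; j; l] <= p i * ((j == i)%:R * (l == i)%:R + (j == i)%:R * p l +
   (l == i)%:R * p j + (j == l)%:R * p j + p j * p l).
Proof.
have pij a b : 0 <= p a * p b by exact: mulr_ge0.
have := mulr_ge0 (p0 i) (pij j l).
have [->|ji] := eqVneq j i.
  rewrite (U_mem (t := [:: i; l])); last by move=> a; rewrite !inE orbA orbb.
  move=> _; apply: le_trans (U2 i l) _; rewrite [i == l]eq_sym.
  have := mulr_ge0 (p0 i) (pij i l).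
  by case: (l == i) => /=; have := pij i i; have := pij i l; have := p0 i; nra.
have [->|li] := eqVneq l i.
  rewrite (U_mem (t := [:: i; j])); last by move=> a; rewrite !inE; case: (a == i); rewrite ?orbT ?orbF.
  move=> h; apply: le_trans (U2 i j) _; rewrite [i == j]eq_sym (negbTE ji) /=.
  by have := pij i j; have := pij i i; nra.
have [<-|jl] := eqVneq j l.
  rewrite (U_mem (t := [:: i; j])); last by move=> a; rewrite !inE orbb.
  move=> h; apply: le_trans (U2 i j) _; rewrite [i == j]eq_sym (negbTE ji) /=.
  by have := pij i j; have := mulr_ge0 (p0 i) (pij j j); nra.
move=> h; rewrite /U /ps undup_id ?big_cons ?big_nil; last first.
  by rewrite /= !inE negb_or eq_sym ji eq_sym li jl.
by rewrite !mul0r !add0r mulr1.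
Qed.

(** Schur test: f i * f j is at most the mean of the two squares, and the rows of [kap] have p-mass
    at most 2. *)
Let kap_half (f : I -> R) : (forall i, 0 <= f i) ->
  \sum_i \sum_j f i * f j * (p i * p j * kap i j) <= 2 * \sum_i p i * f i ^+ 2.
Proof.
move=> f0; pose G i j := f i ^+ 2 * (p i * p j * kap i j).
have e0 i j : 0 <= p i * p j * kap i j by rewrite !mulr_ge0.
apply: le_trans (_ : \sum_i \sum_j 2^-1 * (G i j + G j i) <= _).
  apply: ler_sum => i _; apply: ler_sum => j _; rewrite /G (kapC j i) (mulrC (p j)).
  have := e0 i j; set e := _ * kap i j => e1; have := mulr_ge0 e1 (sqr_ge0 (f i - f j)); nra.
under eq_bigr do rewrite -mulr_sumr big_split /=.
rewrite -mulr_sumr big_split /= [X in _ + X]exchange_big /=; set S := \sum_i _.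
have -> : 2^-1 * (S + S) = S by field.
rewrite /S mulr_sumr; apply: ler_sum => i _; rewrite /G.
have -> : \sum_j f i ^+ 2 * (p i * p j * kap i j) = p i * f i ^+ 2 * \sum_j kap i j * p j.
  by rewrite mulr_sumr; apply: eq_bigr => j _; ring.
by rewrite mulrC ler_wpM2r // mulr_ge0 // sqr_ge0.
Qed.

Lemma sum4_swap12 (F : I -> I -> I -> I -> R) :
  \sum_i \sum_j \sum_k \sum_l F i j k l = \sum_i \sum_j \sum_k \sum_l F j i k l.
Proof. by rewrite exchange_big. Qed.

Lemma sum4_swap34 (F : I -> I -> I -> I -> R) :
  \sum_i \sum_j \sum_k \sum_l F i j k l = \sum_i \sum_j \sum_k \sum_l F i j l k.
Proof. by apply: eq_bigr => i _; apply: eq_bigr => j _; rewrite exchange_big. Qed.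

Let QU i : \sum_j `|q i j| * U [:: i; j] <= p i * Q i.
Proof.
apply: le_trans (_ : \sum_j `|q i j| * ((i == j)%:R * p i + p i * p j) <= _).
  by apply: ler_sum => j _; apply: ler_wpM2l.
under eq_bigr do rewrite mulrDr; rewrite big_split /= /Q mulrDr; apply: lerD.
  rewrite (bigD1 i) //= big1 ?addr0 => [|j /negbTE ji]; first by rewrite eqxx mul1r ger0_norm // mulrC.
  by rewrite eq_sym ji mul0r mulr0.
by rewrite mulr_sumr ler_sum // => j _; rewrite mulrCA.
Qed.

Let Q0 i : 0 <= Q i.
Proof. by rewrite addr_ge0 // sumr_ge0 // => j _; rewrite mulr_ge0. Qed.

Let U0 s : 0 <= U s. Proof. exact: ps0. Qed.

Let B := \sum_i p i * Q i ^+ 2.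

(** Summing over j and l first turns the two pairs into p i * Q i and p k * Q k; the Schur test does
    the rest. *)
Let disjoint_sum :
  \sum_i \sum_j \sum_k \sum_l `|q i j| * `|q k l| * (U [:: i; j] * U [:: k; l] * kap i k) <= 2 * B.
Proof.
apply: le_trans (kap_half Q0).
have -> : \sum_i \sum_j \sum_k \sum_l `|q i j| * `|q k l| * (U [:: i; j] * U [:: k; l] * kap i k) =
    \sum_i \sum_k (\sum_j `|q i j| * U [:: i; j]) * (\sum_l `|q k l| * U [:: k; l]) * kap i k.
  apply: eq_bigr => i _; rewrite exchange_big /=; apply: eq_bigr => k _.
  rewrite !mulr_suml; apply: eq_bigr => j _; rewrite mulr_sumr mulr_suml.
  by apply: eq_bigr => l _; ring.
apply: ler_sum => i _; apply: ler_sum => k _.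
rewrite (_ : Q i * Q k * _ = (p i * Q i) * (p k * Q k) * kap i k); last by ring.
by rewrite ler_wpM2r // ler_pM // sumr_ge0 // => j _; rewrite mulr_ge0.
Qed.

(** The Schur test again, applied to q i i, which is at most Q i. *)
Let sum_q2 : \sum_i \sum_j p i * p j * q i j ^+ 2 <= 2 * B.
Proof.
apply: le_trans (_ : 2 * \sum_i p i * q i i ^+ 2 <= _); last first.
  rewrite ler_wpM2l //; apply: ler_sum => i _; rewrite ler_wpM2l //.
  by rewrite lerXn2r ?nnegrE // lerDl sumr_ge0 // => j _; rewrite mulr_ge0.
apply: le_trans (kap_half qd0); apply: ler_sum => i _; apply: ler_sum => j _.
rewrite [leRHS](_ : _ = p i * p j * (q i i * q j j * kap i j)); last by ring.
by rewrite ler_wpM2l ?mulr_ge0.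
Qed.

(** For i = k the expansion of [U3] assembles into p i times the square of Q i, except for its term
    with j = l, which forms the sum of [sum_q2]: hence 3 = 1 + 2. *)
Let coincident_sum :
  \sum_i \sum_j \sum_k \sum_l (i == k)%:R * (`|q i j| * `|q k l| * U [:: i; j; k; l]) <= 3 * B.
Proof.
have -> : \sum_i \sum_j \sum_k \sum_l (i == k)%:R * (`|q i j| * `|q k l| * U [:: i; j; k; l]) =
   \sum_i \sum_j \sum_l `|q i j| * `|q i l| * U [:: i; j; l].
  apply: eq_bigr => i _; apply: eq_bigr => j _.
  rewrite (bigD1 i) //= [X in _ + X]big1 ?addr0 => [|k /negbTE ki]; last first.
    by rewrite big1 // => l _; rewrite eq_sym ki mul0r.
  apply: eq_bigr => l _; rewrite eqxx mul1r; congr (_ * _).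
  by apply: U_mem => a; rewrite !inE; case: (a == i); case: (a == j); case: (a == l).
apply: le_trans (_ : \sum_i (p i * Q i ^+ 2 + \sum_j p i * p j * q i j ^+ 2) <= _); last first.
  by rewrite big_split /= -/B; have := sum_q2; lra.
apply: ler_sum => i _.
pose S := \sum_j `|q i j| * p j.
apply: le_trans (_ : \sum_j \sum_l `|q i j| * `|q i l| * (p i * ((j == i)%:R * (l == i)%:R + (j == i)%:R * p l +
   (l == i)%:R * p j + (j == l)%:R * p j + p j * p l)) <= _).
  by apply: ler_sum => j _; apply: ler_sum => l _; rewrite ler_wpM2l ?mulr_ge0.
have d1 (F : I -> R) (j : I) : \sum_l (l == j)%:R * F l = F j.
  rewrite (bigD1 j) //= eqxx mul1r big1 ?addr0 // => l /negbTE ->; exact: mul0r.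
have E : \sum_j \sum_l `|q i j| * `|q i l| * (p i * ((j == i)%:R * (l == i)%:R + (j == i)%:R * p l +
   (l == i)%:R * p j + (j == l)%:R * p j + p j * p l)) =
   p i * (`|q i i| * `|q i i| + `|q i i| * S + S * `|q i i| + \sum_j q i j ^+ 2 * p j + S * S).
  transitivity (\sum_j p i * ((j == i)%:R * (`|q i j| * (`|q i i| + S)) + `|q i j| * p j * `|q i i| +
     q i j ^+ 2 * p j + `|q i j| * p j * S)).
    apply: eq_bigr => j _.
    transitivity (p i * `|q i j| * \sum_l ((j == i)%:R * ((l == i)%:R * `|q i l|) + (j == i)%:R * (`|q i l| * p l) +
        (l == i)%:R * (`|q i l| * p j) + (l == j)%:R * (`|q i l| * p j) + p j * (`|q i l| * p l))).
      by rewrite mulr_sumr; apply: eq_bigr => l _; rewrite [l == j]eq_sym; ring.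
    rewrite !big_split /= -!mulr_sumr !d1 -/S -[q i j ^+ 2]real_normK ?num_real //; ring.
  rewrite -mulr_sumr !big_split /= d1 -!mulr_suml -/S; ring.
have -> : \sum_j p i * p j * q i j ^+ 2 = p i * \sum_j q i j ^+ 2 * p j.
  by rewrite mulr_sumr; apply: eq_bigr => j _; ring.
rewrite E /Q -/S ger0_norm // -[leRHS]mulrDr ler_wpM2l // le_eqVlt; apply/orP; left; apply/eqP; ring.
Qed.

Let cu (s : seq I) := c (undup s).

(** If the two pairs share an index there is no cancellation and both parts are bounded separately:
    600 = 24 + 24^2. Otherwise the correlations decouple. *)
Let term_bound i j k l :
  q i j * q k l * (cu [:: i; j; k; l] - cu [:: i; j] * cu [:: k; l]) <=
  48 * (`|q i j| * `|q k l| * (U [:: i; j] * U [:: k; l] * (kap i k + kap i l + kap j k + kap j l))) +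
  600 * (((i == k)%:R + (i == l)%:R + (j == k)%:R + (j == l)%:R) * (`|q i j| * `|q k l| * U [:: i; j; k; l])).
Proof.
have w0 : 0 <= `|q i j| * `|q k l| by rewrite mulr_ge0.
set w := `|q i j| * `|q k l|.
apply: le_trans (ler_norm _) _; rewrite !normrM -/w.
have t1 : 0 <= w * (U [:: i; j] * U [:: k; l] * (kap i k + kap i l + kap j k + kap j l)).
  by rewrite !mulr_ge0 // !addr_ge0.
have t2 : 0 <= ((i == k)%:R + (i == l)%:R + (j == k)%:R + (j == l)%:R) * (w * U [:: i; j; k; l]).
  by rewrite mulr_ge0 ?mulr_ge0 // !addr_ge0.
have [/or4P H|] := boolP [|| i == k, i == l, j == k | j == l].
  have b1 : `|cu [:: i; j; k; l] - cu [:: i; j] * cu [:: k; l]| <= 600 * U [:: i; j; k; l].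
    apply: le_trans (ler_normB _ _) _; rewrite normrM.
    have c4 : `|cu [:: i; j; k; l]| <= 24 * U [:: i; j; k; l].
      by apply: c_le; rewrite ?undup_uniq // (leq_trans (size_undup _)).
    have c2 a b : `|cu [:: a; b]| <= 24 * U [:: a; b].
      by apply: c_le; rewrite ?undup_uniq // (leq_trans (size_undup _)).
    have c22 := ler_pM (normr_ge0 _) (normr_ge0 _) (c2 i j) (c2 k l).
    have := U_cat_ge [:: i; j] [:: k; l]; rewrite /= => uu; nra.
  have d1 : 1 <= (i == k)%:R + (i == l)%:R + (j == k)%:R + (j == l)%:R :> R.
    have n0 (b : bool) : 0 <= b%:R :> R by exact: ler0n.
    have := n0 (i == k); have := n0 (i == l); have := n0 (j == k); have := n0 (j == l).
    by case: H => -> /=; rewrite ?mulr1n; lra.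
  apply: le_trans (_ : w * (600 * U [:: i; j; k; l]) <= _); first by rewrite ler_wpM2l.
  have := mulr_ge0 w0 (U0 [:: i; j; k; l]); rewrite -/w; nra.
rewrite !negb_or => /and4P[ik il jk jl].
apply: le_trans (_ : 48 * (w * (U [:: i; j] * U [:: k; l] * (kap i k + kap i l + kap j k + kap j l))) <= _); last first.
  by rewrite lerDl; apply: mulr_ge0 t2; exact: ler0n.
have dis : undup [:: i; j; k; l] = undup [:: i; j] ++ undup [:: k; l].
  rewrite -[[:: i; j; k; l]]/([:: i; j] ++ [:: k; l]) undup_cat; congr (_ ++ _).
  apply/all_filterP/allP => a; rewrite mem_undup !inE negb_or.
  by case/orP => /eqP ->; rewrite ?ik ?il ?jk ?jl.
have un : uniq (undup [:: i; j] ++ undup [:: k; l]) by rewrite -dis undup_uniq.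
have s2 (a b : I) : (size (undup [:: a; b]) <= 2)%N by rewrite (leq_trans (size_undup _)).
have := c_cat un (s2 i j) (s2 k l); rewrite -dis -!/(cu _) => h.
rewrite [leRHS]mulrCA ler_wpM2l //; apply: le_trans h _; rewrite ler_wpM2l //.
have -> : ps (undup [:: i; j; k; l]) = U [:: i; j] * U [:: k; l] by rewrite dis /ps big_cat.
rewrite ler_wpM2l ?mulr_ge0 //.
have su (F : I -> R) a b : (forall x, 0 <= F x) -> \sum_(x <- undup [:: a; b]) F x <= F a + F b.
  move=> F0; rewrite /= inE; case: eqVneq => [->|_] /=; rewrite !big_cons big_nil addr0 ?lerDr //.
apply: le_trans (su (fun a => \sum_(b <- undup [:: k; l]) kap a b) i j _) _.
  by move=> x; apply: sumr_ge0.
have := su (kap i) k l (kap0 i); have := su (kap j) k l (kap0 j); lra.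
Qed.

(** The symmetry of q reduces the four possible crossings to the one between i and k, and 7584 = 48
    * 4 * 2 + 600 * 4 * 3. *)
Lemma pair_variance_le :
  \sum_i \sum_j \sum_k \sum_l q i j * q k l * cu [:: i; j; k; l] -
  (\sum_i \sum_j q i j * cu [:: i; j]) ^+ 2 <= 7584 * B.
Proof.
have -> : \sum_i \sum_j \sum_k \sum_l q i j * q k l * cu [:: i; j; k; l] -
    (\sum_i \sum_j q i j * cu [:: i; j]) ^+ 2 =
  \sum_i \sum_j \sum_k \sum_l q i j * q k l * (cu [:: i; j; k; l] - cu [:: i; j] * cu [:: k; l]).
  rewrite expr2 mulr_suml -sumrB; apply: eq_bigr => i _.
  rewrite mulr_suml -sumrB; apply: eq_bigr => j _.
  rewrite mulr_sumr -sumrB; apply: eq_bigr => k _.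
  by rewrite mulr_sumr -sumrB; apply: eq_bigr => l _; ring.
pose Fa i j k l := `|q i j| * `|q k l| * (U [:: i; j] * U [:: k; l] * kap i k).
pose Fb i j k l := (i == k)%:R * (`|q i j| * `|q k l| * U [:: i; j; k; l]).
have UC a b : U [:: a; b] = U [:: b; a] by apply: U_mem => x; rewrite !inE orbC.
have swb i j k l : Fb j i k l = (j == k)%:R * (`|q i j| * `|q k l| * U [:: i; j; k; l]).
  rewrite /Fb (qC j i); congr (_ * (_ * _)); apply: U_mem => x; rewrite !inE; by case: (x == i); case: (x == j); case: (x == k); case: (x == l).
have swb' i j k l : Fb i j l k = (i == l)%:R * (`|q i j| * `|q k l| * U [:: i; j; k; l]).
  rewrite /Fb (qC k l); congr (_ * (_ * _)); apply: U_mem => x; rewrite !inE; by case: (x == i); case: (x == j); case: (x == k); case: (x == l).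
have swb'' i j k l : Fb j i l k = (j == l)%:R * (`|q i j| * `|q k l| * U [:: i; j; k; l]).
  rewrite /Fb (qC k l) (qC j i); congr (_ * (_ * _)); apply: U_mem => x; rewrite !inE; by case: (x == i); case: (x == j); case: (x == k); case: (x == l).
apply: le_trans (_ : \sum_i \sum_j \sum_k \sum_l
  (48 * (Fa i j k l + Fa i j l k + Fa j i k l + Fa j i l k) +
   600 * (Fb i j k l + Fb i j l k + Fb j i k l + Fb j i l k)) <= _).
  apply: ler_sum => i _; apply: ler_sum => j _; apply: ler_sum => k _; apply: ler_sum => l _.
  apply: le_trans (term_bound _ _ _ _) _.
  rewrite (swb i j k l) (swb' i j k l) (swb'' i j k l) /Fa /Fb (qC l k) (qC j i) (UC l k) (UC j i) le_eqVlt; apply/orP; left; apply/eqP; ring.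
pose S4 (F : I -> I -> I -> I -> R) := \sum_i \sum_j \sum_k \sum_l F i j k l.
have S4D F G : S4 (fun i j k l => F i j k l + G i j k l) = S4 F + S4 G.
  rewrite /S4 -big_split; apply: eq_bigr => i _; rewrite -big_split; apply: eq_bigr => j _.
  by rewrite -big_split; apply: eq_bigr => k _; rewrite -big_split.
have S4Z a F : S4 (fun i j k l => a * F i j k l) = a * S4 F.
  rewrite /S4 mulr_sumr; apply: eq_bigr => i _; rewrite mulr_sumr; apply: eq_bigr => j _.
  by rewrite mulr_sumr; apply: eq_bigr => k _; rewrite mulr_sumr.
have S4s F : S4 (fun i j k l => F i j k l + F i j l k + F j i k l + F j i l k) = 4 * S4 F.
  rewrite !S4D.
  have e34 G : S4 (fun i j k l => G i j l k) = S4 G by rewrite /S4 [RHS]sum4_swap34.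
  have e12 G : S4 (fun i j k l => G j i k l) = S4 G by rewrite /S4 [RHS]sum4_swap12.
  rewrite (e34 F) (e12 F) (e34 (fun i j k l => F j i k l)) (e12 F); ring.
rewrite -/(S4 _) S4D !S4Z !S4s.
have := disjoint_sum; rewrite -/(S4 Fa); have := coincident_sum; rewrite -/(S4 Fb); lra.
Qed.

End VarianceBound.

(** * Moments of the point process *)

Section NonMeasurable.
Context d (T : measurableType d) (R : realType) (nu : {measure set T -> \bar R}).
Local Open Scope ereal_scope.
Import HBNNSimple.

(* the library integral is a supremum over simple functions, hence monotone on
   nonnegative functions that need not be measurable *)
Lemma ge0_le_integral_nomeas (D : set T) (f g : T -> \bar R) :
  (forall x, D x -> 0 <= f x) -> (forall x, D x -> f x <= g x) ->
  \int[nu]_(x in D) f x <= \int[nu]_(x in D) g x.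
Proof.
move=> f0 fg; have g0 x : D x -> 0 <= g x by move=> Dx; apply: le_trans (f0 x Dx) (fg x Dx).
rewrite !ge0_integralE //; apply: ge_ereal_sup => _ [h /= hf <-].
apply: ereal_sup_ubound; exists h => // x /=; apply: le_trans (hf x) _; rewrite !patchE.
by case: ifPn => //; rewrite inE => /fg.
Qed.

(** The positive and negative parts of h are each squeezed between multiples of the indicator of B.
    No measurability of h is assumed, because h will be an inner integral of an iterated one. *)
Lemma integral_between (D B : set T) (h : T -> \bar R) (a b : R) :
  measurable D -> measurable B -> B `<=` D -> nu B < +oo ->
  (forall x, B x -> a%:E <= h x <= b%:E) -> (forall x, D x -> ~ B x -> h x = 0) ->
  a%:E * nu B <= \int[nu]_(x in D) h x <= b%:E * nu B.
Proof.
move=> mD mB BD fB hab h0.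
have c1 (r : R) : (0 <= r)%R -> \int[nu]_(x in D) (r * \1_B x)%:E = r%:E * nu B.
  move=> r0; under eq_integral do rewrite EFinM.
  rewrite ge0_integralZl_EFin //.
  - by rewrite integral_indic // setIidl.
  - exact/measurable_EFinP/measurable_indic.
have key (g : T -> \bar R) (u v : R) : (0 <= u)%R -> (0 <= v)%R ->
    (forall x, B x -> u%:E <= g x <= v%:E) -> (forall x, D x -> ~ B x -> g x = 0) ->
    u%:E * nu B <= \int[nu]_(x in D) g x <= v%:E * nu B.
  move=> u0 v0 guv g0; rewrite -!c1 //; apply/andP; split; apply: ge0_le_integral_nomeas => x Dx.
  - by rewrite lee_fin mulr_ge0 // indicE.
  - rewrite indicE; case: (pselect (B x)) => Bx.
      by rewrite mem_set // mulr1; have /andP[] := guv x Bx.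
    by rewrite memNset // mulr0 g0.
  - case: (pselect (B x)) => Bx; last by rewrite g0.
    by have /andP[gu _] := guv x Bx; apply: le_trans gu; rewrite lee_fin.
  - rewrite indicE; case: (pselect (B x)) => Bx.
      by rewrite mem_set // mulr1; have /andP[] := guv x Bx.
    by rewrite memNset // mulr0 g0.
have [M0 nuB] : exists M, nu B = M%:E.
  by exists (fine (nu B)); rewrite fineK // ge0_fin_numE.
rewrite integralE.
have /andP[p1 p2] : (Num.max a 0)%:E * nu B <= \int[nu]_(x in D) h^\+ x <= (Num.max b 0)%:E * nu B.
  apply: key; rewrite ?le_max ?lexx ?orbT //.
    move=> x Bx; have /andP[h1 h2] := hab x Bx.
    by rewrite funeposE !EFin_max; apply/andP; split; rewrite ge_max !le_max ?h1 ?h2 ?lexx ?orbT.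
  by move=> x Dx Bx; rewrite funeposE h0 // maxxx.
have /andP[n1 n2] : (Num.max (- b) 0)%:E * nu B <= \int[nu]_(x in D) h^\- x <= (Num.max (- a) 0)%:E * nu B.
  apply: key; rewrite ?le_max ?lexx ?orbT //.
    move=> x Bx; have /andP[h1 h2] := hab x Bx.
    rewrite funenegE !EFin_max; apply/andP; split; rewrite ge_max !le_max ?lexx ?orbT ?andbT.
      by rewrite EFinN leeN2 h2.
    by rewrite EFinN leeN2 h1.
  by move=> x Dx Bx; rewrite funenegE h0 // oppe0 maxxx.
(* Subtracting the bounds for the two parts gives back a and b, since r is the difference of its
   positive and negative parts. *)
have mE (r : R) : (r = Num.max r 0 - Num.max (- r) 0)%R.
  by rewrite /Num.max; case: ltP => r1; case: ltP => r2; lra.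
rewrite [in a%:E](mE a) [in b%:E](mE b) !EFinB nuB in p1 p2 n1 n2 *.
rewrite ?muleBl ?fin_numE //.
by apply/andP; split; apply: leeB.
Qed.

End NonMeasurable.

(** * Mixed moments of counts on disjoint sets *)

Section Moments.
Variable R : realType.
Local Notation mu := (@mu R).
Local Notation D := (@disk R).
Local Notation lam := (@lebesgue_measure R \x @lebesgue_measure R)%E.
Implicit Types (B U : set (pt R)).

Definition mass B : R := fine (mu B).

Lemma mu_mass B : measurable B -> B `<=` D -> mu B = (mass B)%:E.
Proof.
move=> mB BD; rewrite /mass fineK // ge0_fin_numE //.
apply: le_lt_trans (mu_disk_lty R); apply: le_measure; rewrite ?inE //.
exact: measurable_disk.
Qed.

Lemma mass_ge0 B : 0 <= mass B.
Proof. by rewrite /mass fine_ge0. Qed.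

Lemma muint_between B (h : pt R -> \bar R) (a b : R) : measurable B -> B `<=` D ->
  (forall x, B x -> (a%:E <= h x <= b%:E)%E) -> (forall x, D x -> ~ B x -> h x = 0%E) ->
  ((a * mass B)%:E <= muint D h <= (b * mass B)%:E)%E.
Proof.
move=> mB BD hab h0.
have pi0 : (0 < pi^-1 :> R)%R by rewrite invr_gt0 pi_gt0.
have mulamE : (mu B = (pi^-1)%:E * lam B)%E by [].
have fB : (lam B < +oo)%E.
  have := mu_mass mB BD; rewrite mulamE.
  case: (lam B) => [r _|H|]; [exact: ltry| |by []].
  by exfalso; move: H; rewrite gt0_muley ?lte_fin.
have [r rE] : exists r, lam B = r%:E.
  exists (fine (lam B)); rewrite fineK // ge0_fin_numE //; exact: measure_ge0.
have mE : mass B = pi^-1 * r by rewrite /mass mulamE rE.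
have : (a%:E * lam B <= \int[@leb2 R]_(x in D) h x <= b%:E * lam B)%E.
  exact: (@integral_between _ _ R lam D B h a b (@measurable_disk R) mB BD fB hab h0).
rewrite rE /muint -!EFinM => /andP[h1 h2].
by rewrite mE !(mulrCA _ pi^-1) !(EFinM pi^-1); apply/andP; split; rewrite lee_wpmul2l // lee_fin ltW.
Qed.

(** One coordinate is peeled off at a time; outside its set the inner integral vanishes, being
    squeezed between 0 and 0. *)
Lemma iter_muint_between (Bs : seq (set (pt R))) (g : seq (pt R) -> \bar R) (a b : R) :
  (forall B, B \in Bs -> measurable B /\ B `<=` D) ->
  (forall s, size s = size Bs -> (forall i, (i < size Bs)%N -> nth set0 Bs i (nth (0,0) s i)) ->
     (a%:E <= g s <= b%:E)%E) ->
  (forall s i, size s = size Bs -> (i < size Bs)%N -> ~ nth set0 Bs i (nth (0,0) s i) -> g s = 0%E) ->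
  ((a * \prod_(B <- Bs) mass B)%:E <= iter_muint (size Bs) g <= (b * \prod_(B <- Bs) mass B)%:E)%E.
Proof.
elim: Bs g a b => [|B Bs IH] g a b mBs gin gout /=.
  by rewrite big_nil !mulr1; apply: gin.
have [mB BD] := mBs B (mem_head _ _).
have mBs' B' : B' \in Bs -> measurable B' /\ B' `<=` D by move=> h; apply: mBs; rewrite inE h orbT.
rewrite big_cons (mulrCA a) (mulrCA b) !(mulrC (mass B)); apply: muint_between => //.
  move=> x Bx; apply: IH => //.
    by move=> s ss sB; apply: gin => [|[|i]] //=; rewrite ?ss // => h; exact: sB.
  by move=> s i ss si sB; apply: (gout (x :: s) i.+1) => //=; rewrite ss.
move=> x Dx Bx; apply/eqP; rewrite eq_le.
have := IH (fun s => g (x :: s)) 0 0 mBs'; rewrite !mul0r andbC; apply.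
  by move=> s ss _; rewrite (gout (x :: s) 0%N) //= ?ss // lexx.
by move=> s i ss si sB; apply: (gout (x :: s) i.+1) => //=; rewrite ss.
Qed.

Section DPP.
Context d (Omega : measurableType d) (P : probability Omega R) (X : Omega -> set (pt R)).
Hypothesis HX : is_DPP_K P X.

Definition npt B (w : Omega) : R := fine (npts (X w) B).

Definition pts U (w : Omega) : seq (pt R) := finmap.enum_fset (fset_set (X w `&` U)).

Lemma pts_uniq U w : uniq (pts U w).
Proof. exact: finmap.fset_uniq. Qed.

Lemma mem_pts U w x : relcompact U -> (x \in pts U w) = (x \in X w `&` U).
Proof.
move=> cU; have [_ fX] := HX.1 w.
by rewrite -(in_fset_set (fX U cU)).
Qed.

Lemma npts_pts U B w : relcompact U -> B `<=` U ->
  npts (X w) B = (\sum_(x <- pts U w) \1_B x)%:E.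
Proof.
move=> cU BU; have fXU : finite_set (X w `&` U) by have [_] := HX.1 w; apply.
rewrite /npts (_ : X w `&` B = (X w `&` U) `&` B); last by rewrite -setIA (setIidr BU).
rewrite esum_mkcondr esum_fset //; last by move=> x _; case: ifP.
rewrite fsbig_finite // -sumEFin; apply: eq_bigr => x _.
by rewrite indicE; case: (x \in B).
Qed.

Lemma npt_pts U B w : relcompact U -> B `<=` U -> npt B w = \sum_(x <- pts U w) \1_B x.
Proof. by move=> cU BU; rewrite /npt (npts_pts _ cU BU). Qed.

Lemma npt_ge0 B w : 0 <= npt B w.
Proof. by rewrite /npt fine_ge0 // /npts esum_ge0. Qed.

Lemma nptsE B w : relcompact B -> npts (X w) B = (npt B w)%:E.
Proof. by move=> cB; rewrite (npt_pts _ cB (@subset_refl _ B)) (npts_pts _ cB (@subset_refl _ B)). Qed.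

Lemma measurable_npt B : measurable B -> relcompact B -> measurable_fun setT (npt B).
Proof.
move=> mB cB; have [_ [mX _]] := HX.
apply: (measurableT_comp (f := fine)); first exact: fine_measurable.
exact: mX.
Qed.

Lemma measurable_prod_npt (Bs : seq (set (pt R))) :
  (forall B, B \in Bs -> measurable B /\ relcompact B) ->
  measurable_fun setT (fun w => \prod_(B <- Bs) npt B w).
Proof.
elim: Bs => [|B Bs IH] mBs.
  by under eq_fun do rewrite big_nil; exact: measurable_cst.
under eq_fun do rewrite big_cons; apply: measurable_funM.
  by have [? ?] := mBs B (mem_head _ _); exact: measurable_npt.
by apply: IH => B' h; apply: mBs; rewrite inE h orbT.
Qed.

Lemma eprodE (l : seq R) : eprod [seq x%:E | x <- l] = (\prod_(x <- l) x)%:E.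
Proof. by elim: l => [|x l IH]; rewrite ?big_nil // big_cons /= IH. Qed.

Lemma relcompact_disk B : relcompact B -> B `<=` D.
Proof. by move=> [r [r1 Br]] x /Br /= xr; apply: le_lt_trans xr r1. Qed.

(** Meant for small cells, with a and b close to the value of [rho] at the centres; the upper bound
    also yields integrability. *)
Lemma moment_between (Bs : seq (set (pt R))) (a b : R) :
  (forall B, B \in Bs -> measurable B /\ relcompact B) ->
  (forall i j, (i < j < size Bs)%N -> nth set0 Bs i `&` nth set0 Bs j = set0) ->
  (forall s, size s = size Bs -> (forall i, (i < size Bs)%N -> nth set0 Bs i (nth (0,0) s i)) ->
     a <= rho s <= b) ->
  P.-integrable setT (fun w => (\prod_(B <- Bs) npt B w)%:E) /\
  a * \prod_(B <- Bs) mass B <= \int[P]_w (\prod_(B <- Bs) npt B w) <= b * \prod_(B <- Bs) mass B.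
Proof.
move=> mBs tBs rs; have [_ [_ /(_ Bs mBs tBs) E]] := HX.
have {}E : (\int[P]_w (\prod_(B <- Bs) npt B w)%:E = iter_muint (size Bs) (fun s =>
       ((\prod_(i < size Bs) (\1_(nth set0 Bs i) (nth (0%R, 0%R) s i) : R)) * rho s)%:E))%E.
  rewrite -E; apply: eq_integral => w _; rewrite -(big_map (npt ^~ w) xpredT id) -eprodE -map_comp.
  by congr eprod; apply/eq_in_map => B BBs /=; rewrite nptsE //; exact: (mBs B BBs).2.
have mBs' B : B \in Bs -> measurable B /\ B `<=` D.
  by move=> /mBs [mB cB]; split => //; exact: relcompact_disk.
have /andP[b1 b2] : ((a * \prod_(B <- Bs) mass B)%:E <= \int[P]_w (\prod_(B <- Bs) npt B w)%:E <= (b * \prod_(B <- Bs) mass B)%:E)%E.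
  rewrite E; apply: iter_muint_between => //.
    move=> s ss sB; rewrite big1 ?mul1r ?lee_fin; first exact: rs.
    by move=> i _; rewrite indicE mem_set //; exact: sB.
  move=> s i ss si sB; rewrite (bigD1 (Ordinal si)) //= indicE memNset // !mul0r.
  by [].
have g0 w : 0 <= \prod_(B <- Bs) npt B w by apply: prodr_ge0 => B _; exact: npt_ge0.
have mg : measurable_fun setT (fun w => \prod_(B <- Bs) npt B w).
  by apply: measurable_prod_npt => B /mBs [].
have fin : (\int[P]_w (\prod_(B <- Bs) npt B w)%:E < +oo)%E by apply: le_lt_trans b2 (ltry _).
split.
  apply/integrableP; split; first exact/measurable_EFinP.
  by under eq_integral do rewrite gee0_abs ?lee_fin //.
rewrite /Rintegral -!lee_fin fineK ?b1 ?b2 //.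
by rewrite ge0_fin_numE // integral_ge0 // => w _; rewrite lee_fin.
Qed.

End DPP.
End Moments.

(** * Discretisation of linear statistics of pairs *)

Section DistinctProducts.
Variables (R : realType) (I : finType) (v : I -> R).
Hypothesis v0 : forall i, 0 <= v i.

(* On a fine partition the cell counts are 0 or 1, so repeated indices count once. *)
Definition uprod (s : seq I) : R := \prod_(a <- undup s) v a.

Lemma uprod_ge0 s : 0 <= uprod s.
Proof. exact: prodr_ge0. Qed.

(** A new index either repeats one of the at most [size s] indices of s, without effect on the
    product, or brings a factor v l. *)
Lemma sum_uprod_cons s : \sum_l uprod (l :: s) <= ((size s)%:R + \sum_l v l) * uprod s.
Proof.
apply: le_trans (_ : \sum_l ((l \in s)%:R + v l) * uprod s <= _).
  apply: ler_sum => l _; rewrite /uprod /=; case: ifP => ls /=; rewrite mulrDl.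
    by rewrite mul1r lerDl mulr_ge0 ?uprod_ge0.
  by rewrite big_cons mul0r add0r.
rewrite -mulr_suml big_split /= ler_wpM2r ?uprod_ge0 // lerD2r.
have -> : \sum_l (l \in s)%:R = #|s|%:R :> R.
  by rewrite -sum1_card natr_sum [RHS]big_mkcond /=; apply: eq_bigr => l _; case: ifP.
by rewrite ler_nat card_size.
Qed.

Lemma sum2_uprod : \sum_i \sum_j uprod [:: i; j] <= (\sum_l v l) * (1 + \sum_l v l).
Proof.
set V := \sum_l v l; have V0 : 0 <= V by exact: sumr_ge0.
have s1 j : \sum_i uprod [:: i; j] <= (1 + V) * uprod [:: j] by exact: (sum_uprod_cons [:: j]).
rewrite exchange_big /=; apply: le_trans (ler_sum _ (fun j _ => s1 j)) _.
rewrite -mulr_sumr mulrC ler_wpM2r ?addr_ge0 //.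
by apply: le_trans (sum_uprod_cons [::]) _; rewrite add0r /uprod big_nil mulr1.
Qed.

(** Summing out one index costs at most 3 plus the total of v, as at most three other indices
    remain. *)
Lemma sum4_uprod : \sum_i \sum_j \sum_k \sum_l uprod [:: i; j; k; l] <= (3 + \sum_l v l) ^+ 4.
Proof.
set V := \sum_l v l; have V0 : 0 <= V by exact: sumr_ge0.
have s1 (s : seq I) (m : nat) : (size s <= m)%N -> \sum_i uprod (i :: s) <= (m%:R + V) * uprod s.
  move=> sm; apply: le_trans (sum_uprod_cons s) _; rewrite ler_wpM2r ?uprod_ge0 // lerD2r ler_nat //.
have V3 : 0 <= 3 + V by rewrite addr_ge0.
have -> : \sum_i \sum_j \sum_k \sum_l uprod [:: i; j; k; l] = \sum_l \sum_k \sum_j \sum_i uprod [:: i; j; k; l].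
  under eq_bigr do under eq_bigr do rewrite exchange_big.
  under eq_bigr do rewrite exchange_big.
  rewrite exchange_big /=; apply: eq_bigr => l _.
  under eq_bigr do rewrite exchange_big.
  rewrite exchange_big /=; apply: eq_bigr => k _; exact: exchange_big.
apply: le_trans (_ : \sum_l \sum_k \sum_j (3 + V) * uprod [:: j; k; l] <= _).
  by do 3 (apply: ler_sum => ? _); exact: s1.
apply: le_trans (_ : \sum_l \sum_k (3 + V) * ((3 + V) * uprod [:: k; l]) <= _).
  do 2 (apply: ler_sum => ? _); rewrite -mulr_sumr ler_wpM2l //; exact: s1.
apply: le_trans (_ : \sum_l (3 + V) * ((3 + V) * ((3 + V) * uprod [:: l])) <= _).
  apply: ler_sum => ? _; rewrite -!mulr_sumr !ler_wpM2l //; exact: s1.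
rewrite -!mulr_sumr !exprS expr0 !ler_wpM2l // mulr1.
by apply: le_trans (s1 [::] 3%N isT) _; rewrite /uprod big_nil mulr1.
Qed.

End DistinctProducts.

(** Cells may be empty, as grid squares missing U are; the centre is therefore only required to lie
    in U. *)
Record is_partition (R : realType) (U : set (pt R)) (I : finType) (B : I -> set (pt R))
    (c : I -> pt R) (e : R) : Prop := IsPartition {
  cell_measurable : forall i, measurable (B i);
  cell_sub : forall i, B i `<=` U;
  cell_disjoint : forall i j, i != j -> B i `&` B j = set0;
  cell_cover : forall x, U x -> exists i, B i x;
  cell_center : forall i, U (c i);
  cell_radius : forall i x, B i x -> cmod (toC x - toC (c i)) <= e;
  cell_radius_ge0 : 0 <= e }.

(** * Counts and masses over a fixed partition *)

Section FixedPartition.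
Variable R : realType.
Local Notation mu := (@mu R).
Local Notation D := (@disk R).
Context d (Omega : measurableType d) (P : probability Omega R) (X : Omega -> set (pt R)).
Hypothesis HX : is_DPP_K P X.
Variables (U : set (pt R)) (r : R).
Hypotheses (r0 : 0 <= r) (r1 : r < 1) (Ur : forall x, U x -> cmod (toC x) <= r).

Lemma U_relcompact : relcompact U.
Proof.
exists (r ^+ 2); split; first by rewrite expr_lt1.
by move=> y Uy /=; rewrite -[leLHS]/(sqmod (toC y)) -cmod_sqr lerXn2r ?nnegrE ?cmod_ge0 // Ur.
Qed.

Lemma U_disk : U `<=` D.
Proof. exact: relcompact_disk U_relcompact. Qed.

Lemma cmod_Kp_le x y : U x -> U y -> cmod (Kp x y) <= ((1 - r) ^+ 2)^-1.
Proof.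
move=> Ux Uy; have s0 : 0 < 1 - r by rewrite subr_gt0.
have dx : 1 - r <= cmod (oneBJ x y).
  apply: le_trans (cmod_distB _ _); rewrite cmod1 lerD2l lerN2 cmodM cmod_conj.
  rewrite -[leRHS]mulr1; apply: ler_pM; rewrite ?cmod_ge0 ?Ur //.
  exact: le_trans (Ur Uy) (ltW r1).
rewrite KpE cmodV cmodX lef_pV2 ?posrE ?exprn_gt0 //; last exact: lt_le_trans dx.
by rewrite lerXn2r ?nnegrE ?cmod_ge0 // ltW.
Qed.

Variables (I : finType) (B : I -> set (pt R)) (c : I -> pt R) (e : R).
Hypothesis Hpart : is_partition U B c e.

Let mB i : measurable (B i). Proof. by case: Hpart. Qed.
Let BU i : B i `<=` U. Proof. by case: Hpart. Qed.
Let Bdisj i j : i != j -> B i `&` B j = set0. Proof. by case: Hpart => _ _ + _ _ _ _; apply. Qed.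
Let Bcov x : U x -> exists i, B i x. Proof. by case: Hpart => _ _ _ + _ _ _; apply. Qed.
Let cU i : U (c i). Proof. by case: Hpart. Qed.
Let Bc i x : B i x -> cmod (toC x - toC (c i)) <= e. Proof. by case: Hpart => _ _ _ _ _ + _; apply. Qed.
Let e0 : 0 <= e. Proof. by case: Hpart. Qed.

Let BD i : B i `<=` D. Proof. by move=> x /BU /U_disk. Qed.
Let rcB i : relcompact (B i).
Proof. by have [t [t1 Ut]] := U_relcompact; exists t; split => // x /BU /Ut. Qed.

Definition ccount (w : Omega) (a : I) : R := npt X (B a) w.
Definition cmass (a : I) : R := mass (B a).
Definition crho (s : seq I) : R := rho [seq c a | a <- undup s].
(** Modulus of continuity of [rho] for at most four points: 4! permutations, four entries each
    bounded by (1 - r)^(-2), and the Lipschitz constant of [Kp_diff_le]. *)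
Definition osc_cst : R := 24 * (4 * (((1 - r) ^+ 2)^-1) ^+ 4 * (8 / (1 - r) ^+ 4)).

Lemma osc_cst_ge0 : 0 <= osc_cst.
Proof.
have s0 : 0 < 1 - r by rewrite subr_gt0.
by rewrite !mulr_ge0 ?exprn_ge0 ?invr_ge0 ?exprn_ge0 // ltW.
Qed.

Lemma fact_le24 n : (n <= 4)%N -> (n`!%:R : R) <= 24.
Proof. by case: n => [|[|[|[|[|n]]]]] // _; rewrite -[24]/(4`!%:R) ler_nat. Qed.

(** Distinct cells are disjoint, so the correlation functions apply to [undup s]; over the product
    of these cells [rho] stays within [osc_cst * e] of its value at the centres. *)
Lemma moment_uprod s : (size s <= 4)%N ->
  P.-integrable setT (fun w => (uprod (ccount w) s)%:E) /\
  `|\int[P]_w uprod (ccount w) s - uprod cmass s * crho s| <= osc_cst * e * uprod cmass s.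
Proof.
move=> s4; pose Bs := [seq B a | a <- undup s].
have s4' : (size (undup s) <= 4)%N by apply: leq_trans (size_undup _) s4.
have sBs : size Bs = size (undup s) by rewrite size_map.
have s0 : 0 < 1 - r by rewrite subr_gt0.
have M1 : 1 <= ((1 - r) ^+ 2)^-1.
  by rewrite invf_ge1 ?exprn_gt0 // exprn_ile1 ?(ltW s0) // gerBl.
have nthB i : (i < size (undup s))%N -> exists2 a, nth set0 Bs i = B a & nth (0,0) [seq c a | a <- undup s] i = c a /\ index a (undup s) = i.
  rewrite /Bs; case E : (undup s) => [//|a0 s'] si; exists (nth a0 (a0 :: s') i); first by rewrite (nth_map a0).
  by rewrite (nth_map a0) //; split => //; rewrite index_uniq // -E undup_uniq.
have [||t st tB|iP /andP[h1 h2]] := @moment_between R _ _ P X HX Bs (crho s - osc_cst * e) (crho s + osc_cst * e).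
- by move=> B' /mapP[a _ ->].
- move=> i j /andP[ij]; rewrite sBs => js.
  have [a -> [_ ia]] := nthB i (ltn_trans ij js); have [a' -> [_ ja]] := nthB j js.
  by apply: Bdisj; apply/eqP => aa; move: ij; rewrite -ia -ja aa ltnn.
- rewrite sBs in st tB.
  suff : `|rho t - crho s| <= osc_cst * e by rewrite ler_norml => /andP[h1 h2]; apply/andP; split; lra.
  have tn i : (i < size t)%N -> U (nth (0,0) t i) /\ U (nth (0,0) [seq c a | a <- undup s] i) /\
      cmod (toC (nth (0,0) t i) - toC (nth (0,0) [seq c a | a <- undup s] i)) <= e.
    rewrite st => si; have [a Ea [-> _]] := nthB i si; have := tB i si; rewrite Ea => h.
    by split; [exact: BU h|split; [exact: cU|exact: Bc]].
  apply: le_trans (@rho_diff_le R t [seq c a | a <- undup s] ((1 - r) ^+ 2)^-1 (8 * e / (1 - r) ^+ 4) _ M1 _ _ _) _.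
  + by rewrite st size_map.
  + by move=> i j /tn [? _] /tn [? _]; exact: cmod_Kp_le.
  + by move=> i j /tn [_ [? _]] /tn [_ [? _]]; exact: cmod_Kp_le.
  + move=> i j /tn [u1 [u2 u3]] /tn [v1 [v2 v3]].
    by apply: Kp_diff_le => //; exact: Ur.
  + rewrite st /osc_cst; set M := ((1 - r) ^+ 2)^-1; set n := size (undup s).
    have Mn : M ^+ n <= M ^+ 4 by rewrite ler_weXn2l.
    have q0 : 0 <= 8 * e / (1 - r) ^+ 4 by rewrite !mulr_ge0 ?invr_ge0 ?exprn_ge0 // ltW.
    have M0 : 0 <= M by exact: le_trans M1.
    have -> : 24 * (4 * M ^+ 4 * (8 / (1 - r) ^+ 4)) * e = 24 * (4 * M ^+ 4 * (8 * e / (1 - r) ^+ 4)) by ring.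
    apply: ler_pM => //; first by apply: mulr_ge0 => //; apply: mulr_ge0; [exact: ler0n|exact: exprn_ge0].
      exact: fact_le24.
    by rewrite ler_wpM2r //; apply: ler_pM; rewrite ?exprn_ge0 // ler_nat.
have E w : \prod_(B' <- Bs) npt X B' w = uprod (ccount w) s by rewrite /Bs big_map.
have Em : \prod_(B' <- Bs) mass B' = uprod cmass s by rewrite /Bs big_map.
rewrite Em in h1 h2.
split; first by under eq_fun do rewrite -E.
under eq_Rintegral do rewrite -E.
rewrite ler_norml; apply/andP; split; nra.
Qed.


Lemma cell_uniq i j x : B i x -> B j x -> i = j.
Proof.
move=> Bi Bj; apply/eqP/negPn/negP => ij.
by have : (B i `&` B j) x by []; rewrite Bdisj.
Qed.

Lemma sum_cell (f : I -> R) i x : B i x -> \sum_j f j * \1_(B j) x = f i.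
Proof.
move=> Bx; rewrite (bigD1 i) //= indicE mem_set // mulr1 big1 ?addr0 // => j ji.
rewrite indicE memNset ?mulr0 // => Bj; move/eqP: ji; apply; exact: cell_uniq Bj Bx.
Qed.

Lemma sum_cell_out (f : I -> R) x : ~ U x -> \sum_j f j * \1_(B j) x = 0.
Proof.
by move=> Ux; rewrite big1 // => j _; rewrite indicE memNset ?mulr0 // => /BU.
Qed.

Lemma sum_massE (h : I -> R) : (forall i, 0 <= h i) ->
  ((\sum_i h i * cmass i)%:E = \int[mu]_(x in D) (\sum_i h i * \1_(B i) x)%:E)%E.
Proof.
move=> h0; have mD := @measurable_disk R.
rewrite -sumEFin; under [RHS]eq_integral do rewrite -sumEFin.
rewrite ge0_integral_sum //; last first.
- by move=> i x _; rewrite lee_fin mulr_ge0 // indicE.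
- by move=> i; apply: measurable_funTS; apply/measurable_EFinP; apply: measurable_funM => //; apply: measurable_indic; exact: mB.
apply: eq_bigr => i _; under eq_integral do rewrite EFinM.
rewrite ge0_integralZl_EFin //; last first.
- by apply: measurable_funTS; apply/measurable_EFinP; apply: measurable_indic; exact: mB.
rewrite (@integral_indic _ _ R mu D mD (B i) (mB i)).
rewrite setIidl; last exact: BD.
by rewrite EFinM; congr (_ * _)%E; rewrite -mu_mass //; exact: BD.
Qed.

(** The left side is the integral of a step function lying below H. *)
Lemma riemann_le (h : I -> R) (H : pt R -> R) : (forall i, 0 <= h i) -> (forall x, 0 <= H x) ->
  measurable_fun D H -> (forall i x, B i x -> h i <= H x) ->
  ((\sum_i h i * cmass i)%:E <= \int[mu]_(x in D) (H x)%:E)%E.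
Proof.
move=> h0 H0 mH hH; rewrite sum_massE //; apply: ge0_le_integral_nomeas => x _.
  by rewrite lee_fin sumr_ge0 // => i _; rewrite mulr_ge0 // indicE.
rewrite lee_fin; have [Ux|Ux] := pselect (U x); last by rewrite sum_cell_out //; exact: H0.
by have [i Bx] := Bcov Ux; rewrite (sum_cell _ Bx) hH.
Qed.

Lemma mass_cover_le (A : set (pt R)) (J : pred I) : measurable A -> A `<=` D ->
  (forall x, A x -> exists2 i, J i & B i x) -> mass A <= \sum_(i | J i) cmass i.
Proof.
move=> mA AD AJ; have mD := @measurable_disk R.
rewrite -lee_fin -mu_mass // -[A](setIidl AD) -(@integral_indic _ _ R mu D mD A mA) [leRHS](_ : _ = (\sum_i (J i)%:R * cmass i)%:E); last first.
  by congr EFin; rewrite big_mkcond; apply: eq_bigr => i _; case: (J i); rewrite ?mul1r ?mul0r.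
rewrite sum_massE; last by move=> i; exact: ler0n.
apply: ge0_le_integral_nomeas => x _; rewrite lee_fin ?indicE //.
have [Ax|Ax] := pselect (A x); last first.
  by rewrite memNset //= sumr_ge0 // => i _; rewrite mulr_ge0 // indicE.
by have [i Ji Bx] := AJ x Ax; rewrite (sum_cell _ Bx) Ji mem_set.
Qed.

Lemma cmass_ge0 i : 0 <= cmass i.
Proof. exact: mass_ge0. Qed.

Lemma sum_cmass_le1 : \sum_i cmass i <= 1.
Proof.
have := @riemann_le (fun=> 1) (fun=> 1) (fun=> ler01) (fun=> ler01) (measurable_cst _) (fun _ _ _ => lexx _).
have -> : (\int[mu]_(x in D) 1%:E = 1)%E.
  by rewrite integral_cst ?mul1e; [exact: mu_disk|exact: measurable_disk].
by rewrite lee_fin; under eq_bigr do rewrite mul1r.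
Qed.

Lemma ccount_ge0 w a : 0 <= ccount w a.
Proof. exact: npt_ge0. Qed.

Lemma nnE w a : ccount w a = \sum_(x <- pts X U w) \1_(B a) x.
Proof. by apply: (npt_pts HX); [exact: U_relcompact|exact: BU]. Qed.

Lemma sum_ccount (f : I -> R) (ix : pt R -> I) w : (forall x, U x -> B (ix x) x) ->
  \sum_a f a * ccount w a = \sum_(x <- pts X U w) f (ix x).
Proof.
move=> hix; under eq_bigr do rewrite nnE mulr_sumr.
rewrite exchange_big /= !big_seq; apply: eq_bigr => x.
rewrite (mem_pts HX _ _ U_relcompact) inE => -[_ Ux].
exact: sum_cell (hix _ Ux).
Qed.

Lemma moment_sum (J : finType) (sg : J -> seq I) (F : J -> R) (Qm : R) :
  (forall t, (size (sg t) <= 4)%N) -> (forall t, `|F t| <= Qm) ->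
  P.-integrable setT (fun w => (\sum_t F t * uprod (ccount w) (sg t))%:E) /\
  `|\int[P]_w (\sum_t F t * uprod (ccount w) (sg t)) - \sum_t F t * (uprod cmass (sg t) * crho (sg t))| <=
    Qm * (osc_cst * e) * \sum_t uprod cmass (sg t).
Proof.
move=> s4 FQ.
have iF t : P.-integrable setT (EFin \o (fun w => F t * uprod (ccount w) (sg t))).
  by apply: eq_integrable (integrableZl measurableT (F t) (moment_uprod (s4 t)).1).
split; first exact: integrable_sumr.
rewrite Rintegral_sum // -sumrB mulr_sumr; apply: le_trans (ler_norm_sum _ _ _) _.
apply: ler_sum => t _; have [i1 b1] := moment_uprod (s4 t).
rewrite RintegralZl // -mulrBr normrM -mulrA; apply: ler_pM => //.
Qed.

Lemma uprod_idem (v : I -> R) (s : seq I) : (forall a, v a = 0 \/ v a = 1) ->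
  uprod v s = \prod_(a <- s) v a.
Proof.
move=> v01; rewrite /uprod; elim: s => [|a s IH] //=; rewrite big_cons.
case: ifP => ha; last by rewrite big_cons IH.
rewrite IH; have [a0|->] := v01 a; last by rewrite mul1r.
rewrite a0 mul0r; apply/eqP; rewrite prodf_seq_eq0; apply/hasP; exists a => //=.
by rewrite a0.
Qed.

Lemma ccount_01 w (ix : pt R -> I) : (forall x, U x -> B (ix x) x) ->
  {in pts X U w &, injective ix} -> forall a, ccount w a = 0 \/ ccount w a = 1.
Proof.
move=> hix inj a; rewrite nnE.
have -> : \sum_(x <- pts X U w) \1_(B a) x = (count_mem a [seq ix x | x <- pts X U w])%:R :> R.
  rewrite -sum1_count natr_sum [RHS]big_mkcond [RHS]big_map [LHS]big_seq [RHS]big_seq; apply: eq_bigr => x.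
  rewrite (mem_pts HX _ _ U_relcompact) inE => -[_ Ux] /=; rewrite indicE.
  have Bx := hix x Ux; case: eqVneq => [<-|ne]; first by rewrite mem_set.
  by rewrite memNset // => Ba; move/eqP: ne; apply; exact: cell_uniq Bx Ba.
rewrite count_uniq_mem; last by rewrite map_inj_in_uniq // pts_uniq.
by case: (_ \in _); [right|left].
Qed.

End FixedPartition.

Lemma near_all_seq (T : eqType) (s : seq T) (Q : T -> nat -> Prop) :
  (forall x, x \in s -> \forall n \near \oo, Q x n) ->
  \forall n \near \oo, forall x, x \in s -> Q x n.
Proof.
elim: s => [|x s IH] H; first by apply: nearW.
have h1 := H x (mem_head _ _).
have h2 := IH (fun y ys => H y (mem_behead (s := x :: s) ys)).
near=> n => y; rewrite inE => /predU1P[->|ys]; first by near: n.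
by move: y ys; near: n.
Unshelve. all: by end_near. Qed.

Lemma cvg_sum_seq (R : realType) (T : eqType) (s : seq T) (f : T -> nat -> R) (l : T -> R) :
  (forall x, x \in s -> f x @ \oo --> l x) ->
  (fun n => \sum_(x <- s) f x n) @ \oo --> \sum_(x <- s) l x.
Proof.
elim: s => [|x s IH] H.
  by rewrite big_nil; under eq_fun do rewrite big_nil; exact: cvg_cst.
rewrite big_cons; under eq_fun do rewrite big_cons.
apply: cvgD; first exact: H (mem_head _ _).
by apply: IH => y ys; apply: H; rewrite inE ys orbT.
Qed.

(** * Passage to the limit along refining partitions *)

Section PairStatistic.
Variable R : realType.
Local Notation D := (@disk R).
Context d (Omega : measurableType d) (P : probability Omega R) (X : Omega -> set (pt R)).
Hypothesis HX : is_DPP_K P X.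
Variables (U : set (pt R)) (r : R).
Hypotheses (mU : measurable U) (r0 : 0 <= r) (r1 : r < 1) (Ur : forall x, U x -> cmod (toC x) <= r).
Variables (I : nat -> finType) (B : forall n, I n -> set (pt R)) (c : forall n, I n -> pt R)
  (ix : forall n, pt R -> I n) (e : nat -> R).
Arguments B : clear implicits.
Arguments c : clear implicits.
Hypotheses (Hpart : forall n, is_partition U (B n) (c n) (e n))
  (Hix : forall n x, U x -> B n (ix n x) x) (e_cvg : e @ \oo --> 0).
Variables (q : pt R -> pt R -> R) (Qm : R).
Hypotheses (Qm0 : 0 <= Qm) (qQ : forall x y, U x -> U y -> `|q x y| <= Qm)
  (q_cvg : forall x y, U x -> U y -> (fun n => q (c n (ix n x)) (c n (ix n y))) @ \oo --> q x y).

Let cU n i : U (c n i). Proof. exact: cell_center (Hpart n) i. Qed.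
Let rcU : relcompact U. Proof. exact: U_relcompact r0 r1 Ur. Qed.

Definition pair_stat (w : Omega) : R := \sum_(x <- pts X U w) \sum_(y <- pts X U w) q x y.

Let qc n (t : I n * I n) : R := q (c n t.1) (c n t.2).
Let N w : R := (size (pts X U w))%:R.
Let sg2 n (t : I n * I n) : seq (I n) := [:: t.1; t.2].
Let sg4 n (t : (I n * I n) * (I n * I n)) : seq (I n) := [:: t.1.1; t.1.2; t.2.1; t.2.2].
(** [Tn] and [Wn] approximate the statistic and its square. [W1n] approximates the fourth power of
    the number of points; it serves to show that (3 + N)^4, which dominates the other two up to
    constants, is integrable. *)
Let Tn n w := \sum_(t : I n * I n) qc t * uprod (ccount X (B n) w) (sg2 t).
Let Wn n w := \sum_(t : (I n * I n) * (I n * I n)) (qc t.1 * qc t.2) * uprod (ccount X (B n) w) (sg4 t).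
Let W1n n w := \sum_(t : (I n * I n) * (I n * I n)) 1 * uprod (ccount X (B n) w) (sg4 t).

Let pts_in w x : x \in pts X U w -> U x.
Proof. by rewrite (mem_pts HX _ _ rcU) inE => -[]. Qed.

(** A configuration has finitely many points in U, hence a least distance between them, and finer
    cells separate them. The rank from which this holds depends on w. *)
Lemma separated w : \forall n \near \oo, {in pts X U w &, injective (ix n)}.
Proof.
suff : \forall n \near \oo, forall x, x \in pts X U w -> forall y, y \in pts X U w -> ix n x = ix n y -> x = y.
  by apply: filterS => n H x y xs ys; exact: H.
apply: near_all_seq => x xs; apply: near_all_seq => y ys.
have [->|xy] := eqVneq x y; first by apply: nearW.
have d0 : 0 < cmod (toC x - toC y).
  rewrite sqrtr_gt0 lt_def sqmod_ge0 sqmod_eq0 andbT subr_eq0.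
  by apply: contra xy => /eqP; case: x {xs} => x1 x2; case: y {ys} => y1 y2 [-> ->].
have : \forall n \near \oo, `|e n| < cmod (toC x - toC y) / 2.
  by have /cvgr0Pnorm_lt := e_cvg; apply; rewrite divr_gt0.
apply: filterS => n en ixe; exfalso.
have h1 := cell_radius (Hpart n) (Hix n (pts_in xs)).
have h2 := cell_radius (Hpart n) (Hix n (pts_in ys)).
have : cmod (toC x - toC y) <= e n + e n.
  have -> : toC x - toC y = (toC x - toC (c n (ix n x))) - (toC y - toC (c n (ix n x))) by ring.
  by apply: le_trans (cmodB _ _) _; apply: lerD => //; rewrite ixe.
by have := ler_norm (e n); lra.
Qed.

Let sum_nnN n w : \sum_a ccount X (B n) w a = N w.
Proof.
under eq_bigr do rewrite -[ccount _ _ _ _]mul1r.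
rewrite (sum_ccount HX r0 r1 Ur (Hpart n) (fun=> 1) w (Hix n)).
by rewrite big_const_seq count_predT iter_addr addr0.
Qed.

Let TnE n w : {in pts X U w &, injective (ix n)} ->
  Tn n w = \sum_(x <- pts X U w) \sum_(y <- pts X U w) q (c n (ix n x)) (c n (ix n y)).
Proof.
move=> inj; have v01 := ccount_01 HX r0 r1 Ur (Hpart n) (Hix n) inj.
rewrite -(sum_ccount HX r0 r1 Ur (Hpart n) (fun a => \sum_(y <- pts X U w) q (c n a) (c n (ix n y))) w (Hix n)).
transitivity (\sum_a \sum_b q (c n a) (c n b) * (ccount X (B n) w a * ccount X (B n) w b)).
  rewrite pair_bigA /=; apply: eq_bigr => t _.
  by rewrite uprod_idem // !big_cons big_nil mulr1.
apply: eq_bigr => a _.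
rewrite -(sum_ccount HX r0 r1 Ur (Hpart n) (fun b => q (c n a) (c n b)) w (Hix n)) mulr_suml.
by apply: eq_bigr => b _; ring.
Qed.

Let WnE n w : {in pts X U w &, injective (ix n)} -> Wn n w = Tn n w ^+ 2.
Proof.
move=> inj; have v01 := ccount_01 HX r0 r1 Ur (Hpart n) (Hix n) inj.
rewrite expr2 /Tn big_distrlr /= pair_bigA /=; apply: eq_bigr => t _.
by rewrite !uprod_idem // !big_cons big_nil; ring.
Qed.

Let W1nE n w : {in pts X U w &, injective (ix n)} -> W1n n w = N w ^+ 4.
Proof.
move=> inj; have v01 := ccount_01 HX r0 r1 Ur (Hpart n) (Hix n) inj.
have -> : N w ^+ 4 = (N w * N w) * (N w * N w) by ring.
have E : N w * N w = \sum_(t : I n * I n) uprod (ccount X (B n) w) (sg2 t).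
  rewrite -(sum_nnN n) big_distrlr /= pair_bigA /=; apply: eq_bigr => t _.
  by rewrite uprod_idem // !big_cons big_nil mulr1.
rewrite E big_distrlr /= pair_bigA /=; apply: eq_bigr => t _.
by rewrite !uprod_idem // !big_cons big_nil; ring.
Qed.

Let Tn_cvg w : Tn ^~ w @ \oo --> pair_stat w.
Proof.
apply: cvg_trans (_ : (fun n => \sum_(x <- pts X U w) \sum_(y <- pts X U w) q (c n (ix n x)) (c n (ix n y))) @ \oo --> _).
  by apply: near_eq_cvg; near=> n; apply/esym/TnE; near: n; exact: separated.
apply: cvg_sum_seq => x xs; apply: cvg_sum_seq => y ys.
exact: q_cvg (pts_in xs) (pts_in ys).
Unshelve. all: by end_near. Qed.

Let Wn_cvg w : Wn ^~ w @ \oo --> pair_stat w ^+ 2.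
Proof.
apply: cvg_trans (_ : (fun n => Tn n w * Tn n w) @ \oo --> _).
  by apply: near_eq_cvg; near=> n; apply/esym; rewrite WnE ?expr2 //; near: n; exact: separated.
by rewrite expr2; apply: cvgM; exact: Tn_cvg.
Unshelve. all: by end_near. Qed.

Let W1n_cvg w : W1n ^~ w @ \oo --> N w ^+ 4.
Proof.
apply: cvg_trans (_ : (fun n => N w ^+ 4) @ \oo --> _); last exact: cvg_cst.
by apply: near_eq_cvg; near=> n; apply/esym; rewrite W1nE //; near: n; exact: separated.
Unshelve. all: by end_near. Qed.

Let nn0 n w a : 0 <= ccount X (B n) w a. Proof. exact: ccount_ge0. Qed.

Let sum_sg2 n (v : I n -> R) : (forall i, 0 <= v i) ->
  \sum_(t : I n * I n) uprod v (sg2 t) <= (3 + \sum_l v l) ^+ 4.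
Proof.
move=> v0; have V0 : 0 <= \sum_l v l by exact: sumr_ge0.
rewrite -(pair_bigA _ (fun i j => uprod v [:: i; j])) /=.
apply: le_trans (sum2_uprod v0) _; set V := \sum_l v l in V0 *.
have h : 1 <= 3 + V by lra.
apply: le_trans (_ : (3 + V) ^+ 2 <= _); first by nra.
by rewrite ler_weXn2l.
Qed.

Let sum_sg4 n (v : I n -> R) : (forall i, 0 <= v i) ->
  \sum_(t : (I n * I n) * (I n * I n)) uprod v (sg4 t) <= (3 + \sum_l v l) ^+ 4.
Proof.
move=> v0; apply: le_trans _ (sum4_uprod v0).
rewrite [leRHS]pair_bigA /=.
under [leRHS]eq_bigr do rewrite pair_bigA /=.
by rewrite [leRHS]pair_bigA.
Qed.

Let N3 w : 0 <= (3 + N w) ^+ 4.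
Proof. by rewrite exprn_ge0 // addr_ge0 // ler0n. Qed.

Let Tn_le n w : `|Tn n w| <= Qm * (3 + N w) ^+ 4.
Proof.
apply: le_trans (ler_norm_sum _ _ _) _.
apply: le_trans (_ : Qm * \sum_(t : I n * I n) uprod (ccount X (B n) w) (sg2 t) <= _).
  rewrite mulr_sumr; apply: ler_sum => t _; rewrite normrM [`|uprod _ _|]ger0_norm ?uprod_ge0 // ler_wpM2r ?uprod_ge0 //.
  exact: qQ.
by rewrite ler_wpM2l // -(sum_nnN n); exact: sum_sg2.
Qed.

Let qq_le n (t : (I n * I n) * (I n * I n)) : `|qc t.1 * qc t.2| <= Qm ^+ 2.
Proof. by rewrite normrM expr2; apply: ler_pM => //; exact: qQ. Qed.

Let Wn_le n w : `|Wn n w| <= Qm ^+ 2 * (3 + N w) ^+ 4.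
Proof.
apply: le_trans (ler_norm_sum _ _ _) _.
apply: le_trans (_ : Qm ^+ 2 * \sum_(t : (I n * I n) * (I n * I n)) uprod (ccount X (B n) w) (sg4 t) <= _).
  rewrite mulr_sumr; apply: ler_sum => t _; rewrite normrM [`|uprod _ _|]ger0_norm ?uprod_ge0 // ler_wpM2r ?uprod_ge0 //.
rewrite ler_wpM2l ?exprn_ge0 // -(sum_nnN n); exact: sum_sg4.
Qed.

Let sum_mm4 n : (3 + \sum_l cmass (B n) l) ^+ 4 <= 256.
Proof.
have h : 0 <= \sum_l cmass (B n) l by apply: sumr_ge0 => i _; exact: cmass_ge0.
rewrite [leRHS](_ : _ = 4 ^+ 4); last by ring.
rewrite lerXn2r ?nnegrE ?addr_ge0 //.
by have := sum_cmass_le1 r0 r1 Ur (Hpart n); lra.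
Qed.

Let sz2 n (t : I n * I n) : (size (sg2 t) <= 4)%N. Proof. by []. Qed.
Let sz4 n (t : (I n * I n) * (I n * I n)) : (size (sg4 t) <= 4)%N. Proof. by []. Qed.

Let T_moment n := @moment_sum _ _ _ P X HX U r r0 r1 Ur (I n) (B n) (c n) (e n) (Hpart n) _
  (@sg2 n) (@qc n) Qm (@sz2 n) (fun t => qQ (cU t.1) (cU t.2)).
Let W_moment n := @moment_sum _ _ _ P X HX U r r0 r1 Ur (I n) (B n) (c n) (e n) (Hpart n) _
  (@sg4 n) (fun t => qc t.1 * qc t.2) (Qm ^+ 2) (@sz4 n) (@qq_le n).
Let W1_moment n := @moment_sum _ _ _ P X HX U r r0 r1 Ur (I n) (B n) (c n) (e n) (Hpart n) _
  (@sg4 n) (fun=> 1) 1 (@sz4 n) (fun=> eq_ind_r (fun x => x <= 1) (lexx _) (normr1 R)).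

Let M := ((1 - r) ^+ 2)^-1.
Let M1 : 1 <= M.
Proof. by rewrite invf_ge1 ?exprn_gt0 ?subr_gt0 // exprn_ile1 ?subr_ge0 ?(ltW r1) // gerBl. Qed.

Let crho_le n s : (size s <= 4)%N -> `|crho (c n) s| <= 24 * M ^+ 4.
Proof.
move=> s4; have s4' : (size (undup s) <= 4)%N by apply: leq_trans (size_undup _) s4.
apply: le_trans (rho_le _) _.
  by move=> x /mapP[a _ ->]; apply: (U_disk r0 r1 Ur).
rewrite size_map; apply: ler_pM; rewrite ?ler0n ?fact_le24 //.
  by apply: prodr_ge0 => x _; rewrite invr_ge0 exprn_even_ge0.
apply: le_trans (_ : M ^+ size (undup s) <= _); last by rewrite ler_weXn2l.
elim: (undup s) => [|a t IH]; first by rewrite big_nil.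
rewrite /= big_cons exprS; apply: ler_pM => //.
- by rewrite invr_ge0 exprn_even_ge0.
- by apply: prodr_ge0 => x _; rewrite invr_ge0 exprn_even_ge0.
- apply: le_trans (_ : cmod (Kp (c n a) (c n a)) <= _); last first.
    apply: (@cmod_Kp_le _ U) => //.
  by rewrite Kp_diag cmodR ler_norm.
Qed.

Let e_bound : exists2 E : R, 0 <= E & forall n, e n <= E.
Proof.
have /cvgP/cvg_seq_bounded [E [_ H]] := e_cvg.
exists (`|E| + 1); first by rewrite addr_ge0.
move=> n; apply: le_trans (ler_norm _) _; apply: (H (`|E| + 1)) => //.
by rewrite (le_lt_trans (ler_norm _)) // ltrDl.
Qed.

(** Fatou along [W1n], whose means are controlled by the masses of the cells: the total mass is at
    most 1, and 256 = (3 + 1)^4. *)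
Let N4_fin : (\int[P]_w (N w ^+ 4)%:E < +oo)%E.
Proof.
have [E E0 eE] := e_bound.
have oc : 0 <= osc_cst r by apply: osc_cst_ge0.
pose K := 256 * (24 * M ^+ 4) + osc_cst r * E * 256.
apply: (@le_lt_trans _ _ K%:E); last exact: ltry.
apply: (@fatou_bound _ _ _ P setT (fun n w => (W1n n w)%:E)) => //.
- by move=> n; have [/integrableP[+ _] _] := W1_moment n.
- move=> n w _; rewrite lee_fin sumr_ge0 // => t _; rewrite mul1r uprod_ge0 //.
- move=> w _; apply: cvg_EFin; [exact: nearW|exact: W1n_cvg].
- move=> n; have [i1 b1] := W1_moment n.
  rewrite -[leLHS]fineK; last exact: (integrable_fin_num measurableT i1).
  rewrite lee_fin -[leLHS]/(\int[P]_w W1n n w).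
  have s1 : \sum_(t : (I n * I n) * (I n * I n)) uprod (cmass (B n)) (sg4 t) <= 256.
    by apply: le_trans (sum_mm4 n); apply: sum_sg4 => i; exact: cmass_ge0.
  have M4 : 0 <= 24 * M ^+ 4 by rewrite mulr_ge0 // exprn_ge0 // (le_trans ler01).
  have s2 : \sum_(t : (I n * I n) * (I n * I n)) 1 * (uprod (cmass (B n)) (sg4 t) * crho (c n) (sg4 t)) <= 256 * (24 * M ^+ 4).
    apply: le_trans (_ : \sum_(t : (I n * I n) * (I n * I n)) uprod (cmass (B n)) (sg4 t) * (24 * M ^+ 4) <= _).
      apply: ler_sum => t _; rewrite mul1r ler_wpM2l ?uprod_ge0 //; first by move=> i; exact: cmass_ge0.
      by apply: le_trans (ler_norm _) _; exact: crho_le.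
    by rewrite -mulr_suml ler_wpM2r.
  have s3 : 1 * (osc_cst r * e n) * \sum_(t : (I n * I n) * (I n * I n)) uprod (cmass (B n)) (sg4 t) <= osc_cst r * E * 256.
    rewrite mul1r; apply: ler_pM => //.
    - by apply: mulr_ge0 => //; exact: cell_radius_ge0 (Hpart n).
    - by apply: sumr_ge0 => t _; apply: uprod_ge0 => i; exact: cmass_ge0.
    - by rewrite ler_wpM2l.
  have := le_trans (ler_norm _) b1; rewrite /K /W1n; lra.
Qed.

Let NE w : N w = npt X U w.
Proof.
rewrite (npt_pts HX w rcU (@subset_refl _ U)) big_seq.
under eq_bigr => x xs do rewrite indicE (mem_set (pts_in xs)).
by rewrite -big_seq big_const_seq count_predT iter_addr addr0.
Qed.

Let mN : measurable_fun setT N.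
Proof.
rewrite (_ : N = npt X U); last by apply/funext => w; exact: NE.
exact: (measurable_npt HX mU rcU).
Qed.

Let N3_int : P.-integrable setT (fun w => ((3 + N w) ^+ 4)%:E).
Proof.
have i4 : P.-integrable setT (fun w => (N w ^+ 4)%:E).
  apply/integrableP; split; first by apply/measurable_EFinP; exact: measurable_funX.
  by under eq_integral do rewrite gee0_abs ?lee_fin ?exprn_ge0 ?ler0n //.
(* By convexity (3 + x)^4 <= 8 (3^4 + x^4). *)
have i1 : P.-integrable setT (fun w => (8 * (3 ^+ 4 + N w ^+ 4))%:E).
  have i2 : P.-integrable setT (fun w => ((3 ^+ 4)%:E + (N w ^+ 4)%:E)%E).
    by apply: integrableD => //; exact: finite_measure_integrable_cst.
  by apply: eq_integrable (integrableZl measurableT 8 i2).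
apply: le_integrable i1 => //.
  by apply/measurable_EFinP; apply: measurable_funX; apply: measurable_funD.
move=> w _; rewrite !abse_EFin lee_fin (ger0_norm (N3 w)).
apply: le_trans (ler_norm _).
have : 0 <= N w by rewrite ler0n.
move: (N w) => x x0; have := sqr_ge0 (x - 3); have := sqr_ge0 (x ^+ 2 - 9); nra.
Qed.

Let cvg_from_err (u v a : nat -> R) (l : R) : u @ \oo --> l -> a @ \oo --> 0 ->
  (forall n, `|u n - v n| <= a n) -> v @ \oo --> l.
Proof.
move=> ul a0 uv.
have -> : v = (fun n => u n - (u n - v n)) by apply/funext => n; ring.
rewrite -[l]subr0; apply: cvgB => //.
apply: norm_cvg0; apply: (squeeze_cvgr (f := fun=> 0) (h := a)) => //; last exact: cvg_cst.
by apply: nearW => n; rewrite normr_ge0 uv.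
Qed.

(** Dominated convergence, the discretisation error vanishing with e. Inequalities that hold for the
    finite sums over all fine partitions thereby pass to the first two moments. *)
Lemma pair_stat_moments :
  [/\ measurable_fun setT pair_stat,
      P.-integrable setT (fun w => (pair_stat w)%:E) /\ P.-integrable setT (fun w => (pair_stat w ^+ 2)%:E),
      (fun n => \sum_i \sum_j q (c n i) (c n j) * (uprod (cmass (B n)) [:: i; j] * crho (c n) [:: i; j])) @ \oo -->
        \int[P]_w pair_stat w &
      (fun n => \sum_i \sum_j \sum_k \sum_l q (c n i) (c n j) * q (c n k) (c n l) *
         (uprod (cmass (B n)) [:: i; j; k; l] * crho (c n) [:: i; j; k; l])) @ \oo --> \int[P]_w pair_stat w ^+ 2].
Proof.
have mT n : measurable_fun setT (Tn n).
  by have [/integrableP[/measurable_EFinP + _] _] := T_moment n.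
have mW n : measurable_fun setT (Wn n).
  by have [/integrableP[/measurable_EFinP + _] _] := W_moment n.
have mS : measurable_fun setT pair_stat by apply: (measurable_fun_cvg mT) => w _; exact: Tn_cvg.
have mS2 : measurable_fun setT (fun w => pair_stat w ^+ 2) by apply: (measurable_fun_cvg mW) => w _; exact: Wn_cvg.
have iG (a : R) : P.-integrable setT (EFin \o (fun w => a * (3 + N w) ^+ 4)).
  by apply: eq_integrable (integrableZl measurableT a N3_int).
have [iT cT] := dominated_cvg_Rintegral measurableT mT mS (fun w _ => @Tn_cvg w) (iG Qm) (fun n w _ => Tn_le n w).
have [iW cW] := dominated_cvg_Rintegral measurableT mW mS2 (fun w _ => @Wn_cvg w) (iG (Qm ^+ 2)) (fun n w _ => Wn_le n w).
have err (a : R) : (fun n => a * (osc_cst r * e n) * 256) @ \oo --> 0.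
  rewrite -[X in _ --> X](mul0r 256); apply: cvgM; last exact: cvg_cst.
  rewrite -[X in _ --> X](mulr0 a); apply: cvgM; first exact: cvg_cst.
  by rewrite -[X in _ --> X](mulr0 (osc_cst r)); apply: cvgM => //; exact: cvg_cst.
have oc : 0 <= osc_cst r by apply: osc_cst_ge0.
split => //.
- apply: (cvg_from_err cT (err Qm)) => n; rewrite pair_bigA /=.
  have [_ b] := T_moment n; apply: le_trans b _; apply: ler_wpM2l.
    by apply: mulr_ge0 => //; apply: mulr_ge0 => //; exact: cell_radius_ge0 (Hpart n).
  by apply: le_trans (sum_mm4 n); apply: sum_sg2 => i; exact: cmass_ge0.
- apply: (cvg_from_err cW (err (Qm ^+ 2))) => n.
  rewrite pair_bigA /=; under [X in _ - X]eq_bigr do rewrite pair_bigA /=.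
  rewrite pair_bigA /=.
  have [_ b] := W_moment n; apply: le_trans b _; apply: ler_wpM2l.
    by apply: mulr_ge0; [exact: exprn_ge0|apply: mulr_ge0 => //; exact: cell_radius_ge0 (Hpart n)].
  by apply: le_trans (sum_mm4 n); apply: sum_sg4 => i; exact: cmass_ge0.
Qed.

End PairStatistic.

(** * Square grids *)

Section Grid.
Variable R : realType.
Local Notation D := (@disk R).
Variables (U : set (pt R)) (x0 : pt R).
Hypotheses (mU : measurable U) (UD : U `<=` D) (Ux0 : U x0).

(** Maps the interval from -1 to 1 onto that from 0 to n+1, so that the integer part is the index of
    the cell. *)
Definition gridpos (n : nat) (a : R) : R := (a + 1) / 2 * n.+1%:R.
Definition gridI (n : nat) : finType := ('I_n.+1 * 'I_n.+1)%type.
Definition gridB n (i : gridI n) : set (pt R) := U `&`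
  [set x | (i.1%:R <= gridpos n x.1) && (gridpos n x.1 < i.1.+1%:R) &&
           ((i.2%:R <= gridpos n x.2) && (gridpos n x.2 < i.2.+1%:R))].
(** The default value [x0] is for squares that miss U; it lies in U itself. *)
Definition gridc n (i : gridI n) : pt R := xget x0 (gridB i).
Definition gridix n (x : pt R) : gridI n :=
  (inord (Num.truncn (gridpos n x.1)), inord (Num.truncn (gridpos n x.2))).
(** Twice the side of a square; it bounds both the distance to the centre and the mass of a cell. *)
Definition gride (n : nat) : R := 4 / n.+1%:R.

Lemma gride_cvg : gride @ \oo --> 0.
Proof.
rewrite -[X in _ --> X](mulr0 4); apply: cvgM; first exact: cvg_cst.
exact: cvg_harmonic.
Qed.

Lemma gridpos_mono n (a b : R) (k : nat) : k%:R <= gridpos n a -> gridpos n a < k.+1%:R ->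
  k%:R <= gridpos n b -> gridpos n b < k.+1%:R -> `|a - b| <= 2 / n.+1%:R.
Proof.
have n0 : 0 < n.+1%:R :> R by rewrite ltr0n.
rewrite /gridpos -[k.+1%:R]natr1 ler_pdivlMr // -[X in _ * X <= _]gtr0_norm // -normrM ler_norml.
by move: (n.+1%:R : R) => N h1 h2 h3 h4; apply/andP; split; lra.
Qed.

Lemma gridix_in n x : U x -> gridB (gridix n x) x.
Proof.
move=> Ux; split => //=; have Dx := UD Ux.
have key (a : R) : a ^+ 2 < 1 -> ((inord (Num.truncn (gridpos n a)) : 'I_n.+1)%:R <= gridpos n a) &&
    (gridpos n a < (inord (Num.truncn (gridpos n a)) : 'I_n.+1).+1%:R).
  move=> a1; have /andP[h1 h2] : -1 < a < 1 by apply/andP; split; nra.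
  have n0 : 0 < n.+1%:R :> R by rewrite ltr0n.
  have p0 : 0 <= gridpos n a by rewrite /gridpos; apply: mulr_ge0; [lra|exact: ltW].
  have pn : gridpos n a < n.+1%:R by rewrite /gridpos gtr_pMl //; lra.
  have /andP[t1 t2] := truncn_itv p0.
  rewrite inordK ?t1 //.
  by rewrite -(ltr_nat R); apply: le_lt_trans t1 pn.
have s1 := sqr_ge0 x.1; have s2 := sqr_ge0 x.2; move: Dx; rewrite /disk /= => Dx.
by apply/andP; split; apply: key; lra.
Qed.

Lemma gridc_in n (i : gridI n) x : gridB i x -> gridB i (gridc i).
Proof. by move=> Bx; rewrite /gridc; apply: xgetPex; exists x. Qed.

Lemma measurable_gridpos n k (f : pt R -> R) : measurable_fun setT f ->
  measurable [set x | (k%:R <= gridpos n (f x)) && (gridpos n (f x) < k.+1%:R)].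
Proof.
move=> mf; have mg : measurable_fun setT (fun x => gridpos n (f x)).
  by apply: measurable_funM => //; apply: measurable_funM => //; exact: measurable_funD.
rewrite (_ : [set x | _] = [set x | k%:R <= gridpos n (f x)] `&` [set x | gridpos n (f x) < k.+1%:R]).
  apply: measurableI.
    rewrite -[X in measurable X]setTI.
    by apply: (measurable_fun_le (f := fun=> k%:R) (g := fun x => gridpos n (f x))).
  by apply: (measurable_set_ltr (f := fun x => gridpos n (f x)) (g := fun=> k.+1%:R)).
by apply/seteqP; split => x /=; [move=> /andP[]|move=> [-> ->]].
Qed.

Lemma measurable_gridB n (i : gridI n) : measurable (gridB i).
Proof.
apply: measurableI => //.
rewrite (_ : [set x | _] = [set x : pt R | (i.1%:R <= gridpos n x.1) && (gridpos n x.1 < i.1.+1%:R)] `&`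
   [set x : pt R | (i.2%:R <= gridpos n x.2) && (gridpos n x.2 < i.2.+1%:R)]).
  by apply: measurableI; apply: measurable_gridpos; [exact: measurable_fst_pt|exact: measurable_snd_pt].
by apply/seteqP; split => x /=; [move=> /andP[]|move=> [-> ->]].
Qed.

Lemma grid_partition n : is_partition U (@gridB n) (@gridc n) (gride n).
Proof.
have natint (k l : nat) (a : R) : k%:R <= a -> a < k.+1%:R -> l%:R <= a -> a < l.+1%:R -> k = l.
  move=> h1 h2 h3 h4; have u1 : (k < l.+1)%N by rewrite -(ltr_nat R) (le_lt_trans h1 h4).
  have u2 : (l < k.+1)%N by rewrite -(ltr_nat R) (le_lt_trans h3 h2).
  by apply/eqP; rewrite eqn_leq; apply/andP; split.
split.
- exact: measurable_gridB.
- by move=> i x [].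
- move=> i j ij; rewrite -subset0 => x [[_ /= /andP[/andP[a1 a2] /andP[a3 a4]]] [_ /= /andP[/andP[b1 b2] /andP[b3 b4]]]].
  move/eqP: ij; apply; case: i a1 a2 a3 a4 => i1 i2 /= a1 a2 a3 a4; case: j b1 b2 b3 b4 => j1 j2 /= b1 b2 b3 b4.
  by congr (_, _); apply/val_inj => /=; [exact: natint a1 a2 b1 b2|exact: natint a3 a4 b3 b4].
- by move=> x Ux; exists (gridix n x); exact: gridix_in.
- move=> i; have [[x Bx]|nB] := pselect (exists x, gridB i x).
    by have [] := gridc_in Bx.
  by rewrite /gridc xgetPN // => x Bx; apply: nB; exists x.
- move=> i x Bx; have Bc := gridc_in Bx.
  case: Bx => _ /= /andP[/andP[a1 a2] /andP[a3 a4]]; case: Bc => _ /= /andP[/andP[b1 b2] /andP[b3 b4]].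
  have g1 := gridpos_mono a1 a2 b1 b2; have g2 := gridpos_mono a3 a4 b3 b4.
  have -> : toC x - toC (gridc i) = Complex (x.1 - (gridc i).1) 0 + Complex 0 (x.2 - (gridc i).2).
    by apply/eqP; rewrite eq_complex /= addr0 add0r !eqxx.
  apply: le_trans (cmodD _ _) _; rewrite cmodR.
  have -> : cmod (Complex 0 (x.2 - (gridc i).2)) = `|x.2 - (gridc i).2|.
    by rewrite /cmod /sqmod /= expr0n add0r sqrtr_sqr.
  have -> : gride n = 2 / n.+1%:R + 2 / n.+1%:R by rewrite /gride; ring.
  exact: lerD.
- by rewrite /gride divr_ge0 // ler0n.
Qed.

(** Small masses make the expected counts, K(x,x) times the mass, at most 1, as the variance bound
    assumes. *)
Lemma cmass_gridB n (i : gridI n) : cmass (@gridB n) i <= gride n.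
Proof.
have n0 : 0 < n.+1%:R :> R by rewrite ltr0n.
pose lo (k : nat) : R := k%:R * 2 / n.+1%:R - 1.
pose J (k : nat) := `[lo k, lo k.+1]%classic.
have ll (k : nat) : lo k.+1 - lo k = 2 / n.+1%:R by rewrite /lo -natr1; ring.
have lelo (k : nat) : lo k <= lo k.+1 by rewrite -subr_ge0 ll divr_ge0 // ltW.
have Jin (k : nat) (a : R) : k%:R <= gridpos n a -> gridpos n a < k.+1%:R -> J k a.
  rewrite /gridpos /J /= in_itv /= /lo => h1 h2; apply/andP; split.
    rewrite lerBlDr ler_pdivrMr //; lra.
  rewrite lerBrDr ler_pdivlMr //; lra.
have BJ : gridB i `<=` J i.1 `*` J i.2.
  by move=> x [_ /= /andP[/andP[a1 a2] /andP[a3 a4]]]; split; exact: Jin.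
have legJ k : @lebesgue_measure R (J k) = (2 / n.+1%:R)%:E.
  rewrite /J lebesgue_measure_itv /= lte_fin; case: ltP => [_|h]; first by rewrite -EFinB ll.
  by congr EFin; rewrite -(ll k); apply/esym/eqP; rewrite subr_eq0 eq_le h lelo.
have mJ k : measurable (J k) by exact: measurable_itv.
have mBJ : (mu (R:=R) (gridB i) <= mu (R:=R) (J i.1 `*` J i.2))%E.
  apply: le_measure => //; rewrite inE; first exact: measurable_gridB.
  by apply: measurableX; exact: mJ.
rewrite -lee_fin -mu_mass; last first.
- by move=> x [/UD].
- exact: measurable_gridB.
apply: le_trans mBJ _; rewrite muE.
rewrite (_ : (_ \x _)%E _ = (@lebesgue_measure R (J i.1) * @lebesgue_measure R (J i.2))%E); last first.
  by apply: product_measure1E; exact: mJ.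
rewrite !legJ -!EFinM lee_fin /gride.
have pi1 : pi^-1 <= 1 :> R by rewrite invf_le1 ?pi_gt0 // (le_trans _ (pi_ge2 R)) // ler1n.
have q1 : n.+1%:R^-1 <= 1 :> R by rewrite invf_le1 // ler1n.
have q0 : 0 <= n.+1%:R^-1 :> R by rewrite invr_ge0 ltW.
have p0 : 0 <= pi^-1 :> R by exact: piV_ge0.
have : pi^-1 * n.+1%:R^-1 <= 1 :> R by rewrite mulr_ile1.
by move: (n.+1%:R^-1 : R) q0 => y y0 h; nra.
Qed.

End Grid.

(** * The weight exp(- s d_h) *)

Section Weight.
Variables (R : realType) (z : R[i]).
Hypothesis z1 : sqmod z < 1.
Local Notation D := (@disk R).

Let a := sqmod z.
Let cz1 : cmod z < 1.
Proof. by rewrite -(@expr_lt1 _ 2) ?cmod_ge0 // cmod_sqr. Qed.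

Definition pseudo x := cmod (phi z (toC x)).
(* [exp (- d_h(z,x))], comparable to [1 - |x|^2] up to constants depending on [z]. *)
Definition hdec x := (1 - pseudo x) / (1 + pseudo x).
Definition den x := sqmod (1 - conjc z * toC x).
(** Both constants come from [hdecE]: the factor [den] lies between (1 - |z|)^2 and 4, and (1 +
    pseudo)^2 between 1 and 4. *)
Definition hdec_lo : R := (1 - sqmod z) / 16.
Definition hdec_hi : R := (1 - sqmod z) / (1 - cmod z) ^+ 2.

Lemma hdec_lo_gt0 : 0 < hdec_lo.
Proof. by rewrite divr_gt0 // subr_gt0. Qed.

Lemma hdec_hi_gt0 : 0 < hdec_hi.
Proof. by rewrite divr_gt0 ?exprn_gt0 ?subr_gt0. Qed.

(** Dividing by [den] gives the classical value of 1 - |phi_z(x)|^2. *)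
Lemma den_identity x : den x - sqmod (z - toC x) = (1 - sqmod z) * bgap x.
Proof. by rewrite /den; case: z => u v; case: x => b c; rewrite /bgap /nrm2 /sqmod /toC /=; ring. Qed.

Lemma den_ge x : D x -> (1 - cmod z) ^+ 2 <= den x.
Proof.
move=> Dx; rewrite /den -cmod_sqr lerXn2r ?nnegrE ?cmod_ge0 ?subr_ge0 ?(ltW cz1) //.
apply: le_trans (cmod_distB _ _); rewrite cmod1 lerD2l lerN2 cmodM cmod_conj.
by rewrite -[leRHS]mulr1 ler_wpM2l ?cmod_ge0 // ltW // cmod_toC_lt1.
Qed.

Lemma den_le x : D x -> den x <= 4.
Proof.
move=> Dx; rewrite /den -cmod_sqr (_ : 4 = 2 ^+ 2); last by ring.
rewrite lerXn2r ?nnegrE ?cmod_ge0 //.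
apply: le_trans (cmodB _ _) _; rewrite cmod1 cmodM cmod_conj.
have := cmod_toC_lt1 Dx; have := cmod_ge0 z; have := cmod_ge0 (toC x); move: cz1; nra.
Qed.

Lemma den_gt0 x : D x -> 0 < den x.
Proof. by move=> Dx; apply: lt_le_trans (den_ge Dx); rewrite exprn_gt0 // subr_gt0. Qed.

Lemma pseudo_ge0 x : 0 <= pseudo x. Proof. exact: cmod_ge0. Qed.

Lemma pseudo_sqr x : D x -> 1 - pseudo x ^+ 2 = (1 - sqmod z) * bgap x / den x.
Proof.
move=> Dx; have d0 := den_gt0 Dx.
rewrite cmod_sqr /phi sqmodM sqmodV -/(den x) -den_identity mulrBl mulfV //.
by rewrite gt_eqF.
Qed.

Lemma pseudo_lt1 x : D x -> pseudo x < 1.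
Proof.
move=> Dx; rewrite -(@expr_lt1 _ 2) ?pseudo_ge0 // -subr_gt0 pseudo_sqr //.
by rewrite divr_gt0 ?den_gt0 // mulr_gt0 ?subr_gt0 // -subr_gt0 bgap_gt0.
Qed.

Lemma hdecE x : D x -> hdec x = (1 - sqmod z) * bgap x / (den x * (1 + pseudo x) ^+ 2).
Proof.
move=> Dx; have p0 : 1 + pseudo x != 0 by rewrite gt_eqF // ltr_pwDl ?pseudo_ge0.
rewrite invfM mulrA -pseudo_sqr // /hdec; field; exact: p0.
Qed.

Lemma hdec_gt0 x : D x -> 0 < hdec x.
Proof. by move=> Dx; rewrite divr_gt0 ?subr_gt0 ?pseudo_lt1 // ltr_pwDl ?pseudo_ge0. Qed.

Lemma hdec_ge x : D x -> hdec_lo * bgap x <= hdec x.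
Proof.
move=> Dx; rewrite hdecE // (_ : hdec_lo * bgap x = (1 - sqmod z) * bgap x / 16); last exact: mulrAC.
have t0 : 0 <= (1 - sqmod z) * bgap x by rewrite mulr_ge0 ?subr_ge0 ?ltW // -subr_gt0 bgap_gt0.
rewrite ler_wpM2l // lef_pV2 ?posrE ?mulr_gt0 ?den_gt0 ?exprn_gt0 ?ltr_pwDl ?pseudo_ge0 //.
rewrite (_ : 16 = 4 * 2 ^+ 2); last by ring.
apply: ler_pM; rewrite ?(ltW (den_gt0 _)) ?den_le ?exprn_ge0 ?addr_ge0 ?pseudo_ge0 //.
by rewrite lerXn2r ?nnegrE ?addr_ge0 ?pseudo_ge0 //; have := pseudo_lt1 Dx; lra.
Qed.

Lemma hdec_le x : D x -> hdec x <= hdec_hi * bgap x.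
Proof.
move=> Dx; rewrite hdecE // (_ : hdec_hi * bgap x = (1 - sqmod z) * bgap x / (1 - cmod z) ^+ 2); last exact: mulrAC.
have t0 : 0 <= (1 - sqmod z) * bgap x by rewrite mulr_ge0 ?subr_ge0 ?ltW // -subr_gt0 bgap_gt0.
rewrite ler_wpM2l // lef_pV2 ?posrE ?mulr_gt0 ?den_gt0 ?exprn_gt0 ?subr_gt0 ?ltr_pwDl ?pseudo_ge0 //.
rewrite -[leLHS]mulr1; apply: ler_pM => //.
- by rewrite exprn_ge0 // subr_ge0 ltW.
- exact: den_ge.
- by rewrite exprn_ege1 // lerDl pseudo_ge0.
Qed.

Lemma dhE x : D x -> dh z (toC x) = - ln (hdec x).
Proof.
move=> Dx; rewrite /dh -/(pseudo x) /hdec -[X in ln X]invf_div lnV // posrE.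
exact: hdec_gt0.
Qed.

Lemma expR_dh s x : D x -> expR (- s * dh z (toC x)) = hdec x `^ s.
Proof.
move=> Dx; rewrite dhE // mulrNN /powR gt_eqF //.
exact: hdec_gt0.
Qed.

Lemma UE N : U N z = [set x | D x /\ expR (- N) < hdec x].
Proof.
suff H x : D x -> (dh z (toC x) < N) = (expR (- N) < hdec x).
  by apply/seteqP; split => x [Dx h]; split => //; move: h; rewrite H.
move=> Dx; rewrite dhE // ltrNl -[X in _ = (_ < X)]lnK; last by rewrite posrE hdec_gt0.
by rewrite ltr_expR.
Qed.

Lemma cmeas_phi : cmeas (fun x => phi z (toC x)).
Proof.
apply: cmeasM.
  by apply: cmeasD; [exact: cmeas_cst|apply: cmeasN; exact: cmeas_toC].
apply: cmeasV; apply: cmeasD; first exact: cmeas_cst.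
by apply: cmeasN; apply: cmeasM; [exact: cmeas_cst|exact: cmeas_toC].
Qed.

Lemma measurable_pseudo : measurable_fun setT pseudo.
Proof.
rewrite (_ : pseudo = (fun x => sqmod (phi z (toC x)) `^ 2^-1)); last first.
  by apply/funext => x; rewrite powR12_sqrt // sqmod_ge0.
by apply: (measurableT_comp (f := fun y : R => y `^ 2^-1)) => //; exact: measurable_sqmod cmeas_phi.
Qed.

Lemma measurable_U N : measurable (U N z).
Proof.
rewrite UE (_ : [set x | _] = D `&` [set x | expR (- N) * (1 + pseudo x) < 1 - pseudo x]).
  apply: measurableI; first exact: measurable_disk.
  have mp := measurable_pseudo.
  apply: measurable_set_ltr; last by apply: measurable_funB.
  by apply: measurable_funM => //; apply: measurable_funD.
by apply/seteqP; split => x [Dx] /= h; split => //; move: h; rewrite /hdec ltr_pdivlMr // ltr_pwDl ?pseudo_ge0.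
Qed.

Lemma center_U N : 0 < N -> U N z (complex.Re z, complex.Im z).
Proof.
move=> N0; have zE : toC (complex.Re z, complex.Im z) = z by rewrite /toC /=; case: (z).
split; first exact: z1.
rewrite /dh zE /phi subrr mul0r /cmod sqmod0 sqrtr0 addr0 subr0 divr1.
by rewrite ln1.
Qed.

Lemma bgap_U N x : U N z x -> expR (- N) / hdec_hi < bgap x.
Proof.
rewrite UE => -[Dx h]; rewrite ltr_pdivrMr ?hdec_hi_gt0 // mulrC.
exact: lt_le_trans h (hdec_le Dx).
Qed.

Lemma in_U N x : D x -> expR (- N) / hdec_lo < bgap x -> U N z x.
Proof.
move=> Dx; rewrite ltr_pdivrMr ?hdec_lo_gt0 // mulrC => h.
by rewrite UE; split => //; exact: lt_le_trans h (hdec_ge Dx).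
Qed.

Lemma ccvg_affine (u : nat -> R[i]) l b c : ccvg u l -> ccvg (fun n => b + c * u n) (b + c * l).
Proof.
move=> ul; rewrite /ccvg (_ : (fun n => _) = (fun n => cmod c * cmod (u n - l))).
  by rewrite -[X in _ --> X](mulr0 (cmod c)); apply: cvgM => //; exact: cvg_cst.
by apply/funext => n; rewrite -cmodM; congr cmod; ring.
Qed.

Lemma hdec_cvg (u : nat -> pt R) x : D x ->
  ccvg (fun n => toC (u n)) (toC x) -> (fun n => hdec (u n)) @ \oo --> hdec x.
Proof.
move=> Dx ux; have p0 : 1 + pseudo x != 0 by rewrite gt_eqF // ltr_pwDl ?pseudo_ge0.
have ps : (fun n => pseudo (u n)) @ \oo --> pseudo x.
  have h1 : (fun n => sqmod (phi z (toC (u n)))) @ \oo --> sqmod (phi z (toC x)).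
    rewrite /phi sqmodM sqmodV; under eq_fun do rewrite sqmodM sqmodV.
    apply: cvgM.
      have -> : z - toC x = z + (-1) * toC x by ring.
      under eq_fun do rewrite -[X in z - X]mul1r -mulNr.
      by apply: ccvg_sqmod; exact: ccvg_affine.
    apply: cvgV; first by rewrite -/(den x) gt_eqF // den_gt0.
    rewrite -mulNr; under eq_fun do rewrite -mulNr.
    by apply: ccvg_sqmod; exact: ccvg_affine.
  exact: (@cvg_comp _ _ _ _ (@Num.sqrt R) _ _ _ h1 (@sqrt_continuous R _)).
apply: cvgM; first by apply: cvgB => //; exact: cvg_cst.
by apply: cvgV => //; apply: cvgD => //; exact: cvg_cst.
Qed.

Lemma weight_cvg s (u : nat -> pt R) x : (forall n, D (u n)) -> D x ->
  ccvg (fun n => toC (u n)) (toC x) -> (fun n => hdec (u n) `^ s) @ \oo --> hdec x `^ s.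
Proof.
move=> Du Dx ux; have h0 := hdec_gt0 Dx.
have E y : D y -> hdec y `^ s = expR (s * ln (hdec y)) by move=> /hdec_gt0 y0; rewrite /powR gt_eqF.
rewrite E //; under eq_fun do rewrite E //.
have h1 := hdec_cvg Dx ux.
have h2 : (fun n => s * ln (hdec (u n))) @ \oo --> s * ln (hdec x).
  apply: cvgM; first exact: cvg_cst.
  exact: (@cvg_comp _ _ _ _ (@ln R) _ _ _ h1 (continuous_ln h0)).
exact: (@cvg_comp _ _ _ _ (@expR R) _ _ _ h2 (@continuous_expR R _)).
Qed.

End Weight.

(** * Kernel sums over the cells of a fine partition *)

Section TruncatedPower.
Variable R : realType.
Local Notation leb := (@lebesgue_measure R).

(** Truncated because [integral_oneBJV_le] asks for a bounded weight; on U, where 1 - |x|^2 >= dl,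
    it coincides with the plain power. *)
Definition trunc_pow (dl b u : R) : R := Num.max (1 - u) dl `^ b.

Lemma measurable_trunc_pow dl b : measurable_fun setT (trunc_pow dl b).
Proof.
apply: (measurableT_comp (f := fun y : R => y `^ b)) => //.
by apply: measurable_maxr => //; apply: measurable_funB.
Qed.

Lemma trunc_pow_ge0 dl b u : 0 <= trunc_pow dl b u.
Proof. exact: powR_ge0. Qed.

Lemma powR_le_neg (b x y : R) : 0 < x -> x <= y -> b <= 0 -> y `^ b <= x `^ b.
Proof.
move=> x0 xy b0; rewrite -[b]opprK powRN [leRHS]powRN.
have y0 := lt_le_trans x0 xy.
rewrite lef_pV2 ?posrE ?powR_gt0 //; apply: ge0_ler_powR; rewrite ?nnegrE ?oppr_ge0 // ltW //.
Qed.

Lemma trunc_pow_le dl b u : 0 < dl -> b <= 0 -> trunc_pow dl b u <= dl `^ b.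
Proof. by move=> d0 b0; apply: powR_le_neg => //; rewrite le_max lexx orbT. Qed.

(** The flat part contributes dl^ep and the power part (1 - dl^ep)/ep; as ep <= 1 the sum is at most
    1/ep, uniformly in dl. *)
Lemma integral_trunc_pow (ep dl : R) : 0 < ep -> ep <= 1 -> 0 < dl -> dl < 1 ->
  (\int[leb]_(u in `[0%R, 1%R[) (trunc_pow dl (ep - 1) u)%:E <= (ep^-1)%:E)%E.
Proof.
move=> ep0 ep1 d0 d1; have d1' : 0 < 1 - dl by rewrite subr_gt0.
have -> : `[0%R, 1%R[%classic = `[0%R, 1 - dl]%classic `|` `]1 - dl, 1%R[%classic.
  by rewrite -itv_bndbnd_setU // bnd_simp ?ltW //; lra.
rewrite ge0_integral_setU //=; first last.
- rewrite disj_set2E; apply/eqP/seteqP; split => // x [] /=; rewrite !in_itv /=; lra.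
- by move=> x _; rewrite lee_fin trunc_pow_ge0.
- by apply: measurable_funTS; apply/measurable_EFinP; exact: measurable_trunc_pow.
have -> : (\int[leb]_(u in `](1 - dl)%R, 1%R[) (trunc_pow dl (ep - 1) u)%:E = (dl `^ ep)%:E)%E.
  rewrite (_ : integral _ _ _ = \int[leb]_(u in `](1 - dl)%R, 1%R[) (dl `^ (ep - 1))%:E)%E; last first.
    apply: eq_integral => u; rewrite inE /= in_itv /= => /andP[u1 u2].
    by rewrite /trunc_pow max_r //; lra.
  rewrite integral_cst //= lebesgue_measure_itv /= lte_fin gtrBl d0 -EFinD -EFinM; congr EFin.
  rewrite opprB addrCA subrr addr0 mulrC mulr_powRB1 // ltW //.
pose F (u : R) := - ep^-1 * (1 - u) `^ ep.
have dF (u : R) : u < 1 -> is_derive u 1 F ((1 - u) `^ (ep - 1)).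
  move=> u1; have u0 : 0 < 1 - u by rewrite subr_gt0.
  have h1 := is_derive1_powR ep u0.
  have h2 : is_derive u 1 (fun v : R => 1 - v) (-1) by rewrite -[-1]add0r; apply: is_deriveB.
  have h3 := @is_derive1_comp R (fun y : R => y `^ ep) (fun v : R => 1 - v) u _ _ h1 h2.
  have h4 : is_derive u 1 (fun v : R => (- ep^-1) *: ((1 - v) `^ ep)) ((- ep^-1) *: ((ep * (1 - u) `^ (ep - 1)) * -1)).
    exact: (@is_deriveZ R R R _ (- ep^-1) u 1 _ h3).
  apply: is_derive_eq h4 _.
  by rewrite /GRing.scale /= mulrN1 mulrNN mulrA mulVf ?gt_eqF // mul1r.
have cF (u : R) : u < 1 -> {for u, continuous F}.
  by move=> u1; apply/differentiable_continuous/derivable1_diffP; case: (dF u u1).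
rewrite (_ : integral _ _ _ = \int[leb]_(u in `[0%R, (1 - dl)%R]) ((1 - u) `^ (ep - 1))%:E)%E; last first.
  apply: eq_integral => u; rewrite inE /= in_itv /= => /andP[u1 u2].
  by rewrite /trunc_pow max_l //; lra.
rewrite (@continuous_FTC2 R (fun u => (1 - u) `^ (ep - 1)) F) //.
- rewrite -EFinB -EFinD lee_fin /F opprB addrCA subrr addr0 subr0 powR1 mulr1 mulNr opprK.
  have p0 : 0 <= dl `^ ep by exact: powR_ge0.
  have e1 : 1 <= ep^-1 by rewrite invf_ge1.
  nra.
- apply: continuous_in_subspaceT => u; rewrite inE /= in_itv /= => /andP[u1 u2].
  have u0 : 0 < 1 - u by lra.
  apply/differentiable_continuous/derivable1_diffP.
  have h1 := is_derive1_powR (ep - 1) u0.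
  have h2 : is_derive u 1 (fun v : R => 1 - v) (-1) by rewrite -[-1]add0r; apply: is_deriveB.
  by have [] := @is_derive1_comp R (fun y : R => y `^ (ep - 1)) (fun v : R => 1 - v) u _ _ h1 h2.
- split => [x| |].
  + by rewrite in_itv /= => /andP[_ h]; case: (dF x _) => //; lra.
  + by apply: cvg_at_right_filter; apply: cF.
  + by apply: cvg_at_left_filter; apply: cF; lra.
- move=> x; rewrite in_itv /= => /andP[_ h]; have x1 : x < 1 by lra.
  by rewrite derive1E (@derive_val _ _ _ _ _ _ _ (dF x x1)).
Qed.

End TruncatedPower.

Lemma powRD_gt0 (R : realType) (x a b : R) : 0 < x -> x `^ (a + b) = x `^ a * x `^ b.
Proof. by move=> x0; rewrite powRD // (gt_eqF x0) implybT. Qed.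

Section CellSums.
Variable R : realType.
Local Notation D := (@disk R).
Local Notation mu := (@mu R).
Local Notation leb := (@lebesgue_measure R).
Variables (U : set (pt R)) (dl : R).
Hypotheses (dl0 : 0 < dl) (dl1 : dl < 1) (UD : U `<=` D) (tU : forall x, U x -> dl <= bgap x).
Variables (I : finType) (B : I -> set (pt R)) (c : I -> pt R) (e : R).
Hypothesis Hpart : is_partition U B c e.

(* Bounds the ratio of the values of [bgap], and of [cmod (oneBJ a _)], at two points of a cell. *)
Definition distortion : R := 1 + 2 * e / dl.
Local Notation L := distortion.

Let e0 : 0 <= e. Proof. exact: cell_radius_ge0 Hpart. Qed.

Lemma distortion_ge1 : 1 <= L.
Proof. by rewrite lerDl divr_ge0 ?mulr_ge0 // ltW. Qed.

Let r := Num.sqrt (1 - dl).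
Lemma rad_ge0 : 0 <= r. Proof. exact: sqrtr_ge0. Qed.
Lemma rad_lt1 : r < 1.
Proof. by rewrite -sqrtr1 ltr_sqrt // gtrBl. Qed.
Lemma cmod_le_rad x : U x -> cmod (toC x) <= r.
Proof.
move=> Ux; rewrite /cmod sqmod_toC ler_sqrt; last by rewrite subr_ge0 ltW.
by have := tU Ux; rewrite /bgap; lra.
Qed.

Let cU i : U (c i). Proof. exact: cell_center Hpart i. Qed.
Let BU i x : B i x -> U x. Proof. exact: cell_sub Hpart i x. Qed.

(** Within a cell 1 - a conj x moves by at most e, and its modulus at the centre is at least dl. *)
Lemma oneBJ_cell a j x : U a -> B j x -> sqmod (oneBJ a x) <= L ^+ 2 * sqmod (oneBJ a (c j)).
Proof.
move=> Ua Bx; have L0 : 0 <= L by apply: le_trans distortion_ge1.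
rewrite -!cmod_sqr -exprMn lerXn2r ?nnegrE ?mulr_ge0 ?cmod_ge0 //.
have ge : dl <= cmod (oneBJ a (c j)).
  rewrite -(@ler_pXn2r _ 2) ?nnegrE ?cmod_ge0 ?(ltW dl0) // cmod_sqr.
  apply: le_trans (sqmod_oneBJ_ge _ _); rewrite expr2; apply: ler_pM; rewrite ?(ltW dl0) ?tU //.
have -> : oneBJ a x = oneBJ a (c j) - toC a * conjc (toC x - toC (c j)).
  by rewrite /oneBJ conjcD raddfN /=; ring.
apply: le_trans (cmodB _ _) _; rewrite cmodM cmod_conj /distortion mulrDl mul1r lerD2l.
apply: le_trans (_ : 1 * e <= _).
  apply: ler_pM; rewrite ?cmod_ge0 ?(cell_radius Hpart) //.
  by rewrite ltW // cmod_toC_lt1 //; exact: UD.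
rewrite mul1r (_ : 2 * e / dl * _ = (2 * e) * (cmod (oneBJ a (c j)) / dl)); last by ring.
have h : 1 <= cmod (oneBJ a (c j)) / dl by rewrite ler_pdivlMr // mul1r.
by move: (cmod _ / dl) h e0 => y h ?; nra.
Qed.

Let nrm2_close j x : B j x -> `|bgap x - bgap (c j)| <= 2 * e.
Proof.
move=> Bx; have Ux := BU Bx.
have x1 := cmod_toC_lt1 (UD Ux); have c1 := cmod_toC_lt1 (UD (cU j)).
have h1 := cmod_distB (toC x) (toC (c j)); have h2 := cmod_distB (toC (c j)) (toC x).
have h3 := cell_radius Hpart Bx.
have h4 : cmod (toC (c j) - toC x) <= e by rewrite -cmodN opprB.
rewrite /bgap -!sqmod_toC -!cmod_sqr ler_norml.
have p1 := cmod_ge0 (toC x); have p2 := cmod_ge0 (toC (c j)).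
move: (cmod (toC x)) (cmod (toC (c j))) x1 c1 h1 h2 p1 p2 => u v x1 c1 h1 h2 p1 p2.
by apply/andP; split; nra.
Qed.

Let scaleL t : dl <= t -> t + 2 * e <= L * t.
Proof.
move=> dt; rewrite /distortion [leRHS]mulrDl mul1r lerD2l.
rewrite -mulrA ler_peMr ?mulr_ge0 // mulrC ler_pdivlMr // mul1r //.
Qed.

Lemma bgap_cell j x : B j x -> bgap (c j) <= L * bgap x.
Proof.
move=> Bx; apply: le_trans (scaleL (tU (BU Bx))).
by have := nrm2_close Bx; rewrite ler_norml => /andP[]; lra.
Qed.

Lemma bgap_cell' j x : B j x -> bgap x <= L * bgap (c j).
Proof.
move=> Bx; apply: le_trans (scaleL (tU (cU j))).
by have := nrm2_close Bx; rewrite ler_norml => /andP[]; lra.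
Qed.

Let L0 : 0 < L. Proof. exact: lt_le_trans distortion_ge1. Qed.

Lemma oneBJV_cell a j x : U a -> B j x -> (sqmod (oneBJ a (c j)))^-1 <= L ^+ 2 * (sqmod (oneBJ x a))^-1.
Proof.
move=> Ua Bx; have da := sqmod_oneBJ_gt0 (UD Ua) (UD (BU Bx)); have dc := sqmod_oneBJ_gt0 (UD Ua) (UD (cU j)).
rewrite (oneBJ_conj a x) sqmod_conj ler_pdivlMr // mulrC ler_pdivrMr //; exact: oneBJ_cell.
Qed.

Lemma Kp_cell a j x : U a -> B j x -> sqmod (Kp a (c j)) <= L ^+ 4 * sqmod (Kp x a).
Proof.
move=> Ua Bx; rewrite !sqmod_Kp -!exprVn (_ : L ^+ 4 = (L ^+ 2) ^+ 2); last by rewrite -exprM.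
rewrite -exprMn lerXn2r ?nnegrE ?mulr_ge0 ?invr_ge0 ?sqmod_ge0 ?exprn_ge0 ?(ltW L0) //.
exact: oneBJV_cell.
Qed.

Let mKp a : measurable_fun setT (fun x : pt R => sqmod (Kp x a)).
Proof. exact: measurable_sqmod (cmeas_Kp a). Qed.

Let riemann := @riemann_le R U r rad_ge0 rad_lt1 cmod_le_rad I B c e Hpart.

(** The discrete form of int |K(a,y)|^2 dmu(y) = K(a,a). *)
Lemma sum_Kp_le a : U a -> \sum_j sqmod (Kp a (c j)) * cmass B j <= L ^+ 4 * Kdiag a.
Proof.
move=> Ua; have Da := UD Ua; have mD := @measurable_disk R; rewrite -lee_fin.
have L40 : 0 <= L ^+ 4 by rewrite exprn_ge0 // ltW.
apply: le_trans (riemann (H := fun x => L ^+ 4 * sqmod (Kp x a)) _ _ _ _) _.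
- by move=> j; exact: sqmod_ge0.
- by move=> x; rewrite mulr_ge0 ?sqmod_ge0.
- by apply: measurable_funTS; apply: measurable_funM => //; exact: mKp.
- by move=> j x Bx; exact: Kp_cell.
under eq_integral do rewrite EFinM.
rewrite ge0_integralZl_EFin //; last 2 first.
- by move=> x _; rewrite lee_fin sqmod_ge0.
- by apply: measurable_funTS; apply/measurable_EFinP; exact: mKp.
rewrite [leRHS]EFinM; apply: lee_wpmul2l; first by rewrite lee_fin.
have [i1 E1] := reproducing Da Da.
have sE p : sqmod (Kp p a) = complex.Re (Kp p a * conjc (Kp p a)) by rewrite -sqmodE.
under eq_integral do rewrite sE.
rewrite -[leLHS]fineK; last exact: (@integrable_fin_num _ _ _ mu D mD _ i1).
by rewrite lee_fin -[leLHS]/(\int[mu]_(p in D) complex.Re (Kp p a * conjc (Kp p a))) E1 Kp_diag.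
Qed.

(** All cells lie in |x|^2 <= 1 - dl, so only that part of the integral counts; the gain over
    [sum_Kp_le] matters for a near the boundary of the disk. *)
Lemma sum_Kp_trunc_le a : U a ->
  \sum_j sqmod (Kp a (c j)) * cmass B j <= L ^+ 4 * ((1 - dl) / (1 - (1 - dl) * nrm2 a) ^+ 2).
Proof.
move=> Ua; have Da := UD Ua; have mD := @measurable_disk R; rewrite -lee_fin.
have L40 : 0 <= L ^+ 4 by rewrite exprn_ge0 // ltW.
pose h (x : pt R) : R := (nrm2 x <= 1 - dl)%R%:R * sqmod (Kp x a).
have h0 x : 0 <= h x by rewrite mulr_ge0 ?sqmod_ge0 // ler0n.
have mh : measurable_fun setT h.
  apply: measurable_funM; last exact: mKp.
  rewrite (_ : (fun x => _) = \1_[set x : pt R | nrm2 x <= 1 - dl]).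
    by apply: measurable_indic; exact: measurable_nrm2_le.
  by apply/funext => x; rewrite indicE; congr (nat_of_bool _)%:R; apply/idP/idP; rewrite inE.
apply: le_trans (riemann (H := fun x => L ^+ 4 * h x) _ _ _ _) _.
- by move=> j; exact: sqmod_ge0.
- by move=> x; rewrite mulr_ge0.
- by apply: measurable_funTS; apply: measurable_funM.
- move=> j x Bx; rewrite /h; have -> : nrm2 x <= 1 - dl by have := tU (BU Bx); rewrite /bgap; lra.
  by rewrite mul1r; exact: Kp_cell.
under eq_integral do rewrite EFinM.
rewrite ge0_integralZl_EFin //; last 2 first.
- by move=> x _; rewrite lee_fin.
- by apply: measurable_funTS; apply/measurable_EFinP.
rewrite [leRHS]EFinM; apply: lee_wpmul2l; first by rewrite lee_fin.
by apply: integral_Kp_sqmod_le => //; rewrite subr_gt0 dl1 gtrBl.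
Qed.

(** The exponent lies between -1 and 0, so a distortion L of the base costs at most a factor L. *)
Let cellpow b j x : -1 <= b -> b <= 0 -> B j x -> bgap (c j) `^ b <= L * trunc_pow dl b (nrm2 x).
Proof.
move=> b1 b0 Bx; have t0 := bgap_gt0 (UD (BU Bx)); have c0 := bgap_gt0 (UD (cU j)).
rewrite /trunc_pow -/(bgap x) max_l; last exact: tU (BU Bx).
apply: le_trans (_ : (L^-1 * bgap x) `^ b <= _).
  apply: powR_le_neg => //; first by rewrite mulr_gt0 ?invr_gt0.
  by rewrite mulrC ler_pdivrMr // mulrC; exact: bgap_cell'.
rewrite powRM ?invr_ge0 ?(ltW L0) ?(ltW t0) //.
rewrite ler_wpM2r ?powR_ge0 // -powR_inv1 ?(ltW L0) // -powRrM.
rewrite -[leRHS]powRr1 ?(ltW L0) //; apply: ler_powR; [exact: distortion_ge1|lra].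
Qed.

Lemma sum_pow_le al : 0 <= al -> al < 1 -> \sum_j bgap (c j) `^ (- al) * cmass B j <= L / (1 - al).
Proof.
move=> al0 al1; have mD := @measurable_disk R; rewrite -lee_fin.
pose h := trunc_pow dl (- al); have mh : measurable_fun setT h by exact: measurable_trunc_pow.
apply: le_trans (riemann (H := fun x => L * h (nrm2 x)) _ _ _ _) _.
- by move=> j; exact: powR_ge0.
- by move=> x; rewrite mulr_ge0 ?trunc_pow_ge0 // ltW.
- apply: measurable_funTS; apply: measurable_funM => //.
  by apply: (measurableT_comp mh); exact: measurable_nrm2.
- by move=> j x Bx; apply: cellpow => //; lra.
rewrite (ge0_integral_radial (h := fun u => (L * h u)%:E)); last 2 first.
- by apply/measurable_EFinP; apply: measurable_funM.
- by move=> u; rewrite lee_fin mulr_ge0 ?trunc_pow_ge0 // ltW.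
under eq_integral do rewrite EFinM.
rewrite ge0_integralZl_EFin //; last 3 first.
- by move=> x _; rewrite lee_fin trunc_pow_ge0.
- by apply: measurable_funTS; apply/measurable_EFinP.
- exact: ltW.
rewrite [leRHS]EFinM; apply: lee_wpmul2l; first by rewrite lee_fin ltW.
have -> : h = trunc_pow dl ((1 - al) - 1) by rewrite /h; congr trunc_pow; ring.
by apply: integral_trunc_pow => //; lra.
Qed.

(** The weight t^(s-2) bounds g(y) K(y,y) up to a constant. Averaging over circles leaves 1/(1 -
    |a|^2 u), part of whose singularity is exchanged for a power of [bgap a] until the remaining
    integrand is just integrable. *)
Lemma sum_oneBJV_le s ep a : 1 < s -> s < 2 -> 0 < ep -> ep <= s - 1 -> U a ->
  \sum_j (bgap (c j) `^ (s - 2) / sqmod (oneBJ a (c j))) * cmass B j <= L ^+ 3 * (bgap a `^ (s - 2 - ep) / ep).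
Proof.
move=> s1 s2 ep0 ep1 Ua; have Da := UD Ua; have mD := @measurable_disk R; rewrite -lee_fin.
have t0 := bgap_gt0 Da.
pose h := trunc_pow dl (s - 2); have mh : measurable_fun setT h by exact: measurable_trunc_pow.
have h0 u : 0 <= h u by exact: trunc_pow_ge0.
have L30 : 0 <= L ^+ 3 by rewrite exprn_ge0 // ltW.
have mH : measurable_fun setT (fun x : pt R => h (nrm2 x) / sqmod (oneBJ x a)).
  apply: measurable_funM; first by apply: (measurableT_comp mh); exact: measurable_nrm2.
  have : measurable_fun setT (fun x : pt R => sqmod (oneBJ x a)^-1).
    apply: measurable_sqmod; apply: cmeasV; apply: cmeasD; first exact: cmeas_cst.
    by apply: cmeasN; apply: cmeasM; [exact: cmeas_toC|exact: cmeas_cst].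
  by under eq_fun do rewrite sqmodV.
have H0 (x : pt R) : 0 <= h (nrm2 x) / sqmod (oneBJ x a) by rewrite divr_ge0 ?sqmod_ge0.
apply: le_trans (riemann (H := fun x => L ^+ 3 * (h (nrm2 x) / sqmod (oneBJ x a))) _ _ _ _) _.
- by move=> j; rewrite divr_ge0 ?powR_ge0 ?sqmod_ge0.
- by move=> x; rewrite mulr_ge0.
- by apply: measurable_funTS; apply: measurable_funM.
- move=> j x Bx.
  apply: le_trans (_ : (L * h (nrm2 x)) * (L ^+ 2 * (sqmod (oneBJ x a))^-1) <= _).
    apply: ler_pM; rewrite ?powR_ge0 ?invr_ge0 ?sqmod_ge0 ?oneBJV_cell //.
    by apply: cellpow => //; lra.
  by rewrite le_eqVlt; apply/orP; left; apply/eqP; ring.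
under eq_integral do rewrite EFinM.
rewrite ge0_integralZl_EFin //; last 2 first.
- by move=> x _; rewrite lee_fin.
- by apply: measurable_funTS; apply/measurable_EFinP.
rewrite [leRHS]EFinM; apply: lee_wpmul2l; first by rewrite lee_fin.
have s20 : s - 2 <= 0 by lra.
apply: (integral_oneBJV_le mh h0 (fun u => trunc_pow_le u dl0 s20) Da).
apply: le_trans (_ : (\int[leb]_(u in `[0%R, 1%R[) (bgap a `^ (s - 2 - ep) * trunc_pow dl (ep - 1) u)%:E <= _)%E).
  apply: ge0_le_integral_nomeas => u; rewrite /= in_itv /= => /andP[u0 u1].
    rewrite lee_fin divr_ge0 // subr_ge0; have := nrm2_ge0 a; move: t0; rewrite /bgap; nra.
  rewrite lee_fin; pose y := 1 - nrm2 a * u; pose w := Num.max (1 - u) dl.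
  have w0 : 0 < w by rewrite lt_max dl0 orbT.
  have ny := nrm2_ge0 a.
  have yt : bgap a <= y by rewrite /y /bgap; move: t0; rewrite /bgap; nra.
  have yw : w <= y.
    rewrite ge_max; apply/andP; split; last by apply: le_trans yt; exact: tU.
    by rewrite /y; move: t0; rewrite /bgap; nra.
  have y0 : 0 < y by exact: lt_le_trans yw.
  rewrite /h /trunc_pow -/w -/y ler_pdivrMr //.
  (* Both [bgap a] and w are at most y. Splitting y as y^th y^(1-th), this th leaves exactly
     w^(ep-1), and ep <= s - 1 says that th <= 1. *)
  pose th := 2 - s + ep.
  have E1 : w `^ (s - 2) = bgap a `^ (s - 2 - ep) * w `^ (ep - 1) * (bgap a `^ th * w `^ (1 - th)).
    rewrite mulrACA -!powRD_gt0 //.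
    rewrite (_ : s - 2 - ep + th = 0) ?powRr0 ?mul1r; last by rewrite /th; ring.
    by congr (_ `^ _); rewrite /th; ring.
  rewrite [leLHS]E1 ler_wpM2l ?mulr_ge0 ?powR_ge0 //.
  have -> : y = y `^ th * y `^ (1 - th).
    by rewrite -powRD_gt0 // addrC subrK powRr1 // ltW.
  apply: ler_pM; rewrite ?powR_ge0 //; apply: ge0_ler_powR; rewrite ?nnegrE /th ?(ltW t0) ?(ltW w0) ?(ltW y0) //; lra.
under eq_integral do rewrite EFinM.
rewrite ge0_integralZl_EFin //; last 3 first.
- by move=> x _; rewrite lee_fin trunc_pow_ge0.
- by apply: measurable_funTS; apply/measurable_EFinP; exact: measurable_trunc_pow.
- exact: powR_ge0.
rewrite [leRHS]EFinM; apply: lee_wpmul2l; first by rewrite lee_fin powR_ge0.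
by apply: integral_trunc_pow => //; lra.
Qed.

End CellSums.

(** * The variance bound on the cells *)

Section CellMoments.
Variable R : realType.
Local Notation D := (@disk R).
Variables (U : set (pt R)) (dl : R).
Hypotheses (dl0 : 0 < dl) (dl1 : dl < 1) (UD : U `<=` D) (tU : forall x, U x -> dl <= bgap x).
Variables (I : finType) (B : I -> set (pt R)) (c : I -> pt R) (e : R).
Hypothesis Hpart : is_partition U B c e.
Hypothesis Hmm : forall i, cmass B i <= e.
Variables (g : pt R -> R) (G s : R).
Hypotheses (s1 : 1 < s) (s2 : s < 3 / 2) (g0 : forall x, D x -> 0 <= g x)
  (gG : forall x, D x -> g x <= G * bgap x `^ s) (G0 : 0 <= G).

Local Notation L := (distortion dl e).

Definition pairq x y := g x * g y * complex.Re (Kp x y).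

Lemma pairq_diag x : pairq x x = g x ^+ 2 * Kdiag x.
Proof. by rewrite /pairq Kp_diag expr2. Qed.

Lemma pairqC x y : pairq x y = pairq y x.
Proof. by rewrite /pairq (Kp_conj x y) ReJ; ring. Qed.

Lemma pairq_le x y : D x -> D y -> `|pairq x y| <= g x * g y / sqmod (oneBJ x y).
Proof.
move=> Dx Dy; rewrite /pairq normrM [`|g x * g y|]ger0_norm ?mulr_ge0 ?g0 //.
by rewrite ler_wpM2l ?mulr_ge0 ?g0 // -cmod_Kp Re_le_cmod.
Qed.

Lemma pairq_sqr_le x y : D x -> D y ->
  pairq x y ^+ 2 <= pairq x x * pairq y y * (sqmod (Kp x y) / (Kdiag x * Kdiag y)).
Proof.
move=> Dx Dy; have kx := Kdiag_gt0 Dx; have ky := Kdiag_gt0 Dy; rewrite !pairq_diag.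
have -> : g x ^+ 2 * Kdiag x * (g y ^+ 2 * Kdiag y) * (sqmod (Kp x y) / (Kdiag x * Kdiag y)) = (g x * g y) ^+ 2 * sqmod (Kp x y).
  by field; rewrite !gt_eqF.
by rewrite /pairq exprMn ler_wpM2l ?sqr_ge0 // /sqmod lerDl sqr_ge0.
Qed.

Let DcU i : D (c i). Proof. exact: UD (cell_center Hpart i). Qed.
Let m i := cmass B i.
Let m0 i : 0 <= m i. Proof. exact: cmass_ge0. Qed.
Let t0 i : 0 < bgap (c i). Proof. exact: bgap_gt0. Qed.
Let p i := Kdiag (c i) * m i.
Let kap i j := sqmod (Kp (c i) (c j)) / (Kdiag (c i) * Kdiag (c j)).
Let q i j := pairq (c i) (c j).
Let c0 (w : seq I) := (\prod_(a <- w) m a) * rho [seq c a | a <- w].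

Let p0 i : 0 <= p i. Proof. by rewrite mulr_ge0 // ltW // Kdiag_gt0. Qed.
Let kap0 i j : 0 <= kap i j.
Proof. by rewrite divr_ge0 ?sqmod_ge0 ?mulr_ge0 // ltW // Kdiag_gt0. Qed.
Let kapC i j : kap i j = kap j i.
Proof. by rewrite /kap sqmod_Kp_sym [Kdiag _ * _]mulrC. Qed.

Let prodp w : \prod_(a <- w) p a = (\prod_(a <- w) m a) * \prod_(x <- [seq c a | a <- w]) Kdiag x.
Proof. by rewrite big_map -big_split; apply: eq_bigr => a _ /=; rewrite /p mulrC. Qed.

Let prodm0 (w : seq I) : 0 <= \prod_(a <- w) m a. Proof. by apply: prodr_ge0. Qed.

Let mapD (w : seq I) x : x \in [seq c a | a <- w] -> D x.
Proof. by move=> /mapP[a _ ->]. Qed.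

Let c_le (w : seq I) : uniq w -> (size w <= 4)%N -> `|c0 w| <= 24 * \prod_(a <- w) p a.
Proof.
move=> _ w4; rewrite normrM (ger0_norm (prodm0 w)) prodp mulrCA ler_wpM2l //.
apply: le_trans (rho_le (@mapD w)) _; rewrite size_map ler_wpM2r ?fact_le24 //.
by rewrite big_seq; apply: prodr_ge0 => x /mapD /Kdiag_gt0 /ltW.
Qed.

Let c_cat (u v : seq I) : uniq (u ++ v) -> (size u <= 2)%N -> (size v <= 2)%N ->
  `|c0 (u ++ v) - c0 u * c0 v| <= 48 * ((\prod_(a <- u ++ v) p a) * \sum_(a <- u) \sum_(b <- v) kap a b).
Proof.
move=> _ u2 v2; rewrite /c0 map_cat.
have -> : \prod_(a <- u ++ v) m a * rho ([seq c a | a <- u] ++ [seq c a | a <- v]) -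
   (\prod_(a <- u) m a * rho [seq c a | a <- u]) * (\prod_(a <- v) m a * rho [seq c a | a <- v]) =
   \prod_(a <- u ++ v) m a * (rho ([seq c a | a <- u] ++ [seq c a | a <- v]) - rho [seq c a | a <- u] * rho [seq c a | a <- v]).
  by rewrite big_cat /=; ring.
rewrite normrM (ger0_norm (prodm0 _)) prodp.
rewrite -(mulrA (\prod_(a <- u ++ v) m a)) (mulrCA 48) ler_wpM2l //.
have mD : forall x, x \in [seq c a | a <- u] ++ [seq c a | a <- v] -> D x by rewrite -map_cat; exact: mapD.
apply: le_trans (rho_cat mD) _; rewrite !size_map -map_cat.
have -> : \sum_(x <- [seq c a | a <- u]) \sum_(y <- [seq c a | a <- v]) sqmod (Kp x y) / (Kdiag x * Kdiag y) = \sum_(a <- u) \sum_(b <- v) kap a b.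
  by rewrite big_map; apply: eq_bigr => a _; rewrite big_map.
set S := \sum_(a <- u) _; set Pk := \prod_(x <- _) _.
have S0 : 0 <= S by apply: sumr_ge0 => a _; apply: sumr_ge0.
have Pk0 : 0 <= Pk by rewrite /Pk big_seq; apply: prodr_ge0 => x /mapD /Kdiag_gt0 /ltW.
have uv4 : (size u + size v <= 4)%N by exact: (leq_add u2 v2).
have f24 := fact_le24 R uv4.
have -> : 48 * (Pk * S) = 24 * (Pk * (2 * S)) by ring.
by apply: ler_wpM2r => //; apply: mulr_ge0 => //; apply: mulr_ge0.
Qed.

Let kkE i : Kdiag (c i) = bgap (c i) `^ (-2%:R).
Proof. by rewrite powR_invn // ltW. Qed.

(** The three conditions on the grid give p <= 1, L^3 <= 3 and row sums of [kap] at most 2, in this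
    order. *)
Lemma cell_variance_le ep : 0 < ep -> ep <= s - 1 -> e <= dl ^+ 2 -> L <= 4 / 3 -> L ^+ 4 <= 2 ->
  \sum_i \sum_j \sum_k \sum_l q i j * q k l * (uprod m [:: i; j; k; l] * crho c [:: i; j; k; l]) -
  (\sum_i \sum_j q i j * (uprod m [:: i; j] * crho c [:: i; j])) ^+ 2 <=
  7584 * ((G ^+ 2 * (1 + 3 / ep)) ^+ 2 * (dl `^ (- (3 - 2 * s + 2 * ep)) * (2 / (2 * s - 2)))).
Proof.
move=> ep0 eps ed L43 L42; have [s1' s2'] := (s1, s2); have L1 : 1 <= L by exact: (distortion_ge1 dl0 Hpart).
have ds i : dl <= bgap (c i) by apply: tU; exact: cell_center Hpart i.
have p1 i : p i <= 1.
  rewrite /p /Kdiag mulrC ler_pdivrMr ?exprn_gt0 // mul1r; apply: le_trans (Hmm i) _.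
  by apply: le_trans ed _; rewrite lerXn2r ?nnegrE ?(ltW dl0) ?(ltW (t0 i)).
have kap_sum i : \sum_j kap i j * p j <= 2.
  have k0 := Kdiag_gt0 (DcU i).
  have -> : \sum_j kap i j * p j = (\sum_j sqmod (Kp (c i) (c j)) * m j) / Kdiag (c i).
    rewrite mulr_suml; apply: eq_bigr => j _; have kj := Kdiag_gt0 (DcU j).
    by rewrite /kap /p; field; rewrite !gt_eqF.
  rewrite ler_pdivrMr //; apply: le_trans (sum_Kp_le dl0 dl1 UD tU Hpart (cell_center Hpart i)) _.
  by rewrite ler_wpM2r // ltW.
have qC i j : q i j = q j i by exact: pairqC.
have qd0 i : 0 <= q i i by rewrite /q pairq_diag mulr_ge0 ?sqr_ge0 // ltW // Kdiag_gt0.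
have q2 i j : q i j ^+ 2 <= q i i * q j j * kap i j by exact: pairq_sqr_le.
apply: le_trans (pair_variance_le p0 p1 kap0 kapC kap_sum qC qd0 q2 c_le c_cat) _.
apply: ler_wpM2l; first exact: ler0n.
pose b := 2 * s - 2 - ep; pose C1 := G ^+ 2 * (1 + 3 / ep).
have Qle i : q i i + \sum_j `|q i j| * p j <= C1 * bgap (c i) `^ b.
  have gi0 := g0 (DcU i); have gi := gG (DcU i).
  have h1 : q i i <= G ^+ 2 * bgap (c i) `^ b.
    rewrite /q pairq_diag; apply: le_trans (_ : (G * bgap (c i) `^ s) ^+ 2 * Kdiag (c i) <= _).
      by rewrite ler_wpM2r ?(ltW (Kdiag_gt0 _)) // lerXn2r // nnegrE mulr_ge0 ?powR_ge0.
    rewrite exprMn -mulrA ler_wpM2l ?sqr_ge0 // kkE expr2 -!powRD_gt0 //.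
    by apply: ger_powR; [rewrite t0 bgap_le1|rewrite /b; lra].
  have h2 : \sum_j `|q i j| * p j <= G ^+ 2 * (3 / ep) * bgap (c i) `^ b.
    apply: le_trans (_ : G ^+ 2 * bgap (c i) `^ s * (L ^+ 3 * (bgap (c i) `^ (s - 2 - ep) / ep)) <= _); last first.
      have -> : b = s + (s - 2 - ep) by rewrite /b; ring.
      rewrite (powRD_gt0 s (s - 2 - ep) (t0 i)).
      have L3 : L ^+ 3 <= 3.
        apply: le_trans (_ : (4 / 3) ^+ 3 <= _); last by lra.
        by rewrite lerXn2r ?nnegrE //; lra.
      have v0 : 0 <= G ^+ 2 * bgap (c i) `^ s * bgap (c i) `^ (s - 2 - ep) / ep.
        by rewrite divr_ge0 ?(ltW ep0) // !mulr_ge0 ?sqr_ge0 ?powR_ge0.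
      have := ler_wpM2r v0 L3; set x := bgap (c i) `^ s; set y := bgap (c i) `^ (s - 2 - ep) => H.
      have -> : G ^+ 2 * x * (L ^+ 3 * (y / ep)) = L ^+ 3 * (G ^+ 2 * x * y / ep) by ring.
      by have -> : G ^+ 2 * (3 / ep) * (x * y) = 3 * (G ^+ 2 * x * y / ep) by ring.
    have s22 : s < 2 by lra.
    apply: le_trans (ler_wpM2l _ (sum_oneBJV_le dl0 dl1 UD tU Hpart s1 s22 ep0 eps (cell_center Hpart i))); last first.
      by rewrite mulr_ge0 ?sqr_ge0 ?powR_ge0.
    rewrite mulr_sumr; apply: ler_sum => j _.
    have gj0 := g0 (DcU j); have gj := gG (DcU j); have d0 := sqmod_oneBJ_gt0 (DcU i) (DcU j).
    apply: le_trans (_ : (G * bgap (c i) `^ s) * (G * bgap (c j) `^ s) / sqmod (oneBJ (c i) (c j)) * p j <= _).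
      rewrite ler_wpM2r //; apply: le_trans (pairq_le (DcU i) (DcU j)) _.
      by rewrite ler_wpM2r ?invr_ge0 ?(ltW d0) //; apply: ler_pM.
    rewrite /p kkE powRD_gt0 // le_eqVlt; apply/orP; left; apply/eqP.
    by rewrite -/(m j); ring.
  by rewrite /C1 mulrDr mulr1 mulrDl; exact: lerD.
have Q0 i : 0 <= q i i + \sum_j `|q i j| * p j.
  by rewrite addr_ge0 // sumr_ge0 // => j _; rewrite mulr_ge0.
pose al := 3 - 2 * s.
apply: le_trans (_ : \sum_i C1 ^+ 2 * (dl `^ (- (al + 2 * ep)) * (bgap (c i) `^ (- al) * m i)) <= _).
  apply: ler_sum => i _.
  apply: le_trans (_ : p i * (C1 * bgap (c i) `^ b) ^+ 2 <= _).
    rewrite ler_wpM2l // lerXn2r ?nnegrE ?Q0 //; exact: le_trans (Q0 i) (Qle i).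
  (* The exponent -2 + 2b equals -2 al - 2 ep. One factor t^(-al) is kept for summation, which needs
     al < 1; the rest is bounded by its value at t = dl. *)
  have E1 : Kdiag (c i) * (bgap (c i) `^ b) ^+ 2 = bgap (c i) `^ (- (al + 2 * ep)) * bgap (c i) `^ (- al).
    by rewrite kkE expr2 -!powRD_gt0 //; congr (_ `^ _); rewrite /b /al; ring.
  have -> : p i * (C1 * bgap (c i) `^ b) ^+ 2 = C1 ^+ 2 * ((Kdiag (c i) * (bgap (c i) `^ b) ^+ 2) * m i).
    by rewrite /p; ring.
  rewrite E1; apply: ler_wpM2l; first exact: sqr_ge0.
  rewrite -mulrA; apply: ler_wpM2r; first by rewrite mulr_ge0 ?powR_ge0.
  by apply: powR_le_neg => //; rewrite /al; lra.
rewrite -mulr_sumr -mulr_sumr ler_wpM2l ?sqr_ge0 // ler_wpM2l ?powR_ge0 //.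
have al1 : al < 1 by rewrite /al; lra.
have al0 : 0 <= al by rewrite /al; lra.
apply: le_trans (sum_pow_le dl0 dl1 UD tU Hpart al0 al1) _.
have -> : 1 - al = 2 * s - 2 by rewrite /al; ring.
by apply: ler_wpM2r; [rewrite invr_ge0; lra|lra].
Qed.

End CellMoments.

(** * Lower bound for the mean *)

Section MeanLowerBound.
Variable R : realType.
Local Notation D := (@disk R).

Lemma rho1 (x : pt R) : rho [:: x] = Kdiag x.
Proof.
rewrite /rho det_mx11 mxE; transitivity (complex.Re (Kp x x)); first by [].
by rewrite Kp_diag.
Qed.

Lemma rho2 (x y : pt R) : rho [:: x; y] = Kdiag x * Kdiag y - sqmod (Kp x y).
Proof.
have det2 (M : 'M[R[i]]_2) : \det M = M ord0 ord0 * M ord_max ord_max - M ord0 ord_max * M ord_max ord0.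
  rewrite (expand_det_row _ ord0) !big_ord_recl big_ord0 /cofactor !det_mx11 !mxE addr0.
  have -> : lift ord0 ord0 = ord_max :> 'I_2 by apply/val_inj.
  have -> : lift ord_max ord0 = ord0 :> 'I_2 by apply/val_inj.
  by rewrite expr0 expr1 mul1r mulN1r mulrN.
rewrite /rho det2 !mxE.
transitivity (complex.Re (Kp x x * Kp y y - Kp x y * Kp y x)); first by [].
rewrite !Kp_diag (Kp_conj x y) -sqmodE ReD ReN ReM /= mulr0 subr0 //.
Qed.

Lemma A2normsq_ge0 (f : pt R -> R[i]) : (0 <= A2normsq f)%E.
Proof.
apply: mule_ge0; first by rewrite lee_fin invr_ge0 pi_ge0.
by apply: integral_ge0 => x _; rewrite lee_fin sqmod_ge0.
Qed.

Variables (U : set (pt R)) (dl : R).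
Hypotheses (dl0 : 0 < dl) (dl1 : dl < 1) (UD : U `<=` D) (tU : forall x, U x -> dl <= bgap x).
Variables (I : finType) (B : I -> set (pt R)) (c : I -> pt R) (e : R).
Hypothesis Hpart : is_partition U B c e.
Variables (g : pt R -> R) (gm T kappa : R).
Hypotheses (g0 : forall x, D x -> 0 <= g x) (gm0 : 0 <= gm) (gmg : forall x, U x -> gm <= g x).
Hypotheses (T0 : 0 < T) (T1 : 4 * T <= 1) (TU : forall x, D x -> T < bgap x -> U x).
Hypotheses (ka0 : 0 < kappa) (dlE : dl = 4 * kappa * T).

Local Notation L := (distortion dl e).

Let DcU i : D (c i). Proof. exact: UD (cell_center Hpart i). Qed.
Let m i := cmass B i.
Let m0 i : 0 <= m i. Proof. exact: cmass_ge0. Qed.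
Let t0 i : 0 < bgap (c i). Proof. exact: bgap_gt0. Qed.
Let q i j := pairq g (c i) (c j).
Let k0 i : 0 < Kdiag (c i). Proof. exact: Kdiag_gt0. Qed.
Let S i := \sum_j sqmod (Kp (c i) (c j)) * m j.
Let qd0 i : 0 <= q i i.
Proof. by rewrite /q pairq_diag mulr_ge0 ?sqr_ge0 // ltW. Qed.

(** Cauchy-Schwarz for the kernel, then the inequality of arithmetic and geometric means. *)
Let q_le i j : q i j <= (q i i + q j j) / 2.
Proof.
apply: le_trans (ler_norm _) _; rewrite -(@ler_pXn2r _ 2) ?nnegrE ?divr_ge0 ?addr_ge0 //.
rewrite real_normK ?num_real //.
apply: le_trans (pairq_sqr_le g (DcU i) (DcU j)) _.
apply: le_trans (_ : q i i * q j j <= _).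
  apply: ler_piMr; first exact: mulr_ge0 (qd0 i) (qd0 j).
  by rewrite ler_pdivrMr ?mulr_gt0 // mul1r; exact: sqmod_Kp_le.
by move: (q i i) (q j j) => x y; have := sqr_ge0 (x - y); nra.
Qed.

(* The pair sum with weights [K(x,x) K(y,y)] is a squared norm in the Bergman space, hence
   nonnegative; only the diagonal and the term in [|K(x,y)|^2] remain. *)
Lemma cell_mean_split :
  \sum_i q i i * m i * (Kdiag (c i) - S i) <= \sum_i \sum_j q i j * (uprod m [:: i; j] * crho c [:: i; j]).
Proof.
have termE i j : q i j * (uprod m [:: i; j] * crho c [:: i; j]) =
    (i == j)%:R * (q i i * m i * Kdiag (c i)) +
    (q i j * (Kdiag (c i) * m i) * (Kdiag (c j) * m j) - q i j * sqmod (Kp (c i) (c j)) * m i * m j).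
  rewrite /uprod /crho /= inE; case: eqVneq => [<-|ne] /=.
    by rewrite !big_seq1 rho1 Kp_diag sqmodR; ring.
  by rewrite big_cons big_seq1 rho2; ring.
have -> : \sum_i \sum_j q i j * (uprod m [:: i; j] * crho c [:: i; j]) =
    \sum_i q i i * m i * Kdiag (c i) + (\sum_i \sum_j q i j * (Kdiag (c i) * m i) * (Kdiag (c j) * m j) -
    \sum_i \sum_j q i j * sqmod (Kp (c i) (c j)) * m i * m j).
  rewrite -sumrB -big_split /=; apply: eq_bigr => i _.
  rewrite -sumrB; under eq_bigr do rewrite termE.
  rewrite big_split /=; congr (_ + _).
  rewrite (bigD1 i) //= eqxx mul1r big1 ?addr0 // => j ji.
  by rewrite eq_sym (negbTE ji) mul0r.
have psd : 0 <= \sum_i \sum_j q i j * (Kdiag (c i) * m i) * (Kdiag (c j) * m j).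
  have := A2normsq_ge0 (fun w => \sum_(i <- index_enum I) Complex (g (c i) * (Kdiag (c i) * m i)) 0 * Kp w (c i)).
  rewrite (@A2normsq_sum R I (fun i => g (c i) * (Kdiag (c i) * m i)) c (index_enum I)); last by move=> i _; exact: DcU.
  rewrite lee_fin; congr (_ <= _); apply: eq_bigr => i _; apply: eq_bigr => j _.
  by rewrite /q /pairq; ring.
have ub : \sum_i \sum_j q i j * sqmod (Kp (c i) (c j)) * m i * m j <= \sum_i q i i * m i * S i.
  pose F i j := q i i * m i * (sqmod (Kp (c i) (c j)) * m j).
  have SE : \sum_i q i i * m i * S i = \sum_i \sum_j F i j.
    by apply: eq_bigr => i _; rewrite /S mulr_sumr.
  have SE' : \sum_i q i i * m i * S i = \sum_i \sum_j F j i by rewrite SE exchange_big.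
  have -> : \sum_i q i i * m i * S i = \sum_i \sum_j (F i j + F j i) / 2.
    rewrite [LHS](_ : _ = (\sum_i q i i * m i * S i + \sum_i q i i * m i * S i) / 2); last by field.
    rewrite {1}SE SE' -big_split /= mulr_suml; apply: eq_bigr => i _.
    by rewrite -big_split /= mulr_suml.
  apply: ler_sum => i _; apply: ler_sum => j _.
  rewrite /F (sqmod_Kp_sym (c j) (c i)).
  have v0 : 0 <= sqmod (Kp (c i) (c j)) * m i * m j by rewrite !mulr_ge0 ?sqmod_ge0.
  have := ler_wpM2r v0 (q_le i j); set K := sqmod _; set a := q i i; set b := q j j => H.
  have -> : q i j * K * m i * m j = q i j * (K * m i * m j) by ring.
  apply: le_trans H _; rewrite le_eqVlt; apply/orP; left; apply/eqP; ring.
have -> : \sum_i q i i * m i * (Kdiag (c i) - S i) = \sum_i q i i * m i * Kdiag (c i) - \sum_i q i i * m i * S i.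
  by rewrite -sumrB; apply: eq_bigr => i _; ring.
lra.
Qed.

Hypotheses (L1 : L <= 4 / 3) (L2 : L ^+ 4 <= 1 + dl) (L3 : L ^+ 4 <= 1 + kappa).

Let y i := 1 - (1 - dl) * nrm2 (c i).
Let S_le i : S i <= L ^+ 4 * ((1 - dl) / y i ^+ 2).
Proof. exact: (sum_Kp_trunc_le dl0 dl1 UD tU Hpart (cell_center Hpart i)). Qed.

Let yE i : y i = bgap (c i) + dl * (1 - bgap (c i)).
Proof. by rewrite /y /bgap; ring. Qed.

(** The factor L^4 exceeds 1 by at most dl, and (1 + dl)(1 - dl) <= 1. *)
Let diff_ge0 i : 0 <= Kdiag (c i) - S i.
Proof.
have d0 := dl0; have d1 := dl1; have ti := t0 i; have ti1 := bgap_le1 (c i).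
rewrite subr_ge0; apply: le_trans (S_le i) _.
have yt : bgap (c i) <= y i by rewrite yE lerDl mulr_ge0 ?subr_ge0 // ltW.
have h : (y i ^+ 2)^-1 <= Kdiag (c i).
  rewrite /Kdiag lef_pV2 ?posrE ?exprn_gt0 ?(lt_le_trans ti) //.
  by rewrite lerXn2r ?nnegrE ?(ltW ti) // ltW // (lt_le_trans ti).
have h0 : 0 <= (y i ^+ 2)^-1 by rewrite invr_ge0 sqr_ge0.
rewrite mulrA; apply: le_trans (_ : 1 * Kdiag (c i) <= _); last by rewrite mul1r.
apply: ler_pM => //.
  by rewrite mulr_ge0 ?subr_ge0 ?(ltW d1) // exprn_even_ge0.
by have := L2; move: (L ^+ 4) => X; nra.
Qed.

(** Here dl (1 - bgap) >= 2 kappa T, so y is at least (1 + kappa) times [bgap]. Of the factor (1 +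
    kappa)^2 gained in y^2, one 1 + kappa pays for L^4 and the other is the deficit. *)
Let diff_near i : bgap (c i) <= 2 * T -> Kdiag (c i) * (kappa / (1 + kappa)) <= Kdiag (c i) - S i.
Proof.
move=> tn; have d0 := dl0; have d1 := dl1; have ti := t0 i; have k1 := ka0.
have T1' := T1; have T0' := T0; have E := dlE.
have p1 : 0 < 1 + kappa by lra.
have yt : (1 + kappa) * bgap (c i) <= y i.
  rewrite yE mulrDl mul1r lerD2l E.
  apply: le_trans (_ : 4 * kappa * T * (1 / 2) <= _).
    by have := ler_wpM2l (ltW k1) tn; lra.
  apply: ler_wpM2l; first by rewrite -E ltW.
  by lra.
have y0 : 0 < (1 + kappa) * bgap (c i) by rewrite mulr_gt0.
have h : (y i ^+ 2)^-1 <= Kdiag (c i) * ((1 + kappa) ^+ 2)^-1.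
  rewrite /Kdiag -invfM -exprMn [bgap _ * _]mulrC lef_pV2 ?posrE ?exprn_gt0 ?(lt_le_trans y0) //.
  by rewrite lerXn2r ?nnegrE ?(ltW y0) // ltW // (lt_le_trans y0).
have Sk : S i <= Kdiag (c i) / (1 + kappa).
  apply: le_trans (S_le i) _.
  apply: le_trans (_ : (1 + kappa) * (1 * (Kdiag (c i) * ((1 + kappa) ^+ 2)^-1)) <= _).
    apply: ler_pM => //.
    - by rewrite exprn_even_ge0.
    - by rewrite divr_ge0 ?sqr_ge0 // subr_ge0 ltW.
    - apply: ler_pM => //; first by rewrite subr_ge0 ltW.
        by rewrite invr_ge0 sqr_ge0.
      by lra.
  by rewrite le_eqVlt; apply/orP; left; apply/eqP; field; rewrite gt_eqF.
have -> : Kdiag (c i) * (kappa / (1 + kappa)) = Kdiag (c i) - Kdiag (c i) / (1 + kappa).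
  by field; rewrite gt_eqF.
by rewrite lerD2l lerN2.
Qed.

Lemma cell_mean_ge :
  gm ^+ 2 * ((2 * T) ^+ 4)^-1 * (kappa / (1 + kappa)) * (T / 4) <=
  \sum_i \sum_j q i j * (uprod m [:: i; j] * crho c [:: i; j]).
Proof.
have T0' := T0; have T1' := T1; have L1' := L1; have k1 := ka0.
apply: le_trans cell_mean_split.
pose J : pred I := fun i => bgap (c i) <= 2 * T.
(* In this annulus 1 - |x|^2 is between 5T/4 and 3T/2: above T, hence inside U, and still at most 2T
   after the distortion 4/3. Its mass is T/4. *)
pose A := [set x : pt R | 1 - 3 / 2 * T < nrm2 x <= 1 - 5 / 4 * T].
have mA : measurable A.
  rewrite (_ : A = [set x | nrm2 x <= 1 - 5 / 4 * T] `\` [set x | nrm2 x <= 1 - 3 / 2 * T]).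
    by apply: measurableD; exact: measurable_nrm2_le.
  apply/seteqP; split => x /=; rewrite /A /=.
    by move=> /andP[h1 h2]; split => //; apply/negP; rewrite -ltNge.
  by move=> [h1 /negP]; rewrite -ltNge => h2; apply/andP; split.
have AD : A `<=` D by move=> x /andP[_ h]; rewrite /disk /= -/(nrm2 x); lra.
have massA : mass A = T / 4.
  rewrite /mass /A mu_annulus; last by lra.
  by rewrite !max_l /=; lra.
have cover : mass A <= \sum_(i | J i) m i.
  apply: (mass_cover_le (rad_ge0 dl) (rad_lt1 dl0) (cmod_le_rad dl1 tU) Hpart) => // x Ax.
  have Dx := AD x Ax; case/andP: Ax => h1 h2.
  have Ux : U x by apply: TU => //; rewrite /bgap; lra.
  have [i Bx] := cell_cover Hpart Ux; exists i => //.
  apply: le_trans (bgap_cell dl0 UD tU Hpart Bx) _.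
  apply: le_trans (_ : 4 / 3 * (3 / 2 * T) <= _); last by lra.
  apply: ler_pM => //; last by rewrite /bgap; lra.
  - exact: le_trans (distortion_ge1 dl0 Hpart).
  - by rewrite ltW // bgap_gt0.
rewrite massA in cover.
have K0 : 0 <= gm ^+ 2 * ((2 * T) ^+ 4)^-1 * (kappa / (1 + kappa)).
  apply: mulr_ge0; first by rewrite mulr_ge0 ?sqr_ge0 // invr_ge0 exprn_even_ge0.
  by rewrite divr_ge0 //; lra.
apply: le_trans (ler_wpM2l K0 cover) _.
rewrite [leRHS](bigID J) /= mulr_sumr -[leLHS]addr0; apply: lerD; last first.
  by apply: sumr_ge0 => i _; exact: mulr_ge0 (mulr_ge0 (qd0 i) (m0 i)) (diff_ge0 i).
apply: ler_sum => i Ji.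
have ti := t0 i.
have kT : ((2 * T) ^+ 4)^-1 <= Kdiag (c i) ^+ 2.
  rewrite /Kdiag exprVn -exprM lef_pV2 ?posrE ?exprn_gt0 ?mulr_gt0 //.
  by rewrite lerXn2r ?nnegrE ?(ltW ti) ?mulr_ge0 // ltW.
have k3 : 0 <= kappa / (1 + kappa) by rewrite divr_ge0 //; lra.
apply: le_trans (_ : g (c i) ^+ 2 * Kdiag (c i) ^+ 2 * (kappa / (1 + kappa)) * m i <= _).
  apply: ler_wpM2r => //; apply: ler_wpM2r => //; apply: ler_pM => //.
  - exact: sqr_ge0.
  - by rewrite invr_ge0 exprn_even_ge0.
  - by rewrite lerXn2r ?nnegrE ?g0 // gmg //; exact: (cell_center Hpart).
rewrite /q pairq_diag.
have w0 : 0 <= g (c i) ^+ 2 * Kdiag (c i) * m i.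
  exact: mulr_ge0 (mulr_ge0 (sqr_ge0 _) (ltW (k0 i))) (m0 i).
apply: le_trans (ler_wpM2l w0 (diff_near Ji)).
by rewrite le_eqVlt; apply/orP; left; apply/eqP; ring.
Qed.

End MeanLowerBound.

(** * Mean and variance of the norm *)

Section StatMoments.
Variables (R : realType) (s : R) (z : R[i]).
Hypotheses (s1 : 1 < s) (s2 : s < 3 / 2) (z1 : sqmod z < 1).
Local Notation D := (@disk R).
Context d (Omega : measurableType d) (P : probability Omega R) (X : Omega -> set (pt R)).
Hypothesis HX : is_DPP_K P X.

Definition weight (x : pt R) : R := hdec z x `^ s.
Local Notation q := (pairq weight).
Let G : R := hdec_hi z `^ s.

Lemma weight_ge0 x : 0 <= weight x. Proof. exact: powR_ge0. Qed.

Lemma weight_le x : D x -> weight x <= G * bgap x `^ s.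
Proof.
move=> Dx; have s1' := s1.
rewrite -powRM ?(ltW (hdec_hi_gt0 z1)) ?(ltW (bgap_gt0 Dx)) //.
apply: ge0_ler_powR; rewrite ?nnegrE ?(ltW (hdec_gt0 z1 Dx)) ?hdec_le //; first by lra.
by rewrite mulr_ge0 ?(ltW (hdec_hi_gt0 z1)) ?(ltW (bgap_gt0 Dx)).
Qed.

Variable N : R.
Hypothesis N0 : 0 < N.
Let tau : R := expR (- N).
Let tau0 : 0 < tau. Proof. exact: expR_gt0. Qed.
Let V := U N z.
Definition depth : R := tau / hdec_hi z.
Local Notation dl := depth.
Let dl0 : 0 < dl. Proof. by rewrite divr_gt0 // hdec_hi_gt0. Qed.
Let x0 : pt R := (complex.Re z, complex.Im z).
Let Vx0 : V x0. Proof. exact: center_U. Qed.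
Let VD : V `<=` D. Proof. by move=> x []. Qed.
Let tV x : V x -> dl <= bgap x.
Proof. by move=> Vx; apply: ltW; exact: bgap_U. Qed.
Let dl1 : dl < 1.
Proof. by apply: lt_le_trans (bgap_le1 x0); exact: (bgap_U z1 Vx0). Qed.
Let mV : measurable V. Proof. exact: measurable_U. Qed.

Let B n := @gridB R V n.
Let c n := @gridc R V x0 n.
Arguments B : clear implicits.
Arguments c : clear implicits.
Let Hpart n : is_partition V (B n) (c n) (gride R n).
Proof. exact: grid_partition. Qed.
Let cV n i : V (c n i). Proof. exact: cell_center (Hpart n) i. Qed.

Let Bix n x : V x -> B n (gridix n x) x. Proof. exact: gridix_in. Qed.

Let Bmm n i : cmass (B n) i <= gride R n. Proof. exact: cmass_gridB. Qed.

Let Gtt x : D x -> weight x <= G.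
Proof.
move=> Dx; apply: le_trans (weight_le Dx) _; rewrite -[leRHS]mulr1 ler_wpM2l ?powR_ge0 //.
have -> : 1 = 1 `^ s :> R by rewrite powR1.
apply: ge0_ler_powR; rewrite ?nnegrE ?(ltW (bgap_gt0 Dx)) ?bgap_le1 //.
by rewrite (le_trans ler01) // ltW.
Qed.

Let q_bound x y : V x -> V y -> `|q x y| <= G * G / (dl * dl).
Proof.
move=> Vx Vy; have Dx := VD Vx; have Dy := VD Vy.
apply: le_trans (pairq_le (fun a _ => weight_ge0 a) Dx Dy) _.
have d2 : 0 < dl * dl by rewrite mulr_gt0.
apply: ler_pM; rewrite ?mulr_ge0 ?invr_ge0 ?sqmod_ge0 ?weight_ge0 //.
  by apply: ler_pM; rewrite ?weight_ge0 ?Gtt.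
rewrite lef_pV2 ?posrE ?sqmod_oneBJ_gt0 //.
by apply: le_trans (sqmod_oneBJ_ge _ _); apply: ler_pM; rewrite ?(ltW dl0) ?tV.
Qed.

Let c_cvg x : V x -> ccvg (fun n => toC (c n (gridix n x))) (toC x).
Proof.
move=> Vx; apply: (squeeze_cvgr (f := fun=> 0) (h := gride R)) => //; last 2 first.
- exact: cvg_cst.
- exact: gride_cvg.
apply: nearW => n; rewrite cmod_ge0 andTb -cmodN opprB.
by have := cell_radius (Hpart n) (Bix n Vx).
Qed.

Let q_cvg x y : V x -> V y -> (fun n => q (c n (gridix n x)) (c n (gridix n y))) @ \oo --> q x y.
Proof.
move=> Vx Vy; apply: cvgM.
  apply: cvgM; apply: weight_cvg => //; [|exact: VD|exact: c_cvg| |exact: VD|exact: c_cvg].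
  - by move=> n; apply: VD; exact: cV.
  - by move=> n; apply: VD; exact: cV.
apply: ccvg_Re; set r := Num.sqrt (1 - dl).
apply: (squeeze_cvgr (f := fun=> 0) (h := fun n => 8 * gride R n / (1 - r) ^+ 4)); last 2 first.
- exact: cvg_cst.
- rewrite -[X in _ --> X](mul0r ((1 - r) ^+ 4)^-1); apply: cvgM; last exact: cvg_cst.
  by rewrite -[X in _ --> X](mulr0 8); apply: cvgM; [exact: cvg_cst|exact: gride_cvg].
apply: nearW => n; rewrite cmod_ge0 andTb.
have cl a : V a -> cmod (toC a) <= r by exact: cmod_le_rad dl1 tV a.
have cc a : V a -> cmod (toC (c n (gridix n a)) - toC a) <= gride R n.
  by move=> Va; rewrite -cmodN opprB; have := cell_radius (Hpart n) (Bix n Va).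
by apply: Kp_diff_le (rad_lt1 dl0) _ _ _ _ _ _; rewrite ?cl ?cc.
Qed.

Let L_cvg : (fun n => distortion dl (gride R n)) @ \oo --> (1 : R).
Proof.
rewrite -[X in _ --> X]addr0; apply: cvgD; first exact: cvg_cst.
rewrite -[X in _ --> X](mul0r dl^-1); apply: cvgM; last exact: cvg_cst.
by rewrite -[X in _ --> X](mulr0 2); apply: cvgM; [exact: cvg_cst|exact: gride_cvg].
Qed.

Let L4_cvg : (fun n => distortion dl (gride R n) ^+ 4) @ \oo --> (1 : R).
Proof.
pose a n := distortion dl (gride R n).
rewrite (_ : (fun n => _) = (fun n => a n * a n * (a n * a n))); last by apply/funext => n; rewrite /a; ring.
have -> : (1 : R) = 1 * 1 * (1 * 1) by ring.
by apply: cvgM; apply: cvgM.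
Qed.

Definition stat := pair_stat X V q.

Let moments := pair_stat_moments HX mV (rad_ge0 dl) (rad_lt1 dl0) (@cmod_le_rad R V dl dl1 tV)
  Hpart Bix (@gride_cvg R) (divr_ge0 (mulr_ge0 (powR_ge0 _ _) (powR_ge0 _ _)) (mulr_ge0 (ltW dl0) (ltW dl0))) q_bound q_cvg.

Lemma integrable_stat : P.-integrable setT (EFin \o stat). Proof. by have [_ []] := moments. Qed.
Lemma integrable_stat2 : P.-integrable setT (EFin \o (fun w => stat w ^+ 2)).
Proof. by have [_ []] := moments. Qed.

Lemma stat_variance_le ep : 0 < ep -> ep <= s - 1 ->
  \int[P]_w (stat w ^+ 2) - (\int[P]_w stat w) ^+ 2 <=
  7584 * ((G ^+ 2 * (1 + 3 / ep)) ^+ 2 * (dl `^ (- (3 - 2 * s + 2 * ep)) * (2 / (2 * s - 2)))).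
Proof.
move=> ep0 eps; have [_ _ cA cW] := moments.
set A := (fun n => _) in cA; set W := (fun n => _) in cW.
have cD : (fun n => W n - A n * A n) @ \oo --> \int[P]_w (stat w ^+ 2) - (\int[P]_w stat w) * (\int[P]_w stat w).
  by apply: cvgB => //; apply: cvgM.
rewrite [_ ^+ 2 in leLHS]expr2; apply: (cvgr_to_le cD).
near=> n; rewrite -[A n * A n]/(A n ^+ 2).
have H := @cell_variance_le R V dl dl0 dl1 VD tV (gridI n) (B n) (c n) (gride R n) (Hpart n) (@Bmm n) weight G s.
apply: H => //.
- by move=> x _; exact: weight_ge0.
- exact: weight_le.
- exact: powR_ge0.
- by near: n; have := @cvgr_le R nat \oo _ _ _ (@gride_cvg R); apply; rewrite exprn_gt0.
- by near: n; have := @cvgr_le R nat \oo _ _ _ L_cvg; apply; lra.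
- by near: n; have := @cvgr_le R nat \oo _ _ _ L4_cvg; apply; lra.
Unshelve. all: by end_near. Qed.

(** By [in_U], points with [bgap] above T belong to the ball. The choice of kappa makes [depth]
    equal to 4 kappa T and does not depend on N. *)
Let T := tau / hdec_lo z.
Let kappa := hdec_lo z / (4 * hdec_hi z).

Lemma stat_mean_ge : 4 * tau <= hdec_lo z ->
  (tau `^ s) ^+ 2 * ((2 * T) ^+ 4)^-1 * (kappa / (1 + kappa)) * (T / 4) <= \int[P]_w stat w.
Proof.
move=> tz; have [_ _ cA _] := moments.
have lo0 := hdec_lo_gt0 z1; have hi0 := hdec_hi_gt0 z1.
have k0 : 0 < kappa by rewrite divr_gt0 // mulr_gt0.
apply: (cvgr_to_ge cA); near=> n.
apply: (@cell_mean_ge R V dl dl0 dl1 VD tV (gridI n) (B n) (c n) (gride R n) (Hpart n) weight (tau `^ s) T kappa) => //.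
- by move=> x _; exact: weight_ge0.
- exact: powR_ge0.
- move=> x; rewrite /V UE // => -[Dx h].
  apply: ge0_ler_powR; rewrite ?nnegrE ?(ltW tau0) ?(ltW (hdec_gt0 z1 Dx)) ?(ltW h) //.
  by rewrite (le_trans ler01) // ltW.
- by rewrite divr_gt0.
- by rewrite /T mulrA ler_pdivrMr // mul1r.
- by move=> x Dx; exact: in_U.
- by rewrite /dl /kappa /T; field; rewrite !gt_eqF.
- by near: n; have := @cvgr_le R nat \oo _ _ _ L_cvg; apply; lra.
- by near: n; have := @cvgr_le R nat \oo _ _ _ L4_cvg; apply; rewrite ltrDl.
- by near: n; have := @cvgr_le R nat \oo _ _ _ L4_cvg; apply; rewrite ltrDl.
Unshelve. all: by end_near. Qed.

End StatMoments.

(** * Almost sure convergence *)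

Section AlmostSureConvergence.
Context (R : realType) d (Omega : measurableType d) (P : probability Omega R).

(** The expected sum of the Y n is finite, so the series converges almost surely and its terms tend
    to 0. *)
Lemma ae_cvg0_summable (Y : nat -> Omega -> R) (a rho : R) : 0 <= a -> 0 <= rho < 1 ->
  (forall n, measurable_fun setT (Y n)) -> (forall n w, 0 <= Y n w) ->
  (forall n, (\int[P]_w (Y n w)%:E <= (a * rho ^+ n)%:E)%E) ->
  {ae P, forall w, Y ^~ w @ \oo --> (0 : R)}.
Proof.
move=> a0 rho01 mY Y0 Yle; pose F n w := (Y n w)%:E.
have F0 n w : (0 <= F n w)%E by rewrite lee_fin.
have mF n : measurable_fun setT (F n) by apply/measurable_EFinP.
pose S w := (\sum_(0 <= n <oo) F n w)%E.
have S0 w : (0 <= S w)%E by apply: nneseries_ge0.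
have mS : measurable_fun setT S by exact: ge0_emeasurable_sum.
have ISle : (\int[P]_w S w <= (a * (1 - rho)^-1)%:E)%E.
  rewrite integral_nneseries //; apply: lime_le.
    by apply: is_cvg_nneseries => n _ _; exact: integral_ge0.
  apply: nearW => n; apply: le_trans (_ : \sum_(0 <= k < n) (a * rho ^+ k)%:E <= _)%E.
    by apply: lee_sum => k _; exact: Yle.
  rewrite sumEFin lee_fin big_mkord -mulr_sumr ler_wpM2l //; exact: sum_geom_le.
have iS : P.-integrable setT S.
  apply/integrableP; split => //; under eq_integral do rewrite gee0_abs //.
  by apply: le_lt_trans ISle _; rewrite ltry.
have [A [mA PA HA]] := integrable_ae measurableT iS.
exists A; split => // w /= nw; apply: HA => /= fw; apply: nw.
have Sw : (S w < +oo)%E by rewrite ltey_eq fw.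
have tl := nneseries_tail_cvg Sw (fun k _ => F0 k w).
have cF : F ^~ w @ \oo --> (0%:E : \bar R).
  apply: (squeeze_cvge (f := fun=> 0%E) _ (cvg_cst _) tl).
  apply: nearW => n; rewrite F0 /=.
  apply: le_trans (nneseries_lim_ge n.+1 _); last by move=> k _ _; exact: F0.
  by rewrite big_nat1.
exact: (fine_cvg cF).
Qed.

(** Summability is applied to the squares (T/E - 1)^2, whose means are the variances divided by E^2.
    The shift by n0 discards the indices without hypotheses. *)
Lemma ae_ratio_cvg (T : nat -> Omega -> R) (C rho : R) (n0 : nat) : 0 <= C -> 0 <= rho < 1 ->
  (forall n, (n0 <= n)%N -> P.-integrable setT (EFin \o T n)) ->
  (forall n, (n0 <= n)%N -> P.-integrable setT (EFin \o (fun w => T n w ^+ 2))) ->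
  (forall n, (n0 <= n)%N -> 0 < \int[P]_w T n w) ->
  (forall n, (n0 <= n)%N -> \int[P]_w (T n w ^+ 2) - (\int[P]_w T n w) ^+ 2 <= C * rho ^+ n * (\int[P]_w T n w) ^+ 2) ->
  {ae P, forall w, (fun n => T n w / \int[P]_v T n v) @ \oo --> (1 : R)}.
Proof.
move=> C0 rho01 iT iT2 E0 var; have /andP[r0 r1] := rho01.
pose E n := \int[P]_w T n w.
pose Y n w := (T (n + n0)%N w / E (n + n0)%N - 1) ^+ 2.
have mT n : (n0 <= n)%N -> measurable_fun setT (T n).
  by move=> /iT /integrableP[/measurable_EFinP].
have le0 n : (n0 <= n + n0)%N by exact: leq_addl.
have mY n : measurable_fun setT (Y n).
  apply: measurable_funX; apply: measurable_funB => //; apply: measurable_funM => //; exact: mT.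
have Yle n : (\int[P]_w (Y n w)%:E <= (C * rho ^+ n)%:E)%E.
  set m := (n + n0)%N; have Em : 0 < E m by exact: (E0 _ (le0 n)).
  have En0 : E m != 0 by rewrite gt_eqF.
  have i1 : P.-integrable setT (EFin \o (fun w => (E m)^-2 * T m w ^+ 2)).
    by apply: eq_integrable (integrableZl measurableT ((E m)^-2) (iT2 m (le0 n))).
  have i2 : P.-integrable setT (EFin \o (fun w => (2 / E m) * T m w)).
    by apply: eq_integrable (integrableZl measurableT (2 / E m) (iT m (le0 n))).
  have i3 : P.-integrable setT (EFin \o (fun w : Omega => (1 : R))) by exact: finite_measure_integrable_cst.
  have i12 : P.-integrable setT (EFin \o (fun w => (E m)^-2 * T m w ^+ 2 - (2 / E m) * T m w)).
    by apply: eq_integrable (integrableB measurableT i1 i2).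
  have i123 : P.-integrable setT (EFin \o (fun w => ((E m)^-2 * T m w ^+ 2 - (2 / E m) * T m w) + 1)).
    by apply: eq_integrable (integrableD measurableT i12 i3).
  have YE : Y n = (fun w => ((E m)^-2 * T m w ^+ 2 - (2 / E m) * T m w) + 1).
    by apply/funext => w; rewrite /Y -/m; field; exact: En0.
  rewrite YE -[leLHS]fineK; last exact: (integrable_fin_num measurableT i123).
  rewrite lee_fin -[leLHS]/(\int[P]_w (((E m)^-2 * T m w ^+ 2 - (2 / E m) * T m w) + 1)).
  rewrite RintegralD // RintegralB // !RintegralZl //; [|exact: (iT _ (le0 n))|exact: (iT2 _ (le0 n))].
  rewrite Rintegral_cst // -/(E m).
  have -> : fine (P setT) = 1 by rewrite probability_setT.
  set Q := \int[P]_w (T m w ^+ 2).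
  have v : Q - E m ^+ 2 <= C * rho ^+ m * E m ^+ 2 by exact: (var _ (le0 n)).
  have -> : (E m)^-2 * Q - 2 / E m * E m + 1 * 1 = (Q - E m ^+ 2) / E m ^+ 2 by field; exact: En0.
  rewrite ler_pdivrMr ?exprn_gt0 //; apply: le_trans v _.
  rewrite ler_wpM2r ?sqr_ge0 // ler_wpM2l // /m exprD ler_piMr ?exprn_ge0 //.
  by rewrite exprn_ile1 // ltW.
have [A [mA PA HA]] := ae_cvg0_summable C0 rho01 mY (fun n w => sqr_ge0 _) Yle.
exists A; split => // w /= nw; apply: HA => /= cY; apply: nw.
rewrite -(cvg_shiftn n0).
apply/subr_cvg0; apply: norm_cvg0.
have -> : (fun n => `|T (n + n0)%N w / E (n + n0)%N - 1|) = (fun n => Num.sqrt (Y n w)).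
  by apply/funext => n; rewrite /Y sqrtr_sqr.
rewrite -[X in _ --> X]sqrtr0.
exact: (@cvg_comp _ _ _ _ (@Num.sqrt R) _ _ _ cY (@sqrt_continuous R _)).
Qed.

End AlmostSureConvergence.

(** * Comparison of variance and squared mean *)

Section Conclusion.
Variables (R : realType) (s : R) (z : R[i]).
Hypotheses (s1 : 1 < s) (s2 : s < 3 / 2) (z1 : sqmod z < 1).
Context d (Omega : measurableType d) (P : probability Omega R) (X : Omega -> set (pt R)).
Hypothesis HX : is_DPP_K P X.

Lemma relcompact_U N : 0 < N -> relcompact (U N z).
Proof.
move=> N0; have dl0 : 0 < depth z N by rewrite divr_gt0 ?expR_gt0 // hdec_hi_gt0.
exists (1 - depth z N); split; first by rewrite gtrBl.
by move=> x Ux /=; have := bgap_U z1 Ux; rewrite /bgap /nrm2 -/(depth z N); lra.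
Qed.

Lemma A2normsq_Theta N w : 0 < N -> A2normsq (Theta s z N (X w)) = (stat s z X N w)%:E.
Proof.
move=> N0; have rU := relcompact_U N0; have fU := (HX.1 w).2 _ rU.
have inU x : x \in pts X (U N z) w -> U N z x by rewrite (mem_pts HX _ _ rU) inE => -[].
rewrite /stat /pair_stat -(@A2normsq_sum R (pt R) (weight s z) id (pts X (U N z) w)); last by move=> x /inU[].
congr A2normsq; apply/funext => p; rewrite /Theta fsbig_finite //.
apply: eq_big_seq => x xs; have [Dx _] := inU x xs.
by rewrite expR_dh.
Qed.

Let al := 3 - 2 * s.
(** The bound al/4 keeps al - 2 ep positive, and s - 1 is the limit of the interpolation in
    [sum_oneBJV_le]. *)
Let ep := Num.min (al / 4) (s - 1).
Let tau (n : nat) : R := expR (- n%:R).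

Lemma stat_ratio : exists C rho (n0 : nat), [/\ 0 <= C, 0 <= rho < 1, (0 < n0)%N &
  forall n, (n0 <= n)%N -> 0 < \int[P]_w stat s z X n%:R w /\
    \int[P]_w (stat s z X n%:R w ^+ 2) - (\int[P]_w stat s z X n%:R w) ^+ 2 <=
    C * rho ^+ n * (\int[P]_w stat s z X n%:R w) ^+ 2].
Proof.
have s1' := s1; have s2' := s2.
have ep0 : 0 < ep by rewrite lt_min /al; apply/andP; split; lra.
have eps : ep <= s - 1 by rewrite ge_min lexx orbT.
have epa : ep <= al / 4 by rewrite ge_min lexx.
have lo0 := hdec_lo_gt0 z1; have hi0 := hdec_hi_gt0 z1.
set lo := hdec_lo z in lo0; set hi := hdec_hi z in hi0.
pose ka := lo / (4 * hi); have ka0 : 0 < ka by rewrite divr_gt0 // mulr_gt0.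
pose k1 := ka / (1 + ka); have k10 : 0 < k1 by rewrite divr_gt0 // addr_gt0.
(* From [stat_mean_ge] with T = tau/lo: (2T)^(-4) T/4 = lo^3 / (64 tau^3), and tau^(2s-3) =
   tau^(-al). *)
pose K2 := lo ^+ 3 * k1 / 64.
have K20 : 0 < K2 by rewrite divr_gt0 // mulr_gt0 // exprn_gt0.
pose A := 7584 * (((hi `^ s) ^+ 2 * (1 + 3 / ep)) ^+ 2).
have A0 : 0 <= A by apply: mulr_ge0; [exact: ler0n|exact: sqr_ge0].
pose K1 := A * ((hi^-1) `^ (- (al + 2 * ep)) * (2 / (2 * s - 2))).
have s3 : 0 <= 2 / (2 * s - 2) by rewrite divr_ge0 //; lra.
have K10 : 0 <= K1 by apply: mulr_ge0 => //; apply: mulr_ge0 => //; exact: powR_ge0.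
pose ga := al - 2 * ep; have ga0 : 0 < ga by rewrite /ga /al in epa *; lra.
have t0 n : 0 < tau n by exact: expR_gt0.
(* This is the condition 4T <= 1; exp(n) >= 1 + n suffices for it. *)
have [n1 Hn1] : exists n1 : nat, forall n, (n1 <= n)%N -> 4 * tau n <= lo.
  exists (Num.truncn (4 / lo)).+1 => n hn.
  have h1 : 4 / lo < n%:R.
    have /andP[_ h] := truncn_itv (ltW (divr_gt0 (ltr0n R 4) lo0)).
    by apply: lt_le_trans h _; rewrite ler_nat.
  rewrite /tau expRN ler_pdivrMr ?expR_gt0 // -ler_pdivrMl // mulrC.
  by apply: le_trans (ltW h1) _; apply: le_trans (expR_ge1Dx _); lra.
exists (K1 / K2 ^+ 2), (expR (- ga)), (maxn n1 1); split.
- by rewrite divr_ge0 ?sqr_ge0.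
- by rewrite expR_ge0 /= -[ltRHS]expR0 ltr_expR oppr_lt0.
- by rewrite leq_max orbT.
move=> n; rewrite geq_max => /andP[n1n n0].
have nR : 0 < n%:R :> R by rewrite ltr0n.
have tn := t0 n; have tlo := Hn1 n n1n.
have Mge := stat_mean_ge s1 z1 HX nR tlo.
have Vle := stat_variance_le s1 s2 z1 HX nR ep0 eps.
set E := \int[P]_w stat s z X n%:R w in Mge Vle *.
have ME : K2 * tau n `^ (- al) <= E.
  apply: le_trans Mge; rewrite le_eqVlt; apply/orP; left; apply/eqP.
  rewrite -/(tau n) -/lo -/hi -/ka -/k1.
  have -> : (tau n `^ s) ^+ 2 = tau n `^ (- al) * tau n ^+ 3.
    rewrite -(powR_mulrn 3 (ltW tn)) expr2 -!powRD_gt0 //; congr (_ `^ _); rewrite /al; ring.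
  by rewrite /K2; field; rewrite !gt_eqF.
have ta0 : 0 < tau n `^ (- al) by rewrite powR_gt0.
have E0 : 0 < E by apply: lt_le_trans ME; rewrite mulr_gt0.
split => //.
apply: le_trans Vle _.
have -> : depth z n%:R `^ (- (3 - 2 * s + 2 * ep)) = tau n `^ (- (al + 2 * ep)) * (hi^-1) `^ (- (al + 2 * ep)).
  by rewrite /depth powRM ?invr_ge0 ?(ltW tn) ?(ltW hi0).
have rhoE : expR (- ga) ^+ n = tau n `^ ga.
  by rewrite /powR gt_eqF // /tau expRK -expRM_natl; congr expR; ring.
rewrite rhoE; apply: le_trans (_ : K1 / K2 ^+ 2 * tau n `^ ga * (K2 * tau n `^ (- al)) ^+ 2 <= _); last first.
  apply: ler_wpM2l; first by apply: mulr_ge0; [rewrite divr_ge0 ?sqr_ge0|exact: powR_ge0].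
  by rewrite lerXn2r ?nnegrE ?(ltW E0) // mulr_ge0 // ltW.
(* Since -(al + 2 ep) = ga - 2 al, division by the squared mean leaves only tau^ga = exp(-ga n). *)
have tE : tau n `^ (- (al + 2 * ep)) = tau n `^ ga * (tau n `^ (- al)) ^+ 2.
  by rewrite expr2 -!powRD_gt0 //; congr (_ `^ _); rewrite /ga; ring.
rewrite tE le_eqVlt; apply/orP; left; apply/eqP.
rewrite /K1 -/hi /A.
move: (7584 : R) (tau n `^ ga) (tau n `^ (- al)) ((hi^-1) `^ _) (hi `^ s) (2 / _) (3 / ep) => c1 c2 c3 c4 c5 c6 c7.
by field; rewrite gt_eqF.
Qed.

End Conclusion.

Unset Implicit Arguments.

Theorem theorem1p2 (R : realType) (s : R) (z : R[i])
  (d : measure_display) (Omega : measurableType d) (P : probability Omega R)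
  (X : Omega -> set (pt R)) :
  1 < s -> s < 3 / 2 -> sqmod z < 1 ->
  is_DPP_K P X ->
  {ae P, forall w,
     (fun N : nat =>
        fine (A2normsq (Theta s z N%:R (X w))) /
        fine (\int[P]_v A2normsq (Theta s z N%:R (X v)))%E) @ \oo --> (1 : R)}.
Proof.
move=> s1 s2 z1 HX.
have [C [rho [n0 [C0 rho01 n00 H]]]] := stat_ratio s1 s2 z1 HX.
have nR n : (n0 <= n)%N -> 0 < n%:R :> R by move=> h; rewrite ltr0n (leq_trans n00).
have [A [mA PA HA]] := ae_ratio_cvg C0 rho01
  (fun n h => integrable_stat s1 z1 HX (nR n h))
  (fun n h => integrable_stat2 s1 z1 HX (nR n h))
  (fun n h => (H n h).1) (fun n h => (H n h).2).
exists A; split => // w /= nw; apply: HA => /= cw; apply: nw.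
(* Only large N matter; n0 >= 1 ensures N > 0, under which the norm is identified with [stat]. *)
apply: cvg_trans cw; apply: near_eq_cvg; exists n0 => // n /= h.
rewrite (A2normsq_Theta s z1 HX w (nR n h)) /=; congr (_ / fine _).
by apply: eq_integral => v _; rewrite (A2normsq_Theta s z1 HX v (nR n h)).
Qed.
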